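(* Let $p\ge 3$ and $\boldsymbol{\Sigma}=\mathrm{diag}(\sigma_1^2,\dots,\sigma_p^2)$ with $\sigma_1^2>\sigma_2^2>\dots>\sigma_p^2>0$. Let $\boldsymbol{\delta}_*$ be the generalized Bayes estimator with respect to the (improper) hierarchical prior $$\boldsymbol{\theta}\,|\,\lambda\sim N_p\big(\boldsymbol{0},(\sigma_1^2/\lambda)\boldsymbol{I}-\boldsymbol{\Sigma}\big),\qquad \pi(\lambda)\propto\lambda^{-2}I_{(0,1)}(\lambda),$$ that is, $$\boldsymbol{\delta}_*(\boldsymbol{x})=\left(\boldsymbol{I}-\boldsymbol{G}\,\frac{\phi_*(z)}{z}\right)\boldsymbol{x},\qquad \boldsymbol{G}=\boldsymbol{\Sigma}/\sigma_1^2,\quad z=\boldsymbol{x}^{\mathsf T}\boldsymbol{G}\boldsymbol{\Sigma}^{-1}\boldsymbol{x}=\|\boldsymbol{x}\|^2/\sigma_1^2,$$ $$\phi_*(z)=z\,\frac{\int_0^1\lambda^{p/2-1}\exp(-z\lambda/2)\,d\lambda}{\int_0^1\lambda^{p/2-2}\exp(-z\lambda/2)\,d\lambda}.$$ Then: (1) $\boldsymbol{\delta}_*$ is ensemble minimax (with respect to $\mathcal{P}_\star$). (2) $\boldsymbol{\delta}_*$ is ordinary minimax when $$2\left(\sum_{i=1}^p\frac{\sigma_i^4}{\sigma_1^4}-2\right)\ge p-2.$$ (3) $\boldsymbol{\delta}_*$ is admissible in the conventional sense.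
   Context: One observes $\boldsymbol{X}\sim N_p(\boldsymbol{\theta},\boldsymbol{\Sigma})$ with $\boldsymbol{\Sigma}$ known and $\boldsymbol{\theta}\in\mathbb{R}^p$ unknown. An estimator is a measurable map $\boldsymbol{\delta}:\mathbb{R}^p\to\mathbb{R}^p$ (it only needs to be defined almost everywhere). Its risk is $R(\boldsymbol{\delta},\boldsymbol{\theta})=E\left[\|\boldsymbol{\delta}(\boldsymbol{X})-\boldsymbol{\theta}\|^2\right]$, where $\boldsymbol{X}\sim N_p(\boldsymbol{\theta},\boldsymbol{\Sigma})$. An estimator $\boldsymbol{\delta}$ is (ordinary) minimax if $\sup_{\boldsymbol{\theta}\in\mathbb{R}^p}R(\boldsymbol{\delta},\boldsymbol{\theta})=\inf_{\boldsymbol{\delta}'}\sup_{\boldsymbol{\theta}\in\mathbb{R}^p}R(\boldsymbol{\delta}',\boldsymbol{\theta})$, the infimum being over all estimators. It is admissible (in the conventional sense) if there is no estimator $\boldsymbol{\delta}'$ with $R(\boldsymbol{\delta}',\boldsymbol{\theta})\le R(\boldsymbol{\delta},\boldsymbol{\theta})$ for all $\boldsymbol{\theta}\in\mathbb{R}^p$ and strict inequality for some $\boldsymbol{\theta}$. For $\tau\in(0,\infty)$ the ensemble risk is $$\bar R(\boldsymbol{\delta},\tau)=\int_{\mathbb{R}^p}R(\boldsymbol{\delta},\boldsymbol{\theta})\frac{1}{(2\pi\tau)^{p/2}}\exp\left(-\frac{\|\boldsymbol{\theta}\|^2}{2\tau}\right)d\boldsymbol{\theta}.$$ Let $\mathcal{P}_\star=\{N_p(\boldsymbol{0},\tau\boldsymbol{I}_p):\tau\in(0,\infty)\}$.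 An estimator $\boldsymbol{\delta}$ is called ensemble minimax (with respect to $\mathcal{P}_\star$) if $\sup_{\tau\in(0,\infty)}\bar R(\boldsymbol{\delta},\tau)=\inf_{\boldsymbol{\delta}'}\sup_{\tau\in(0,\infty)}\bar R(\boldsymbol{\delta}',\tau)$, the infimum being over all estimators $\boldsymbol{\delta}'$. *)

(* Defs.v *)
From HB Require Import structures.
From mathcomp Require Import all_boot all_order all_algebra.
From mathcomp Require Import all_classical all_reals all_analysis.

Set Implicit Arguments.
Unset Strict Implicit.
Unset Printing Implicit Defensive.

Import Order.TTheory GRing.Theory Num.Theory.
Import numFieldNormedType.Exports.

Local Open Scope classical_set_scope.
Local Open Scope ring_scope.

(* R^n is [n.-tuple R] with the library's product sigma-algebra, i.e. the
   Borel sets of R^n. *)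

Definition tuple_cons {R : realType} {n : nat} (xt : measurableTypeR R * n.-tuple R) : n.+1.-tuple R :=
  [tuple of (xt.1 : R) :: xt.2].

Section lebesgue_cons.
Context {R : realType} {n : nat}.
Variable m : {sigma_finite_measure set (n.-tuple R) -> \bar R}.

Lemma measurable_tuple_cons :
  measurable_fun [set: measurableTypeR R * n.-tuple R] (@tuple_cons R n).
Proof. exact: measurable_cons. Qed.

Definition lebesgue_cons : set (n.+1.-tuple R) -> \bar R :=
  pushforward (@lebesgue_measure R \x m)%E (@tuple_cons R n).

Let lebesgue_cons0 : lebesgue_cons set0 = 0%E.
Proof. by rewrite /lebesgue_cons /pushforward preimage_set0 measure0. Qed.

Let lebesgue_cons_ge0 A : (0 <= lebesgue_cons A)%E.
Proof. by rewrite /lebesgue_cons /pushforward; apply: (measure_ge0 (product_measure1 _ _)). Qed.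

Let lebesgue_cons_sigma_additive : semi_sigma_additive lebesgue_cons.
Proof.
move=> F mF tF mUF; rewrite /lebesgue_cons /pushforward preimage_bigcup.
apply: measure_semi_sigma_additive.
- by move=> k; rewrite -[X in measurable X]setTI; exact: measurable_tuple_cons.
- apply/trivIsetP => /= i j _ _ ij; rewrite -preimage_setI.
  by move/trivIsetP : tF => /(_ _ _ _ _ ij) ->//; rewrite preimage_set0.
- rewrite -preimage_bigcup -[X in measurable X]setTI.
  exact: measurable_tuple_cons.
Qed.

HB.instance Definition _ := isMeasure.Build _ _ _ lebesgue_cons
  lebesgue_cons0 lebesgue_cons_ge0 lebesgue_cons_sigma_additive.

Let lebesgue_cons_sigma_finite : sigma_finite setT lebesgue_cons.
Proof.
have /sigma_finiteP[F [TF ndF mF]] := sigma_finiteT (@lebesgue_measure R).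
have /sigma_finiteP[G [TG ndG mG]] := sigma_finiteT m.
pose u (t : n.+1.-tuple R) : measurableTypeR R * n.-tuple R := (thead t, [tuple of behead t]).
have uK : cancel (@tuple_cons R n) u.
  move=> [x t]; rewrite /u /tuple_cons /= theadE; congr pair; exact/val_inj.
have mu : measurable_fun setT u.
  apply/measurable_fun_pair; [exact: measurable_tnth|exact: measurable_behead].
exists (fun k => u @^-1` (F k `*` G k)).
  rewrite -preimage_bigcup -(preimage_setT u) -setXTT TF TG; congr (_ @^-1` _).
  rewrite predeqE => -[x y]; split; last by move=> [k _ []/= ? ?]; split; exists k.
  move=> [/= [k _ Fkx] [l _ Gly]]; exists (maxn k l) => //; split => /=.
  - by move: x Fkx; exact/subsetPset/ndF/leq_maxl.
  - by move: y Gly; exact/subsetPset/ndG/leq_maxr.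
move=> k; have [mFk Fkoo] := mF k; have [mGk Gkoo] := mG k; split.
  by rewrite -[X in measurable X]setTI; apply: mu => //; exact: measurableX.
rewrite /lebesgue_cons /pushforward -comp_preimage (_ : u \o _ = id); last first.
  by apply/funext => x; rewrite /= uK.
by rewrite preimage_id product_measure1E// lte_mul_pinfty// ge0_fin_numE.
Qed.

HB.instance Definition _ := Measure_isSigmaFinite.Build _ _ _ lebesgue_cons
  lebesgue_cons_sigma_finite.

End lebesgue_cons.

(* Lebesgue measure on R^n: the n-fold product of [lebesgue_measure], as
   lebesgue_measure \x (measure on R^n) transported along [tuple_cons]. *)
Fixpoint lebesgue_tuple (R : realType) (n : nat) :
    {sigma_finite_measure set (n.-tuple R) -> \bar R} :=
  if n is n'.+1 return {sigma_finite_measure set (n.-tuple R) -> \bar R}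
  then lebesgue_cons (lebesgue_tuple R n')
  else dirac [tuple].

Definition colv {R : realType} {p : nat} (x : p.-tuple R) : 'cV[R]_p :=
  \col_i tnth x i.

Definition sqnorm {R : realType} {p : nat} (v : 'cV[R]_p) : R :=
  \sum_i v i 0 ^+ 2.

(* Density of N_p(mu, S); meaningful for S positive definite. *)
Definition mvn_pdf {R : realType} {p : nat} (mu : 'cV[R]_p) (S : 'M[R]_p)
    (x : 'cV[R]_p) : R :=
  ((2 * pi) `^ (p%:R / 2) * Num.sqrt (\det S))^-1 *
  expR (- ((x - mu)^T *m invmx S *m (x - mu)) 0 0 / 2).

Section decision_theory.
Context {R : realType} {p : nat}.
Variable S : 'M[R]_p.
Implicit Types (delta : p.-tuple R -> p.-tuple R) (theta x a : p.-tuple R).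

Local Notation leb := (lebesgue_tuple R p).

(* An estimator defined only almost everywhere is represented by any of its
   measurable total extensions: the risks below do not depend on the choice. *)
Definition estimator : set (p.-tuple R -> p.-tuple R) :=
  [set delta | measurable_fun [set: p.-tuple R] delta].

(* E ||delta(X) - theta||^2 for X ~ N_p(theta, S), possibly +oo. *)
Definition risk delta theta : \bar R :=
  (\int[leb]_x (sqnorm (colv (delta x) - colv theta) *
                mvn_pdf (colv theta) S (colv x))%:E)%E.

Definition sup_risk delta : \bar R := ereal_sup (range (risk delta)).

Definition minimax delta : Prop :=
  estimator delta /\
  sup_risk delta = ereal_inf [set sup_risk delta' | delta' in estimator].

Definition admissible delta : Prop :=
  estimator delta /\
  ~ exists delta', [/\ estimator delta',
      forall theta, (risk delta' theta <= risk delta theta)%E &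
      exists theta, (risk delta' theta < risk delta theta)%E].

Definition ensemble_risk delta (tau : R) : \bar R :=
  (\int[leb]_theta (risk delta theta *
     (((2 * pi * tau) `^ (p%:R / 2))^-1 *
      expR (- (sqnorm (colv theta) / (2 * tau))))%:E))%E.

Definition sup_ensemble_risk delta : \bar R :=
  ereal_sup [set ensemble_risk delta tau | tau in [set tau : R | 0 < tau]].

Definition ensemble_minimax delta : Prop :=
  estimator delta /\
  sup_ensemble_risk delta =
    ereal_inf [set sup_ensemble_risk delta' | delta' in estimator].

(* Hierarchical, possibly improper, prior: theta | l ~ N_p(0, C l) and l has
   the unnormalized density w on D. *)
Variables (C : R -> 'M[R]_p) (w : R -> R) (D : set R).

Definition prior_integral (h : p.-tuple R -> R) : \bar R :=
  (\int[@lebesgue_measure R]_(l in D) ((w l)%:E *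
     \int[leb]_theta (h theta * mvn_pdf 0 (C l) (colv theta))%:E))%E.

Definition marginal x : \bar R :=
  prior_integral (fun theta => mvn_pdf (colv theta) S (colv x)).

(* Posterior expected squared-error loss of the action a, multiplied by the
   marginal density at x. *)
Definition posterior_loss x a : \bar R :=
  prior_integral (fun theta =>
    sqnorm (colv a - colv theta) * mvn_pdf (colv theta) S (colv x)).

Definition generalized_bayes delta : Prop :=
  estimator delta /\
  {ae leb, forall x, [/\ (0 < marginal x < +oo)%E,
     (posterior_loss x (delta x) < +oo)%E &
     forall a, (posterior_loss x (delta x) <= posterior_loss x a)%E]}.

End decision_theory.

(* The index of sigma_1: coordinates are numbered from 0. *)
Definition first_ord {p : nat} (hp : (3 <= p)%N) : 'I_p :=
  Ordinal (leq_trans (ltn0Sn 2) hp).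

Definition phi_star {R : realType} (p : nat) (z : R) : R :=
  z * ((\int[@lebesgue_measure R]_(l in `]0, 1[)
          (l `^ (p%:R / 2 - 1) * expR (- (z * l / 2)))) /
       (\int[@lebesgue_measure R]_(l in `]0, 1[)
          (l `^ (p%:R / 2 - 2) * expR (- (z * l / 2))))).

(* s1 stands for sigma_1^2. At x = 0 the quotient phi_star p z / z is 0 by
   convention, which is harmless since it multiplies x. *)
Definition delta_star {R : realType} {p : nat} (s1 : R) (S : 'M[R]_p)
    (x : p.-tuple R) : p.-tuple R :=
  let G := s1^-1 *: S in
  let z := ((colv x)^T *m G *m invmx S *m colv x) 0 0 in
  let v := (1%:M - (phi_star p z / z) *: G) *m colv x in
  [tuple v i 0 | i < p].

(* Main.v *)
Require Import Defs.
From HB Require Import structures.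
From mathcomp Require Import all_boot all_order all_algebra.
From mathcomp Require Import all_classical all_reals all_analysis.
From mathcomp Require Import measurable_realfun.
From mathcomp Require Import ring lra.

Set Implicit Arguments.
Unset Strict Implicit.
Unset Printing Implicit Defensive.

Import Order.TTheory GRing.Theory Num.Theory.
Import numFieldNormedType.Exports.

Local Open Scope classical_set_scope.
Local Open Scope ring_scope.

(** Write [s i] for the variances, [s1] for the largest of them, [z = |x|^2 / s1],
    [b = p / 2 - 2] and [w = shrink b z = phi_star p z / z]: the estimator
    multiplies the [i]-th coordinate by [1 - s i / s1 * w].

    Given the mixing variable [l], the observation has marginal law
    [N (0, (s1 / l) I)], so the law of [l] given [x] has density proportional to
    [l ^ b * exp (- z l / 2)] on [(0, 1)] and depends on [x] through [z] only;
    [w] is its mean, so that [0 < w <= 1].  Integrating the derivative of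
    [l ^ (b + 1) * exp (- z l / 2)] gives a recurrence between the integrals of this
    kernel ([kernel_integral_rec]), whence [z w <= p - 2] and [- w <= z w'].  The
    posterior loss given [l] is quadratic in the action,
    with minimum at the coordinates [(1 - l * s i / s1) * x i]; averaging over [l]
    replaces [l] by [w], so the estimator is generalized Bayes.

    Minimaxity.  Under the prior [N (0, tau I)] the Bayes risk is the sum of the
    [tau * s i / (tau + s i)], which tends to the sum of the [s i] as [tau] grows.
    Both minimax values are therefore at least that sum
    ([sup_ensemble_risk_ge], [sup_risk_ge]), and upper bounds on the risks suffice.
    For the ordinary risk, Stein's identity writes the risk as the sum of the [s i]
    plus the expectation of a function that the condition on the variances makes
    nonpositive ([risk_shrinkage_le]).  For the ensemble risk, integrating over
    [theta] first leaves a comparison of [E (x i ^ 2 w ^ 2)] with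
    [2 s1 / (tau + s i) * E (x i ^ 2 w)] for [x] with independent coordinates of
    variances [tau + s i].  It holds pointwise if [tau <= s1], since [w <= 1]; if
    [tau > s1] it follows from Stein's identity applied to the radial field
    [x i ^ 2 w ^ 2 x] ([radial_bound]).

    Admissibility.  This is Blyth's method with the priors obtained by giving [l]
    the additional weight [cutoff N l ^ 2 = max (0, 1 + ln l / N) ^ 2], which are
    finite.  If another estimator is at least as good everywhere, then its Bayes
    risk in excess of the minimum is at most that of ours
    ([excess_risk_le]), and the latter is [O (1 / N)]
    ([excess_risk_shrinkage_le]).  Excess risks are weighted squared distances to
    a common Bayes estimator and the weights increase with [N], so the two
    estimators are at squared distance [O (1 / N)] for a fixed positive weight.
    They agree almost everywhere and have the same risk.  The rate comes
    from two facts: the recurrence, with the derivative of the cutoff as an extra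
    term, bounds [z] times the change in the posterior mean of [l] by [4 / N] times
    an average of the cutoff ([cutoff_bound]); and the integral over [x] of what
    remains is a multiple of that of [1 / l] over [(exp (- N), 1)], which is [N]
    ([integral_cutoff_zstat]). *)

(** * Integration on the line *)

(** Dominated convergence, the restrictions of [f] to the [E k] being dominated by
    [`|f|]: integrals over unbounded or open sets are reduced to compact pieces,
    where the fundamental theorem of calculus applies. *)
Lemma Rintegral_exhaustion d (T : measurableType d) (R : realType)
    (mu : {measure set T -> \bar R}) (D : set T) (E : (set T)^nat) (f : T -> R)
    (c : R^nat) (l : R) :
  measurable D -> (forall k, measurable (E k)) ->
  (forall x, D x -> \forall k \near \oo, E k x) -> (forall k, E k `<=` D) ->
  mu.-integrable D (EFin \o f) ->
  (forall k, \int[mu]_(x in E k) f x = c k) -> c @ \oo --> l ->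
  \int[mu]_(x in D) f x = l.
Proof.
move=> mD mE DE ED intf Ec cl.
have mf : measurable_fun D f by apply/measurable_EFinP; exact: measurable_int intf.
have cvgE : (\int[mu]_(x in D) (f x * \1_(E k) x)%:E @[k --> \oo] -->
    \int[mu]_(x in D) (f x)%:E)%E.
  apply: (@dominated_cvg _ _ _ mu D mD (fun k x => (f x * \1_(E k) x)%:E) _
    (fun x => `|f x|%:E)) => //.
  - move=> k; apply/measurable_EFinP/measurable_funM => //.
  - move=> x Dx; apply/cvg_EFin; first exact: nearW.
    apply: cvg_near_cst.
    by apply: filterS (DE x Dx) => k Ekx; rewrite /= indicE mem_set// mulr1.
  - by move/integrable_abse : intf.
  - move=> k x Dx /=; rewrite lee_fin normrM ler_piMr//.
    by rewrite indicE; case: (_ \in _); rewrite ?normr1 ?normr0.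
have fin : (\int[mu]_(x in D) (f x)%:E)%E \is a fin_num by exact: integrable_fin_num.
have <- := cvg_lim (@norm_hausdorff _ _) cl; apply/esym/cvg_lim => //.
rewrite (_ : c = fun k => fine (\int[mu]_(x in D) (f x * \1_(E k) x)%:E)%E).
  by apply: fine_cvg; rewrite fineK.
apply/funext => k; rewrite -Ec /Rintegral; congr fine.
rewrite integral_mkcond [RHS]integral_mkcond; apply: eq_integral => x _.
have [Ex|Ex] := boolP (x \in E k); rewrite !patchE.
  by rewrite Ex (mem_set (ED k x (set_mem Ex))) indicE Ex mulr1.
by rewrite (negbTE Ex) indicE (negbTE Ex) mulr0 if_same.
Qed.

Section ftc.
Context {R : realType}.
Local Notation mu := (@lebesgue_measure R).
Implicit Types f F : R -> R.

Lemma Rintegral_FTC f F (a b : R) : a < b ->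
  (forall x, x \in `[a, b] -> is_derive x 1 F (f x)) ->
  {within `[a, b], continuous f} ->
  \int[mu]_(x in `[a, b]) f x = F b - F a.
Proof.
move=> ab dF cf; rewrite /Rintegral (@continuous_FTC2 _ f F a b ab cf)//.
  have cF x : x \in `[a, b] -> {for x, continuous F}.
    move=> xab; apply: differentiable_continuous; apply/derivable1_diffP.
    by case: (dF x xab).
  split.
  - by move=> x xab; have := subset_itv_oo_cc xab => /dF[].
  - apply: cvg_at_right_filter; apply: cF; by rewrite in_itv/= lexx ltW.
  - apply: cvg_at_left_filter; apply: cF; by rewrite in_itv/= lexx ltW.
move=> x xab; rewrite derive1E; have /dF[_] := subset_itv_oo_cc xab; exact.
Qed.

(** The decay of [F] makes both boundary terms vanish in the limit. *)
Lemma Rintegral_derivative_line f F (C : R) :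
  (forall x : R, is_derive x 1 F (f x)) -> continuous f ->
  mu.-integrable [set: R] (EFin \o f) ->
  (forall x, (1 + `|x|) * `|F x| <= C) ->
  \int[mu]_x f x = 0.
Proof.
move=> dF cf intf FC.
have F0 (u : R^nat) : (forall k, `|u k| = k.+1%:R) -> F (u k) @[k --> \oo] --> 0.
  move=> uk; apply: norm_cvg0; apply: (@squeeze_cvgr _ _ _ _ (cst 0) (fun k => C * harmonic k)).
  - apply: nearW => k; rewrite normr_ge0 /= ler_pdivlMr// mulrC -uk.
    by apply: le_trans (FC (u k)); rewrite ler_wpM2r// lerDr.
  - exact: cvg_cst.
  - by rewrite -[0](mulr0 C); apply: cvgMr; exact: cvg_harmonic.
apply: (@Rintegral_exhaustion _ _ _ mu setT (fun k : nat => `[- k.+1%:R, k.+1%:R]%classic) f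
   (fun k => F k.+1%:R - F (- k.+1%:R))) => //.
- move=> x _; near=> k => /=; rewrite in_itv/= -ler_norml.
  apply: (@le_trans _ _ (k%:R)); last by rewrite ler_nat.
  by near: k; exact: nbhs_infty_ger.
- move=> k; apply: Rintegral_FTC => //; last exact: continuous_subspaceT.
  by rewrite -subr_gt0 opprK addr_gt0.
- by rewrite -[0]subr0; apply: cvgB; apply: F0 => k; rewrite ?normrN ger0_norm.
Unshelve. all: by end_near. Qed.

End ftc.

(** * The normal density and Stein's identity *)

(** The parameter is the variance rather than the standard deviation, because
    variances are what adds up in [gauss_conj]. *)
Definition gauss {R : realType} (m v t : R) : R :=
  (Num.sqrt (2 * pi * v))^-1 * expR (- ((t - m) ^+ 2 / (2 * v))).

Section gauss.
Context {R : realType}.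
Local Notation mu := (@lebesgue_measure R).
Implicit Types m v t : R.

Lemma gauss_ge0 m v t : 0 <= gauss m v t.
Proof. by rewrite mulr_ge0 ?expR_ge0// invr_ge0 sqrtr_ge0. Qed.

Lemma gaussE m v : 0 < v -> gauss m v = normal_pdf m (Num.sqrt v).
Proof.
move=> v0; have s0 : Num.sqrt v != 0 by rewrite gt_eqF ?sqrtr_gt0.
apply/funext => t; rewrite normal_pdfE// /gauss /normal_peak /normal_fun.
rewrite sqr_sqrtr ?ltW// -(mulr_natl v) -(mulr_natl (v * pi)) mulNr.
by rewrite -mulrA (mulrC pi).
Qed.

Lemma continuous_gauss m v : 0 < v -> continuous (gauss m v).
Proof.
by move=> v0; rewrite gaussE//; apply: continuous_normal_pdf; rewrite gt_eqF ?sqrtr_gt0.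
Qed.

Lemma measurable_gauss m v : measurable_fun [set: R] (gauss m v).
Proof.
rewrite /gauss; apply: measurable_funM => //; apply: measurableT_comp => //.
apply: measurableT_comp => //; apply: measurable_funM => //.
by apply: measurable_funX; exact: measurable_funB.
Qed.

Lemma integral_gauss m v : 0 < v -> (\int[mu]_t (gauss m v t)%:E = 1)%E.
Proof. by move=> v0; rewrite gaussE// integral_normal_pdf. Qed.

(** Doubling the variance absorbs a quadratic factor, since [y * exp (- y / 2)] is
    bounded for [y >= 0].  Integrability and decay at infinity both reduce to
    this inequality. *)
Lemma gauss_flat m v t : 0 < v ->
  (1 + (t - m) ^+ 2) * gauss m v t <= (2 + 8 * v) * gauss m (2 * v) t.
Proof.
move=> v0; pose y := (t - m) ^+ 2 / (2 * v).
have y0 : 0 <= y by rewrite divr_ge0 ?sqr_ge0// mulr_ge0// ltW.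
have tmy : (t - m) ^+ 2 = 2 * v * y by rewrite mulrC divfK// gt_eqF// mulr_gt0.
have s2 : Num.sqrt 2 <= 2 :> R.
  by rewrite -[leRHS](ger0_norm (ler0n _ _)) -sqrtr_sqr ler_wsqrtr// expr2; lra.
have e1 : expR (- (y / 2)) <= 1 by rewrite -expR0 ler_expR oppr_le0 divr_ge0.
have e2 : y * expR (- (y / 2)) <= 2.
  rewrite expRN ler_pdivrMr ?expR_gt0//.
  by have := expR_ge1Dx (y / 2); lra.
have e0 := expR_ge0 (- (y / 2)).
have -> : gauss m v t = Num.sqrt 2 * expR (- (y / 2)) * gauss m (2 * v) t.
  rewrite /gauss.
  have -> : 2 * pi * (2 * v) = 2 * (2 * pi * v) by ring.
  rewrite (sqrtrM (2 * pi * v))// (invfM (Num.sqrt 2)).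
  have -> : (t - m) ^+ 2 / (2 * (2 * v)) = y / 2.
    by rewrite /y; field; rewrite gt_eqF.
  have -> : - ((t - m) ^+ 2 / (2 * v)) = - (y / 2) + - (y / 2) by rewrite -/y; field.
  rewrite expRD; field.
  by rewrite !gt_eqF ?sqrtr_gt0 ?mulr_gt0 ?pi_gt0.
rewrite mulrA ler_wpM2r ?gauss_ge0// tmy.
have s0 : 0 <= Num.sqrt (2:R) by exact: sqrtr_ge0.
have : (1 + 2 * v * y) * expR (- (y / 2)) <= 1 + 4 * v by nra.
set E := (_ * expR _) => HE.
have : Num.sqrt 2 * E <= 2 * (1 + 4 * v).
  by rewrite ler_pM// /E mulr_ge0//; nra.
by rewrite /E; nra.
Qed.

Lemma gauss_peak m v t : 0 < v -> gauss m v t <= (Num.sqrt (2 * pi * v))^-1.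
Proof.
move=> v0; rewrite ler_piMr ?invr_ge0 ?sqrtr_ge0// -expR0 ler_expR oppr_le0.
by rewrite divr_ge0 ?sqr_ge0// mulr_ge0// ltW.
Qed.

Lemma integrable_gauss m v : 0 < v -> mu.-integrable [set: R] (EFin \o gauss m v).
Proof. by move=> v0; rewrite gaussE//; exact: integrable_normal_pdf. Qed.

Lemma integrable_le_gauss m v (C : R) (f : R -> R) : 0 < v ->
  measurable_fun [set: R] f ->
  (forall t, `|f t| <= C * (1 + (t - m) ^+ 2)) ->
  mu.-integrable [set: R] (EFin \o (fun t => f t * gauss m v t)).
Proof.
move=> v0 mf fC.
have v20 : 0 < 2 * v by rewrite mulr_gt0.
have C0 : 0 <= C.
  by have := le_trans (normr_ge0 _) (fC m); rewrite subrr expr0n addr0 mulr1.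
apply: (@le_integrable _ _ _ mu setT measurableT _
  (EFin \o (fun t => (C * (2 + 8 * v)) * gauss m (2 * v) t))).
- apply/measurable_EFinP/measurable_funM => //; exact: measurable_gauss.
- move=> t _ /=; rewrite lee_fin normrM (ger0_norm (gauss_ge0 _ _ _)).
  apply: le_trans (ler_norm _); rewrite -mulrA.
  apply: (@le_trans _ _ (C * ((1 + (t - m) ^+ 2) * gauss m v t))).
    by rewrite mulrA ler_wpM2r ?gauss_ge0.
  by rewrite ler_wpM2l// gauss_flat.
- have := integrableZl measurableT (C * (2 + 8 * v)) (integrable_gauss m v20).
  exact.
Qed.

Lemma is_derive_gauss m v t : 0 < v ->
  is_derive t 1 (gauss m v) (- (t - m) / v * gauss m v t).
Proof.
move=> v0; rewrite /gauss.
have d1 : is_derive t 1 (fun t : R => - ((t - m) ^+ 2 / (2 * v))) (- (t - m) / v).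
  apply: is_derive_eq; rewrite !scaler0 ?add0r ?addr0 ?subr0 /GRing.scale /=.
  by rewrite mulr1 ; field; rewrite gt_eqF.
apply: is_derive_eq.
by rewrite /GRing.scale /=; ring.
Qed.

(** The integrand is the derivative of [- v * g * gauss m v], which vanishes at
    infinity. *)
Lemma stein (g g' : R -> R) m v (C : R) : 0 < v ->
  (forall t : R, is_derive t 1 g (g' t)) -> continuous g' ->
  (forall t, `|g t| <= C * (1 + `|t - m|)) -> (forall t, `|g' t| <= C) ->
  mu.-integrable [set: R]
    (EFin \o (fun t => ((t - m) * g t - v * g' t) * gauss m v t)) /\
  \int[mu]_t (((t - m) * g t - v * g' t) * gauss m v t) = 0.
Proof.
move=> v0 dg cg' gC g'C.
have cg : continuous g.
  move=> t; apply: differentiable_continuous; apply/derivable1_diffP.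
  by case: (dg t).
have C0 : 0 <= C by exact: le_trans (normr_ge0 _) (g'C m).
have v20 : 0 < 2 * v by rewrite mulr_gt0.
have ct : continuous (fun t => (t - m) * g t - v * g' t).
  move=> t; apply: (@cvgB _ R^o); apply: cvgM; [|exact: cg|exact: cvg_cst|exact: cg'].
  by apply: (@cvgB _ R^o); [exact: cvg_id|exact: cvg_cst].
have int : mu.-integrable [set: R]
    (EFin \o (fun t => ((t - m) * g t - v * g' t) * gauss m v t)).
  apply: (@integrable_le_gauss m v (C * (2 + v))) => //.
    exact: continuous_measurable_fun.
  move=> t; rewrite (le_trans (ler_normB _ _))// !normrM (ger0_norm (ltW v0)).
  have h1 := gC t; have h2 := g'C t.
  have h3 : `|t - m| ^+ 2 = (t - m) ^+ 2 by rewrite real_normK// num_real.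
  have h4 := normr_ge0 (t - m); rewrite -h3.
  move: (`|t - m|) (`|g t|) (`|g' t|) h1 h2 h4 => a b c h1 h2 h4.
  have : a * b <= a * (C * (1 + a)) by rewrite ler_wpM2l.
  have : v * c <= v * C by rewrite ler_wpM2l// ltW.
  have : 0 <= C * (1 - a) ^+ 2 by rewrite mulr_ge0 ?sqr_ge0.
  have : 0 <= C * v * a ^+ 2 by rewrite !mulr_ge0 ?sqr_ge0// ltW.
  nra.
split => //.
apply: (@Rintegral_derivative_line R _ (fun t => - v * g t * gauss m v t)
  (v * (1 + `|m|) * C * 2 * (2 + 8 * v) * (Num.sqrt (2 * pi * (2 * v)))^-1)) => //.
- move=> t; have dgt := dg t; have dG := is_derive_gauss m t v0.
  apply: is_derive_eq; rewrite /GRing.scale /=; field; by rewrite gt_eqF.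
- by move=> t; apply: cvgM; [exact: ct|exact: continuous_gauss].
- move=> t; rewrite normrM (ger0_norm (gauss_ge0 _ _ _)) normrM normrN (ger0_norm (ltW v0)).
  have pk := gauss_peak m t v20.
  have fl := gauss_flat m t v0.
  have tm : 1 + `|t| <= (1 + `|m|) * (1 + `|t - m|).
    have := ler_normD (t - m) m; rewrite subrK => h.
    have := normr_ge0 m; have := normr_ge0 (t - m); nra.
  apply: (@le_trans _ _ ((1 + `|m|) * (1 + `|t - m|) *
      (v * (C * (1 + `|t - m|)) * gauss m v t))).
    have h0 : 0 <= v * `|g t| * gauss m v t by rewrite !mulr_ge0 ?gauss_ge0// ltW.
    apply: ler_pM => //.
    by rewrite ler_wpM2r ?gauss_ge0// ler_wpM2l ?gC// ltW.
  apply: (@le_trans _ _ (v * (1 + `|m|) * C * 2 * ((1 + (t - m) ^+ 2) * gauss m v t))).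
    rewrite [leLHS](_ : _ = v * (1 + `|m|) * C * ((1 + `|t - m|) ^+ 2 * gauss m v t)); last by ring.
    rewrite -[leRHS]mulrA ler_wpM2l ?mulr_ge0 ?addr_ge0// ?(ltW v0)//.
    rewrite mulrA ler_wpM2r ?gauss_ge0//.
    have h3 : `|t - m| ^+ 2 = (t - m) ^+ 2 by rewrite real_normK// num_real.
    have := sqr_ge0 (1 - `|t - m|); rewrite -h3; nra.
  rewrite -[leRHS]mulrA ler_wpM2l ?mulr_ge0 ?addr_ge0// ?(ltW v0)//.
  by apply: le_trans fl _; rewrite ler_wpM2l// addr_ge0// mulr_ge0// ltW.
Qed.

(** For [g t = (t - m) - 2 * (a - m)] the integrand of Stein's identity is
    [(a - t) ^ 2 - ((a - m) ^ 2 + v)] times the density. *)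
Lemma integral_gauss_sqr (a m v : R) : 0 < v ->
  (\int[mu]_t ((a - t) ^+ 2 * gauss m v t)%:E = ((a - m) ^+ 2 + v)%:E)%E.
Proof.
move=> v0.
have intK : mu.-integrable [set: R] (EFin \o (fun t => ((a - m) ^+ 2 + v) * gauss m v t)).
  exact: integrableZl (integrable_gauss m v0).
have [] := @stein (fun t => (t - m) - 2 * (a - m)) (fun=> 1) m v (1 + 2 * `|a - m|) v0.
- move=> t; apply: is_derive_eq; rewrite /GRing.scale /=; ring.
- by move=> t; exact: cvg_cst.
- move=> t; rewrite (le_trans (ler_normB _ _))// normrM ger0_norm//.
  have := normr_ge0 (t - m); have := normr_ge0 (a - m); nra.
- move=> t; rewrite normr1; have := normr_ge0 (a - m); lra.
move=> intS S0.
under eq_integral => t _.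
  rewrite (_ : _ * _ = ((t - m) * (t - m - 2 * (a - m)) - v * 1) * gauss m v t +
   ((a - m) ^+ 2 + v) * gauss m v t); last by ring.
  rewrite EFinD; over.
rewrite integralD//.
have /fineK <- := integrable_fin_num measurableT intS.
rewrite [fine _]S0 add0e.
under eq_integral do rewrite EFinM.
by rewrite integralZl ?integral_gauss ?mule1//; exact: integrable_gauss.
Qed.

End gauss.

(** * The mixing kernel and the shrinkage factor *)

Section powR_integral.
Context {R : realType}.
Local Notation mu := (@lebesgue_measure R).
Implicit Types a z l : R.

(** With [a = p / 2 - 2] and [z = |x|^2 / s1], this is up to a constant the joint
    density of [x] and of the mixing variable [l]; see [gaussp_kernelE]. *)
Definition shrink_kernel a z l : R := l `^ a * expR (- (z * l / 2)).

Definition kernel_integral a z : R :=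
  \int[mu]_(l in `]0, 1[) shrink_kernel a z l.

Lemma measurable_shrink_kernel a z (D : set R) :
  measurable_fun D (shrink_kernel a z).
Proof.
apply: measurable_funTS; apply: measurable_funM; first exact: measurable_powR.
apply: measurableT_comp => //; apply: measurableT_comp => //.
by apply: measurable_funM => //; exact: measurable_funM.
Qed.

Lemma shrink_kernel_ge0 a z l : 0 <= shrink_kernel a z l.
Proof. by rewrite mulr_ge0 ?powR_ge0 ?expR_ge0. Qed.

Lemma shrink_kernel_gt0 a z l : 0 < l -> 0 < shrink_kernel a z l.
Proof. by move=> l0; rewrite mulr_gt0 ?powR_gt0 ?expR_gt0. Qed.

Lemma shrink_kernelS a z l : 0 < l ->
  shrink_kernel (a + 1) z l = shrink_kernel a z l * l.
Proof.
move=> l0; rewrite /shrink_kernel powRD ?powRr1 ?ltW//; first by rewrite mulrAC.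
by rewrite (gt_eqF l0) implybT.
Qed.

Lemma is_derive_shrink_kernel a z l : 0 < l ->
  is_derive l 1 (shrink_kernel (a + 1) z)
    ((a + 1) * shrink_kernel a z l - z / 2 * shrink_kernel (a + 1) z l).
Proof.
move=> l0; have dp := is_derive1_powR (a + 1) l0.
rewrite /shrink_kernel; apply: is_derive_eq.
rewrite !scaler0 ?add0r ?addr0 /GRing.scale /= mulr1 addrK; ring.
Qed.

Lemma continuous_shrink_kernel a z l : 0 < l ->
  {for l, continuous (shrink_kernel a z)}.
Proof.
move=> l0; apply: differentiable_continuous; apply/derivable1_diffP.
by have := is_derive_shrink_kernel (a - 1) z l0; rewrite subrK => -[].
Qed.

Lemma within_continuous_pos (f : R -> R) (u v : R) : 0 < u ->
  (forall l, 0 < l -> {for l, continuous f}) -> {within `[u, v], continuous f}.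
Proof.
move=> u0 cf; apply: continuous_in_subspaceT => l.
by rewrite inE /= in_itv/= => /andP[ul _]; apply: cf; exact: lt_le_trans ul.
Qed.

Lemma Rintegral_shrink_kernel_FTC a z (e : R) : 0 < e -> e < 1 ->
  \int[mu]_(l in `[e, 1]) ((a + 1) * shrink_kernel a z l - z / 2 * shrink_kernel (a + 1) z l)
  = expR (- (z / 2)) - shrink_kernel (a + 1) z e.
Proof.
move=> e0 e1.
have dk l : l \in `[e, 1] -> is_derive l 1 (shrink_kernel (a + 1) z)
    ((a + 1) * shrink_kernel a z l - z / 2 * shrink_kernel (a + 1) z l).
  rewrite in_itv/= => /andP[el _]; apply: is_derive_shrink_kernel.
  exact: lt_le_trans el.
rewrite (Rintegral_FTC e1 dk); first by rewrite {1}/shrink_kernel powR1 mul1r mulr1.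
apply: within_continuous_pos => // l l0; apply: (@cvgB _ R^o).
  by apply: cvgM; [exact: cvg_cst|exact: continuous_shrink_kernel].
by apply: cvgM; [exact: cvg_cst|exact: continuous_shrink_kernel].
Qed.

Let eps (k : nat) : R := (k.+2%:R)^-1.
Let eps_gt0 k : 0 < eps k. Proof. by rewrite invr_gt0. Qed.
Let eps_lt1 k : eps k < 1. Proof. by rewrite invf_lt1// ltr1n. Qed.
Let eps_cvg : eps k @[k --> \oo] --> 0.
Proof.
have := @cvg_harmonic R; rewrite -(cvg_shiftS (@harmonic R)); exact.
Qed.

Let eps_bigcup : \bigcup_k `[eps k, 1[%classic = `]0, 1[%classic :> set R.
Proof.
apply/seteqP; split => l.
  move=> [k _] /=; rewrite !in_itv/= => /andP[el ->].
  by rewrite andbT (lt_le_trans (eps_gt0 k)).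
rewrite /= in_itv/= => /andP[l0 l1].
have /cvgrPdist_lt/(_ _ l0)[k _ /(_ k (leqnn k))] := eps_cvg.
rewrite sub0r normrN ger0_norm ?ltW// => el.
by exists k => //=; rewrite in_itv/= l1 andbT ltW.
Qed.

(** For [a < 0] the integrand is unbounded at 0, so the integral is bounded by
    monotone convergence from the intervals [`[eps k, 1[]. *)
Lemma integrable_powR01 a : -1 < a ->
  mu.-integrable `]0, 1[ (EFin \o (fun l => l `^ a)).
Proof.
move=> a1; have a10 : 0 < a + 1 by lra.
apply/integrableP; split.
  by apply/measurable_EFinP/measurable_funTS; exact: measurable_powR.
under eq_integral do rewrite /= ger0_norm ?powR_ge0//.
have cv : (\int[mu]_(l in `[eps k, 1%R[) (l `^ a)%:E @[k --> \oo] -->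
    \int[mu]_(l in `]0%R, 1%R[) (l `^ a)%:E)%E.
  rewrite -eps_bigcup; apply: ge0_nondecreasing_set_cvg_integral => //.
  - move=> m n mn; apply/subsetPset => l /=; rewrite !in_itv/= => /andP[el ->].
    by rewrite andbT (le_trans _ el)// lef_pV2 ?posrE// ler_nat.
  - by move=> k; apply/measurable_EFinP/measurable_funTS; exact: measurable_powR.
  - by move=> k l _; rewrite lee_fin powR_ge0.
apply: (@le_lt_trans _ _ ((a + 1)^-1)%:E); last by rewrite ltry.
rewrite -(cvg_lim _ cv)//; apply: lime_le; first by apply/cvg_ex; eexists; exact: cv.
apply: nearW => k.
rewrite integral_itv_bndo_bndc; last first.
  by apply/measurable_EFinP/measurable_funTS; exact: measurable_powR.
have := @Rintegral_shrink_kernel_FTC a 0 (eps k) (eps_gt0 k) (eps_lt1 k).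
have E0 : shrink_kernel a 0 = (fun l : R => l `^ a).
  by apply/funext => l; rewrite /shrink_kernel !mul0r oppr0 expR0 mulr1.
have int : mu.-integrable `[eps k, 1] (EFin \o (fun l => l `^ a)).
  apply: continuous_compact_integrable; first exact: segment_compact.
  apply: within_continuous_pos => // l l0.
  rewrite -E0; exact: continuous_shrink_kernel.
under eq_Rintegral => l _.
  rewrite E0 !mul0r subr0; over.
rewrite RintegralZl// /shrink_kernel !mul0r oppr0 expR0 mulr1 => h.
rewrite -[leLHS]fineK; last exact: integrable_fin_num.
rewrite lee_fin -[fine _]/(Rintegral mu _ _).
by rewrite -(ler_pM2l a10) divff ?gt_eqF// h gerBl powR_ge0.
Qed.

Lemma shrink_kernel_le a z l : 0 < l < 1 ->
  shrink_kernel a z l <= expR (`|z| / 2) * l `^ a.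
Proof.
move=> /andP[l0 l1]; rewrite /shrink_kernel mulrC ler_wpM2r ?powR_ge0// ler_expR -mulNr.
rewrite ler_wpM2r// -mulNr (le_trans (ler_norm _))// normrM normrN.
by rewrite ler_piMr// ger0_norm ltW.
Qed.

Lemma integrable_shrink_kernel a z : -1 < a ->
  mu.-integrable `]0, 1[ (EFin \o shrink_kernel a z).
Proof.
move=> a1; apply: (@le_integrable _ _ _ mu _ _ _
  (EFin \o (fun l => expR (`|z| / 2) * l `^ a))) => //.
- by apply/measurable_EFinP; exact: measurable_shrink_kernel.
- move=> l; rewrite /= in_itv/= => l01.
  rewrite lee_fin ger0_norm ?shrink_kernel_ge0//.
  by apply: le_trans (ler_norm _); exact: shrink_kernel_le.
- exact: integrableZl (integrable_powR01 a1).
Qed.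

(** Integration of [is_derive_shrink_kernel]; the boundary term at 0 vanishes
    because [-1 < a]. *)
Lemma kernel_integral_rec a z : -1 < a ->
  z * kernel_integral (a + 1) z =
  2 * (a + 1) * kernel_integral a z - 2 * expR (- (z / 2)).
Proof.
move=> a1; have i0 := integrable_shrink_kernel z a1.
have i1 : mu.-integrable `]0, 1[ (EFin \o shrink_kernel (a + 1) z).
  by apply: integrable_shrink_kernel; lra.
have j0 : mu.-integrable `]0, 1[ (EFin \o (fun l => (a + 1) * shrink_kernel a z l)).
  exact: integrableZl i0.
have j1 : mu.-integrable `]0, 1[ (EFin \o (fun l => z / 2 * shrink_kernel (a + 1) z l)).
  exact: integrableZl i1.
have : \int[mu]_(l in `]0, 1[) ((a + 1) * shrink_kernel a z l -
   z / 2 * shrink_kernel (a + 1) z l) = expR (- (z / 2)).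
  apply: (@Rintegral_exhaustion _ _ _ mu `]0, 1[%classic (fun k => `[eps k, 1[%classic)
    (fun l => (a + 1) * shrink_kernel a z l - z / 2 * shrink_kernel (a + 1) z l)
    (fun k => expR (- (z / 2)) - shrink_kernel (a + 1) z (eps k))) => //.
  - move=> l; rewrite /= in_itv/= => /andP[l0 l1].
    near=> k; rewrite /= in_itv/= l1 andbT ltW//.
    by near: k; exact: (cvgr_lt _ eps_cvg).
  - move=> k l; rewrite /= !in_itv/= => /andP[el ->].
    by rewrite andbT (lt_le_trans _ el).
  - have := integrableB _ j0 j1; apply => //.
  - move=> k; rewrite Rintegral_itv_bndo_bndc; first exact: Rintegral_shrink_kernel_FTC.
    apply: (integrableS _ _ _ (integrableB _ j0 j1)) => //.
    by move=> l; rewrite /= !in_itv/= => /andP[el ->]; rewrite andbT (lt_le_trans _ el).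
  - rewrite -[X in _ --> X]subr0; apply: (@cvgB _ R^o); first exact: cvg_cst.
    apply: (@squeeze_cvgr _ _ _ _ (cst 0) (fun k => expR (`|z| / 2) * eps k `^ (a + 1))).
    + by apply: nearW => k; rewrite shrink_kernel_ge0 shrink_kernel_le// eps_gt0 eps_lt1.
    + exact: cvg_cst.
    + rewrite -[X in _ --> X](mulr0 (expR (`|z| / 2))); apply: cvgMr.
      have a10 : 0 < a + 1 by lra.
      by have /cvg_at_rightP := powR_cvg0 a10; apply; split.
rewrite RintegralB// !RintegralZl// -/(kernel_integral _ _) -/(kernel_integral _ _).
lra.
Unshelve. all: by end_near. Qed.

Lemma kernel_integral_gt0 a z : -1 < a -> 0 < kernel_integral a z.
Proof.
move=> a1; have a11 : -1 < a + 1 by lra.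
have i0 := integrable_shrink_kernel z a1.
have i1 := integrable_shrink_kernel z a11.
have c0 : 0 < expR (- (`|z| / 2)) / (a + 1) by rewrite divr_gt0 ?expR_gt0//; lra.
apply: (lt_le_trans c0).
have := @kernel_integral_rec a 0 a1.
rewrite mul0r mul0r oppr0 expR0 => h.
have I0 : kernel_integral a 0 = (a + 1)^-1.
  by apply: (@mulfI _ (a + 1)); [lra|rewrite divff; lra].
rewrite -I0 /kernel_integral -RintegralZl//; last exact: integrable_shrink_kernel.
apply: le_Rintegral => //.
  exact: integrableZl (integrable_shrink_kernel 0 a1).
move=> l; rewrite /= in_itv/= => /andP[l0 l1].
rewrite /shrink_kernel !mul0r oppr0 expR0 mulr1 mulrC ler_wpM2l ?powR_ge0// ler_expR.
rewrite lerN2 ler_wpM2r// (le_trans (ler_norm _))// normrM ler_piMr// ger0_norm; exact: ltW.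
Qed.

Lemma kernel_integral_le a z : -1 < a ->
  kernel_integral (a + 1) z <= kernel_integral a z.
Proof.
move=> a1; have a11 : -1 < a + 1 by lra.
apply: le_Rintegral => //; [exact: integrable_shrink_kernel..|].
move=> l; rewrite /= in_itv/= => /andP[l0 l1].
by rewrite shrink_kernelS// ler_piMr ?shrink_kernel_ge0// ltW.
Qed.

(** The Cauchy-Schwarz inequality, from the integral of [(l - t) ^ 2] against the
    kernel; it makes [shrink] nonincreasing. *)
Lemma kernel_integral_cauchy a z : -1 < a ->
  kernel_integral (a + 1) z ^+ 2 <= kernel_integral a z * kernel_integral (a + 1 + 1) z.
Proof.
move=> a1; have a11 : -1 < a + 1 by lra.
have a12 : -1 < a + 1 + 1 by lra.
have i0 := integrable_shrink_kernel z a1.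
have i1 := integrable_shrink_kernel z a11.
have i2 := integrable_shrink_kernel z a12.
have I0 := kernel_integral_gt0 z a1.
pose t := kernel_integral (a + 1) z / kernel_integral a z.
have j0 : mu.-integrable `]0, 1[ (EFin \o (fun l => t ^+ 2 * shrink_kernel a z l)).
  exact: integrableZl i0.
have j1 : mu.-integrable `]0, 1[ (EFin \o (fun l => 2 * t * shrink_kernel (a + 1) z l)).
  exact: integrableZl i1.
have : 0 <= \int[mu]_(l in `]0, 1[) (shrink_kernel (a + 1 + 1) z l
    - 2 * t * shrink_kernel (a + 1) z l + t ^+ 2 * shrink_kernel a z l).
  apply: Rintegral_ge0 => l; rewrite /= in_itv/= => /andP[l0 l1].
  rewrite !shrink_kernelS// [leRHS](_ : _ = shrink_kernel a z l * (l - t) ^+ 2); last by ring.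
  by rewrite mulr_ge0 ?sqr_ge0 ?shrink_kernel_ge0.
have j2 : mu.-integrable `]0, 1[ (EFin \o (fun l => shrink_kernel (a + 1 + 1) z l -
    2 * t * shrink_kernel (a + 1) z l)) by have := integrableB _ i2 j1; apply.
rewrite RintegralD; [|by []|exact: j2|exact: j0].
rewrite RintegralB; [|by []|exact: i2|exact: j1].
rewrite RintegralZl; [|by []|exact: i1].
rewrite RintegralZl; [|by []|exact: i0].
rewrite -/(kernel_integral _ _) -/(kernel_integral _ _) -/(kernel_integral _ _).
have -> : kernel_integral (a + 1) z = t * kernel_integral a z by rewrite divfK ?gt_eqF.
move: (kernel_integral a z) (kernel_integral (a + 1 + 1) z) I0 @t {j0 j1 j2} => u v u0 t h; nra.
Qed.

(** Differentiation under the integral, with the derivatives dominated uniformly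
    on the unit neighbourhood of [z]. *)
Lemma is_derive_kernel_integral a z : -1 < a ->
  is_derive z 1 (kernel_integral a) (- kernel_integral (a + 1) z / 2).
Proof.
move=> a1; have a11 : -1 < a + 1 by lra.
pose f z l := shrink_kernel a z l.
have df (x l : R) : is_derive x 1 (f ^~ l) (- (l / 2) * f x l).
  by rewrite /f /shrink_kernel; apply: is_derive_eq; rewrite /GRing.scale /=; field.
have zI : `]z - 1, z + 1[%classic z by rewrite /= in_itv/=; apply/andP; split; lra.
have intf (x : R) : `]z - 1, z + 1[%classic x -> mu.-integrable `]0, 1[ (EFin \o f x).
  by move=> _; exact: integrable_shrink_kernel.
have derf (x l : R) : `]z - 1, z + 1[%classic x -> `]0, 1[%classic l -> derivable (f ^~ l) x 1.
  by move=> _ _; case: (df x l).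
pose G l : R := expR ((`|z| + 1) / 2) * l `^ a.
have G0 l : 0 <= G l by rewrite mulr_ge0 ?expR_ge0 ?powR_ge0.
have intG : mu.-integrable `]0, 1[ (EFin \o G) by exact: integrableZl (integrable_powR01 a1).
have ubG (x l : R) : `]z - 1, z + 1[%classic x -> `]0, 1[%classic l -> `|partial1of2 f x l| <= G l.
  rewrite /= !in_itv/= => /andP[zx xz] l01; have /andP[l0 l1] := l01.
  rewrite partial1of2E; have [_ ->] := df x l.
  rewrite normrM (ger0_norm (shrink_kernel_ge0 _ _ _)).
  apply: (@le_trans _ _ (f x l)).
    rewrite ler_piMl ?shrink_kernel_ge0// normrN ger0_norm; lra.
  apply: le_trans (shrink_kernel_le _ _ l01) _.
  rewrite ler_wpM2r ?powR_ge0// ler_expR ler_wpM2r//.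
  have : `|x - z| <= 1 by rewrite ler_norml; apply/andP; split; lra.
  have := ler_normD (x - z) z; rewrite subrK; lra.
have m01 : measurable (`]0, 1[%classic : set R) by [].
apply: DeriveDef.
  exact: (@derivable_under_integral R _ _ mu f `]0, 1[%classic m01 z (z - 1) (z + 1)
    zI intf derf G G0 intG ubG).
rewrite -derive1E (@differentiation_under_integral R _ _ mu f `]0, 1[%classic m01
  z (z - 1) (z + 1) zI intf derf G G0 intG ubG).
rewrite mulNr -mulrC /kernel_integral -mulNr -RintegralZl//; last first.
  exact: integrable_shrink_kernel.
apply: eq_Rintegral => l; rewrite inE/= in_itv/= => /andP[l0 l1].
rewrite partial1of2E; have [_ ->] := df z l.
by rewrite shrink_kernelS// /f; field.
Qed.

End powR_integral.

(** This is [phi_star p z / z] for [b = p / 2 - 2]: the posterior mean of the mixing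
    variable given [x]. *)
Definition shrink {R : realType} (b z : R) : R :=
  kernel_integral (b + 1) z / kernel_integral b z.

Definition dshrink {R : realType} (b z : R) : R :=
  (kernel_integral (b + 1) z ^+ 2 - kernel_integral b z * kernel_integral (b + 1 + 1) z)
  / (2 * kernel_integral b z ^+ 2).

Section shrink.
Context {R : realType}.
Variable b : R.
Hypothesis b1 : -1 < b.
Implicit Type z : R.

Let b11 : -1 < b + 1. Proof. by move: b1; lra. Qed.
Let b12 : -1 < b + 1 + 1. Proof. by move: b1; lra. Qed.

Let I0 z := kernel_integral_gt0 z b1.
Let I1 z := kernel_integral_gt0 z b11.

Lemma shrink_gt0 z : 0 < shrink b z.
Proof. by rewrite divr_gt0. Qed.

Lemma shrink_le1 z : shrink b z <= 1.
Proof. by rewrite ler_pdivrMr// mul1r kernel_integral_le. Qed.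

Lemma mul_shrink z : z * shrink b z =
  2 * (b + 1) - 2 * expR (- (z / 2)) / kernel_integral b z.
Proof.
rewrite mulrA kernel_integral_rec//; field; by rewrite gt_eqF.
Qed.

(** For [b = p / 2 - 2] this is the bound [phi_star p z <= p - 2]. *)
Lemma mul_shrink_le z : z * shrink b z <= 2 * (b + 1).
Proof. by rewrite mul_shrink gerBl mulr_ge0 ?invr_ge0 ?mulr_ge0 ?expR_ge0// ltW. Qed.

Lemma is_derive_shrink z : is_derive z 1 (shrink b) (dshrink b z).
Proof.
have n0 : kernel_integral b z != 0 by rewrite gt_eqF.
have d0 := is_derive_kernel_integral z b1.
have d1 := is_derive_kernel_integral z b11.
rewrite /shrink; have dv := is_deriveV n0.
apply: is_derive_eq; rewrite /dshrink /GRing.scale /=.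
move: (kernel_integral b z) (kernel_integral (b + 1) z) (kernel_integral (b + 1 + 1) z) n0.
by move=> u0 u1 u2 n0; field; rewrite n0.
Qed.

Lemma dshrink_le0 z : dshrink b z <= 0.
Proof.
rewrite /dshrink pmulr_lle0 ?invr_gt0 ?mulr_gt0 ?exprn_gt0// subr_le0.
exact: kernel_integral_cauchy.
Qed.

(** [z * shrink b z] is nondecreasing: its derivative is evaluated by applying the
    recurrence to both products with [z]. *)
Lemma mul_dshrink_ge z : - shrink b z <= z * dshrink b z.
Proof.
have h1 := kernel_integral_rec z b1; have h2 := kernel_integral_rec z b11.
have h := kernel_integral_le z b1.
have n0 := I0 z; have e0 := expR_gt0 (- (z / 2)).
have -> : z * dshrink b z = (kernel_integral (b + 1) z * (z * kernel_integral (b + 1) z)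
   - kernel_integral b z * (z * kernel_integral (b + 1 + 1) z)) / (2 * kernel_integral b z ^+ 2).
  rewrite /dshrink.
  move: (kernel_integral b z) (kernel_integral (b + 1) z) (kernel_integral (b + 1 + 1) z) n0.
  by move=> u0 u1 u2 n0; field; rewrite gt_eqF.
rewrite h1 h2 /shrink -subr_ge0.
move: (kernel_integral b z) (kernel_integral (b + 1) z) h n0 => u0 u1 h n0.
rewrite [leRHS](_ : _ = expR (- (z / 2)) * (u0 - u1) / u0 ^+ 2).
  by rewrite divr_ge0 ?sqr_ge0// mulr_ge0 ?subr_ge0// ltW.
by field; rewrite gt_eqF.
Qed.

Lemma continuous_kernel_integral a : -1 < a -> continuous (@kernel_integral R a).
Proof.
move=> a1 z; apply: differentiable_continuous; apply/derivable1_diffP.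
by have [] := is_derive_kernel_integral z a1.
Qed.

Lemma continuous_shrink : continuous (shrink b).
Proof.
move=> z; apply: differentiable_continuous; apply/derivable1_diffP.
by have [] := is_derive_shrink z.
Qed.

Lemma continuous_dshrink : continuous (dshrink b).
Proof.
move=> z; have c0 := @continuous_kernel_integral b b1 z.
have c1 := @continuous_kernel_integral (b + 1) b11 z.
have c2 := @continuous_kernel_integral (b + 1 + 1) b12 z.
have n0 : 2 * kernel_integral b z ^+ 2 != 0 by rewrite gt_eqF// mulr_gt0// exprn_gt0.
rewrite /dshrink.
move: (@kernel_integral R b) (@kernel_integral R (b + 1)) (@kernel_integral R (b + 1 + 1)) c0 c1 c2 n0.
move=> u0 u1 u2 c0 c1 c2 n0; apply: cvgM.
  by apply: (@cvgB _ R^o); exact: cvgM.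
by apply: cvgV => //; apply: cvgM; [exact: cvg_cst|exact: cvgM].
Qed.

End shrink.

(** * Integration of functions of several coordinates *)

Section tuple_integral.
Context {R : realType}.
Local Notation mu := (@lebesgue_measure R).
Local Notation leb := (lebesgue_tuple R).

Lemma tnth_tuple_cons0 n (a : R) (t : n.-tuple R) :
  tnth (tuple_cons (a, t)) ord0 = a.
Proof. by []. Qed.

Lemma tnth_tuple_consS n (a : R) (t : n.-tuple R) (i : 'I_n) :
  tnth (tuple_cons (a, t)) (lift ord0 i) = tnth t i.
Proof. by rewrite (tnth_nth 0) [RHS](tnth_nth 0). Qed.

Let measurable_comp_cons n (F : n.+1.-tuple R -> \bar R) :
  measurable_fun setT F ->
  measurable_fun setT (F \o (@tuple_cons R n)).
Proof. by move=> mF; apply: measurableT_comp => //; exact: measurable_tuple_cons. Qed.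

Let integral_tuple_pushforward n (F : n.+1.-tuple R -> \bar R) :
  measurable_fun setT F -> (forall x, 0 <= F x)%E ->
  (\int[leb n.+1]_x F x = \int[(@lebesgue_measure R \x leb n)%E]_x F (tuple_cons x))%E.
Proof.
move=> mF F0.
exact: (@ge0_integral_pushforward _ _ _ _ _ _ (measurable_tuple_cons) _ setT F).
Qed.

Lemma integral_tuple_cons n (F : n.+1.-tuple R -> \bar R) :
  measurable_fun setT F -> (forall x, 0 <= F x)%E ->
  (\int[leb n.+1]_x F x = \int[mu]_a \int[leb n]_t F (tuple_cons (a, t)))%E.
Proof.
move=> mF F0; rewrite integral_tuple_pushforward//.
exact: (fubini_tonelli1 (F \o (@tuple_cons R n)) (measurable_comp_cons mF)
  (fun x => F0 (tuple_cons x))).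
Qed.

Lemma integral_tuple_cons_swap n (F : n.+1.-tuple R -> \bar R) :
  measurable_fun setT F -> (forall x, 0 <= F x)%E ->
  (\int[leb n.+1]_x F x = \int[leb n]_t \int[mu]_a F (tuple_cons (a, t)))%E.
Proof.
move=> mF F0; rewrite integral_tuple_pushforward//.
exact: (fubini_tonelli2 (F \o (@tuple_cons R n)) (measurable_comp_cons mF)
  (fun x => F0 (tuple_cons x))).
Qed.

Lemma integral_tuple_prod n (f : 'I_n -> R -> R) (c : 'I_n -> R) :
  (forall i, measurable_fun setT (f i)) -> (forall i t, 0 <= f i t) ->
  (forall i, \int[mu]_t (f i t)%:E = (c i)%:E)%E ->
  (\int[leb n]_x (\prod_i f i (tnth x i))%:E = (\prod_i c i)%:E)%E.
Proof.
elim: n f c => [|n ih] f c mf f0 fc.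
  under eq_integral do rewrite big_ord0.
  by rewrite big_ord0 /= integral_dirac//= diracT mul1e.
have mtf i : measurable_fun setT (fun x : n.+1.-tuple R => f i (tnth x i)).
  by apply: measurableT_comp => //; exact: measurable_tnth.
rewrite integral_tuple_cons; last 2 first.
- by apply/measurable_EFinP; exact: measurable_prod.
- by move=> x; rewrite lee_fin prodr_ge0.
under eq_integral => a _.
  under eq_integral => t _.
    rewrite big_ord_recl tnth_tuple_cons0 EFinM.
    under eq_bigr do rewrite tnth_tuple_consS.
    over.
  rewrite ge0_integralZl_EFin//; last 2 first.
  - by move=> t _; rewrite lee_fin prodr_ge0.
  - apply/measurable_EFinP; apply: measurable_prod => i _.
    by apply: measurableT_comp => //; exact: measurable_tnth.
  rewrite (ih (fun i => f (lift ord0 i)) (fun i => c (lift ord0 i)))//.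
  over.
rewrite ge0_integralZr//; last 3 first.
- by have /measurable_EFinP := mf ord0; exact.
- by move=> a _; rewrite lee_fin.
- rewrite lee_fin prodr_ge0// => i _; rewrite -lee_fin -fc.
  by apply: integral_ge0 => t _; rewrite lee_fin.
by rewrite fc big_ord_recl -EFinM.
Qed.

Definition set_coord n (x : n.-tuple R) (j : 'I_n) (a : R) : n.-tuple R :=
  [tuple if i == j then a else tnth x i | i < n].

Lemma set_coord_cons0 n (a b : R) (t : n.-tuple R) :
  set_coord (tuple_cons (a, t)) ord0 b = tuple_cons (b, t).
Proof.
apply: eq_from_tnth => i; rewrite tnth_mktuple.
case: (unliftP ord0 i) => [k ->|->]; last by rewrite eqxx.
by rewrite !tnth_tuple_consS.
Qed.

Lemma set_coord_consS n (a b : R) (t : n.-tuple R) (k : 'I_n) :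
  set_coord (tuple_cons (a, t)) (lift ord0 k) b = tuple_cons (a, set_coord t k b).
Proof.
apply: eq_from_tnth => i; rewrite tnth_mktuple.
case: (unliftP ord0 i) => [l ->|->]; last by rewrite !tnth_tuple_cons0.
by rewrite (inj_eq lift_inj) !tnth_tuple_consS tnth_mktuple.
Qed.

(** Tonelli's theorem with the [j]-th coordinate innermost, as a comparison of two
    functions, which avoids naming a measure on the other coordinates. *)
Lemma tonelli_lines n (j : 'I_n) (F K : n.-tuple R -> \bar R) :
  measurable_fun setT F -> (forall x, 0 <= F x)%E ->
  measurable_fun setT K -> (forall x, 0 <= K x)%E ->
  (forall x, \int[mu]_a F (set_coord x j a) = \int[mu]_a K (set_coord x j a))%E ->
  (\int[leb n]_x F x = \int[leb n]_x K x)%E.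
Proof.
elim: n j F K => [[]//|n ih] j F K mF F0 mK K0 FK.
have [k jk|j0] := unliftP ord0 j.
  rewrite (integral_tuple_cons mF F0) (integral_tuple_cons mK K0).
  apply: eq_integral => a _.
  apply: (ih k) => //.
  - by apply: measurableT_comp mF _; apply: measurableT_comp measurable_tuple_cons _; exact: pair1_measurable.
  - by apply: measurableT_comp mK _; apply: measurableT_comp measurable_tuple_cons _; exact: pair1_measurable.
  - move=> t; have := FK (tuple_cons (a, t)); rewrite jk.
    under eq_integral do rewrite set_coord_consS.
    by under [in RHS]eq_integral do rewrite set_coord_consS.
rewrite (integral_tuple_cons_swap mF F0) (integral_tuple_cons_swap mK K0).
apply: eq_integral => t _.
have := FK (tuple_cons (0, t)); rewrite j0.
under eq_integral do rewrite set_coord_cons0.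
by under [in RHS]eq_integral do rewrite set_coord_cons0.
Qed.

(** The integrals of the positive and negative parts agree on every line, hence
    globally. *)
Lemma Rintegral_lines_eq0 n (j : 'I_n) (H : n.-tuple R -> R) :
  (leb n).-integrable setT (EFin \o H) ->
  (forall x, mu.-integrable setT (EFin \o (fun a => H (set_coord x j a))) /\
     \int[mu]_a H (set_coord x j a) = 0) ->
  \int[leb n]_x H x = 0.
Proof.
move=> iH lH; have mH : measurable_fun setT H.
  by apply/measurable_EFinP; exact: measurable_int iH.
have fp := integral_funepos_lt_pinfty measurableT iH.
have fn := integral_funeneg_lt_pinfty measurableT iH.
have eqpn : (\int[leb n]_x (EFin \o H)^\+ x = \int[leb n]_x (EFin \o H)^\- x)%E.
  apply: (tonelli_lines (j := j)) => //.
  - by apply: measurable_funepos; exact/measurable_EFinP.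
  - by apply: measurable_funeneg; exact/measurable_EFinP.
  - move=> x; have [iHx H0] := lH x.
    have gp := integral_funepos_lt_pinfty measurableT iHx.
    have gn := integral_funeneg_lt_pinfty measurableT iHx.
    have : (\int[mu]_a (H (set_coord x j a))%:E = 0)%E.
      by have /fineK <- := integrable_fin_num measurableT iHx; rewrite [fine _]H0.
    rewrite integralE.
    have -> : (fun a => (H (set_coord x j a))%:E) = EFin \o (fun a => H (set_coord x j a)) by [].
    move=> /eqP; rewrite sube_eq; last 2 first.
    + by rewrite ge0_fin_numE// integral_ge0.
    + by rewrite fin_num_adde_defl// ge0_fin_numE// integral_ge0.
    rewrite add0e => /eqP h; transitivity (\int[mu]_a (EFin \o (fun a => H (set_coord x j a)))^\+ a)%E.
      by apply: eq_integral => a _; rewrite !funeposE.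
    by rewrite [LHS]h; apply: eq_integral => a _; rewrite !funenegE.
have -> : \int[leb n]_x H x = fine (\int[leb n]_x (EFin \o H) x)%E by [].
rewrite integralE eqpn subee//.
by rewrite ge0_fin_numE// integral_ge0.
Qed.

End tuple_integral.

(** * Product normal densities and Bayes risk *)

Definition gaussp {R : realType} {p : nat} (m v : 'I_p -> R) (x : p.-tuple R) : R :=
  \prod_i gauss (m i) (v i) (tnth x i).

Definition sqdist {R : realType} {p : nat} (a b : 'I_p -> R) : R :=
  \sum_i (a i - b i) ^+ 2.

Section gaussp.
Context {R : realType} {p : nat}.
Local Notation mu := (@lebesgue_measure R).
Local Notation leb := (lebesgue_tuple R p).
Implicit Types (m v s : 'I_p -> R) (x theta : p.-tuple R).

Lemma gaussp_ge0 m v x : 0 <= gaussp m v x.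
Proof. by apply: prodr_ge0 => i _; exact: gauss_ge0. Qed.

Lemma sqdist_ge0 (a b : 'I_p -> R) : 0 <= sqdist a b.
Proof. by apply: sumr_ge0 => i _; exact: sqr_ge0. Qed.

Lemma measurable_gaussp d (T : measurableType d) (m : 'I_p -> T -> R) v
    (x : T -> p.-tuple R) :
  (forall i, measurable_fun setT (m i)) -> measurable_fun setT x ->
  measurable_fun setT (fun t => gaussp (m ^~ t) v (x t)).
Proof.
move=> mm mx; apply: measurable_prod => i _; rewrite /gauss.
have mxi : measurable_fun setT (fun t => tnth (x t) i).
  exact: (measurableT_comp (measurable_tnth i) mx).
apply: measurable_funM => //; apply: measurableT_comp => //.
apply: measurableT_comp => //; apply: measurable_funM => //.
by apply/measurable_funX/measurable_funB.
Qed.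

Lemma measurable_gaussp1 m v : measurable_fun setT (gaussp m v).
Proof.
by apply: (@measurable_gaussp _ _ (fun i _ => m i) v id) => //; exact: measurable_id.
Qed.

Lemma measurable_sqdist d (T : measurableType d) (a b : 'I_p -> T -> R) :
  (forall i, measurable_fun setT (a i)) -> (forall i, measurable_fun setT (b i)) ->
  measurable_fun setT (fun t => sqdist (a ^~ t) (b ^~ t)).
Proof.
move=> ma mb; apply: measurable_sum => i.
by apply/measurable_funX/measurable_funB.
Qed.

Lemma integral_gaussp m v : (forall i, 0 < v i) ->
  (\int[leb]_x (gaussp m v x)%:E = 1)%E.
Proof.
move=> v0; rewrite (@integral_tuple_prod _ _ (fun i => gauss (m i) (v i)) (fun=> 1)).
- by rewrite big1.
- by move=> i; exact: measurable_gauss.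
- by move=> i t; exact: gauss_ge0.
- by move=> i; rewrite integral_gauss.
Qed.

Lemma integral_gaussp_coord m v j (a : R) : (forall i, 0 < v i) ->
  (\int[leb]_x ((a - tnth x j) ^+ 2 * gaussp m v x)%:E =
   ((a - m j) ^+ 2 + v j)%:E)%E.
Proof.
move=> v0.
pose f i t := (if i == j then (a - t) ^+ 2 else 1) * gauss (m i) (v i) t.
have fE x : (a - tnth x j) ^+ 2 * gaussp m v x = \prod_i f i (tnth x i).
  rewrite /gaussp (bigD1 j)//= [RHS](bigD1 j)//= mulrA; congr (_ * _); first by rewrite /f eqxx.
  by apply: eq_bigr => i ij; rewrite /f (negbTE ij) mul1r.
under eq_integral do rewrite fE.
rewrite (@integral_tuple_prod _ _ f (fun i => if i == j then (a - m j) ^+ 2 + v j else 1)).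
- rewrite (bigD1 j)//= eqxx big1 ?mulr1// => i ij.
  by rewrite (negbTE ij).
- move=> i; apply: measurable_funM; last exact: measurable_gauss.
  by case: (i == j) => //; apply/measurable_funX/measurable_funB.
- by move=> i t; rewrite /f mulr_ge0 ?gauss_ge0//; case: ifP => // _; exact: sqr_ge0.
- move=> i; rewrite /f; case: eqP => [->|_]; first exact: integral_gauss_sqr.
  by under eq_integral do rewrite mul1r; exact: integral_gauss.
Qed.

Lemma integral_gaussp_sqdist m v (a : 'I_p -> R) : (forall i, 0 < v i) ->
  (\int[leb]_x (sqdist a (tnth x) * gaussp m v x)%:E =
   (sqdist a m + \sum_i v i)%:E)%E.
Proof.
move=> v0; under eq_integral do rewrite /sqdist mulr_suml -sumEFin.
rewrite ge0_integral_sum//.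
- under eq_bigr do rewrite integral_gaussp_coord//.
  by rewrite sumEFin big_split.
- move=> i; apply/measurable_EFinP; apply: measurable_funM; last exact: measurable_gaussp1.
  by apply: measurable_funX; apply: measurable_funB => //; exact: measurable_tnth.
- by move=> i x _; rewrite lee_fin mulr_ge0 ?sqr_ge0 ?gaussp_ge0.
Qed.

(** Bayes' formula for a normal mean with a normal prior: both sides are the joint
    density of the mean [t] and the observation [y]. *)
Lemma gauss_conj (v s t y : R) : 0 < v -> 0 < s ->
  gauss 0 v t * gauss t s y =
  gauss 0 (v + s) y * gauss (v / (v + s) * y) (v / (v + s) * s) t.
Proof.
move=> v0 s0; have vs0 : 0 < v + s by rewrite addr_gt0.
have pi0 := pi_gt0 R.
rewrite /gauss mulrACA [RHS]mulrACA -!invfM -!expRD -!sqrtrM ?mulr_ge0// ?ltW//.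
congr (_^-1 * expR _).
  by congr Num.sqrt; field; rewrite gt_eqF.
by field; rewrite !gt_eqF//.
Qed.

Lemma gaussp_conj v s theta x : (forall i, 0 < v i) -> (forall i, 0 < s i) ->
  gaussp (fun=> 0) v theta * gaussp (tnth theta) s x =
  gaussp (fun=> 0) (fun i => v i + s i) x *
  gaussp (fun i => v i / (v i + s i) * tnth x i)
    (fun i => v i / (v i + s i) * s i) theta.
Proof.
by move=> v0 s0; rewrite -!big_split; apply: eq_bigr => i _; exact: gauss_conj.
Qed.

Lemma sqrt_prod (v : 'I_p -> R) : (forall i, 0 <= v i) ->
  Num.sqrt (\prod_i v i) = \prod_i Num.sqrt (v i).
Proof.
move=> v0; elim/big_rec2 : _ => [|i y1 y2 _ <-]; first exact: sqrtr1.
by rewrite sqrtrM.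
Qed.

Lemma mvn_pdf_diag (m v : 'I_p -> R) (theta : 'cV[R]_p) x :
  (forall i, 0 < v i) -> (forall i, theta i 0 = m i) ->
  mvn_pdf theta (diag_mx (\row_i v i)) (colv x) = gaussp m v x.
Proof.
move=> v0 thE; rewrite /mvn_pdf /gaussp /gauss big_split /=; congr (_ * _).
- rewrite prodfV; congr (_^-1).
  rewrite det_diag [p%:R / 2]mulrC powRrM powR12_sqrt ?powR_mulrn ?sqrtr_ge0//; last first.
    by rewrite mulr_ge0// pi_ge0.
  under eq_bigr do rewrite mxE.
  rewrite sqrt_prod; last by move=> i; exact: ltW.
  rewrite -[in X in X * _](card_ord p) -prodr_const -big_split /=.
  by apply: eq_bigr => i _; rewrite [RHS]sqrtrM// mulr_ge0// pi_ge0.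
- rewrite -expR_sum; congr expR.
  have vv : diag_mx (\row_i v i) *m diag_mx (\row_i (v i)^-1) = 1%:M.
    rewrite mulmx_diag; apply/matrixP => i j; rewrite !mxE.
    by rewrite divff// gt_eqF.
  have -> : invmx (diag_mx (\row_i v i)) = diag_mx (\row_i (v i)^-1).
    have [u _] := mulmx1_unit vv.
    by rewrite -[LHS]mulmx1 -vv mulKmx.
  rewrite mul_mx_diag !mxE mulNr mulr_suml -sumrN; apply: eq_bigr => i _.
  rewrite !mxE thE; field.
  by rewrite gt_eqF.
Qed.

Lemma sqnorm_colvB x theta :
  sqnorm (colv x - colv theta) = sqdist (tnth x) (tnth theta).
Proof. by apply: eq_bigr => i _; rewrite !mxE. Qed.

Lemma riskE s (delta : p.-tuple R -> p.-tuple R) theta : (forall i, 0 < s i) ->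
  (risk (diag_mx (\row_i s i)) delta theta =
   \int[leb]_x (sqdist (tnth (delta x)) (tnth theta) * gaussp (tnth theta) s x)%:E)%E.
Proof.
move=> s0; apply: eq_integral => x _.
by rewrite sqnorm_colvB (@mvn_pdf_diag (tnth theta)) => [||i]; rewrite ?mxE.
Qed.

Lemma measurable_loss_integrand s (delta : p.-tuple R -> p.-tuple R) :
  measurable_fun setT delta ->
  measurable_fun setT (fun tx : p.-tuple R * p.-tuple R =>
    (sqdist (tnth (delta tx.2)) (tnth tx.1) * gaussp (tnth tx.1) s tx.2)%:E).
Proof.
move=> md.
have m1 i : measurable_fun setT (fun tx : p.-tuple R * p.-tuple R => tnth tx.1 i).
  exact: (measurableT_comp (measurable_tnth i) measurable_fst).
have m2 i : measurable_fun setT (fun tx : p.-tuple R * p.-tuple R => tnth (delta tx.2) i).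
  apply: (measurableT_comp (measurable_tnth i)).
  exact: measurableT_comp md measurable_snd.
apply/measurable_EFinP; apply: measurable_funM.
  exact: (measurable_sqdist (a := fun i tx => tnth (delta tx.2) i) (b := fun i tx => tnth tx.1 i)).
exact: (measurable_gaussp (m := fun i tx => tnth tx.1 i)).
Qed.

Lemma risk_ge0 (S : 'M[R]_p) (delta : p.-tuple R -> p.-tuple R) theta :
  (0 <= risk S delta theta)%E.
Proof.
apply: integral_ge0 => x _; rewrite lee_fin mulr_ge0//.
  by apply: sumr_ge0 => i _; exact: sqr_ge0.
by rewrite /mvn_pdf mulr_ge0 ?expR_ge0// invr_ge0 mulr_ge0 ?powR_ge0 ?sqrtr_ge0.
Qed.

Lemma measurable_risk s (delta : p.-tuple R -> p.-tuple R) : (forall i, 0 < s i) ->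
  measurable_fun setT delta ->
  measurable_fun setT (risk (diag_mx (\row_i s i)) delta).
Proof.
move=> s0 md.
have := @measurable_fun_fubini_tonelli_F _ _ _ _ _ leb _
  (measurable_loss_integrand s md) _.
rewrite /fubini_F; under [X in measurable_fun _ X]eq_fun do rewrite -riskE//.
apply => tx; by rewrite lee_fin mulr_ge0 ?sqdist_ge0 ?gaussp_ge0.
Qed.

Lemma integral_posterior_loss v s (a : 'I_p -> R) x :
  (forall i, 0 < v i) -> (forall i, 0 < s i) ->
  (\int[leb]_theta (sqdist a (tnth theta) * gaussp (tnth theta) s x *
     gaussp (fun=> 0) v theta)%:E =
   ((sqdist a (fun i => v i / (v i + s i) * tnth x i) +
     \sum_i v i / (v i + s i) * s i) *
    gaussp (fun=> 0) (fun i => v i + s i)%R x)%:E)%E.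
Proof.
move=> v0 s0.
have k0 i : 0 < v i / (v i + s i) * s i by rewrite mulr_gt0 ?divr_gt0 ?addr_gt0.
under eq_integral => theta _.
  rewrite -mulrA [gaussp (tnth _) _ _ * _]mulrC gaussp_conj//.
  rewrite mulrCA EFinM; over.
rewrite ge0_integralZl_EFin//.
- by rewrite integral_gaussp_sqdist// -EFinM mulrC.
- by move=> theta _; rewrite lee_fin mulr_ge0 ?sqdist_ge0 ?gaussp_ge0.
- apply/measurable_EFinP; apply: measurable_funM; last exact: measurable_gaussp1.
  apply: (measurable_sqdist (a := fun i _ => a i) (b := fun i t => tnth t i)) => // i.
  exact: measurable_tnth.
- exact: gaussp_ge0.
Qed.

Lemma integral_posterior v s x : (forall i, 0 < v i) -> (forall i, 0 < s i) ->
  (\int[leb]_theta (gaussp (tnth theta) s x * gaussp (fun=> 0) v theta)%:E =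
   (gaussp (fun=> 0) (fun i => v i + s i)%R x)%:E)%E.
Proof.
move=> v0 s0.
have k0 i : 0 < v i / (v i + s i) * s i by rewrite mulr_gt0 ?divr_gt0 ?addr_gt0.
under eq_integral => theta _.
  rewrite [gaussp (tnth _) _ _ * _]mulrC gaussp_conj// EFinM; over.
rewrite ge0_integralZl_EFin ?integral_gaussp ?mule1//.
- by move=> theta _; rewrite lee_fin gaussp_ge0.
- by apply/measurable_EFinP; exact: measurable_gaussp1.
- exact: gaussp_ge0.
Qed.

(** Posterior expected loss: squared distance to the posterior mean, plus the trace
    of the posterior covariance. *)
Definition bayes_loss v s (delta : p.-tuple R -> p.-tuple R) x : R :=
  sqdist (tnth (delta x)) (fun i => v i / (v i + s i) * tnth x i) +
  \sum_i v i / (v i + s i) * s i.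

(** Tonelli: integrating over [theta] first gives the posterior loss. *)
Lemma bayes_risk v s (delta : p.-tuple R -> p.-tuple R) :
  (forall i, 0 < v i) -> (forall i, 0 < s i) -> measurable_fun setT delta ->
  (\int[leb]_theta (risk (diag_mx (\row_i s i)) delta theta *
     (gaussp (fun=> 0) v theta)%:E) =
   \int[leb]_x (bayes_loss v s delta x *
     gaussp (fun=> 0) (fun i => v i + s i)%R x)%:E)%E.
Proof.
move=> v0 s0 md; have mL := measurable_loss_integrand s md.
pose f (tx : p.-tuple R * p.-tuple R) :=
  (sqdist (tnth (delta tx.2)) (tnth tx.1) * gaussp (tnth tx.1) s tx.2 *
   gaussp (fun=> 0) v tx.1)%:E.
have f0 tx : (0 <= f tx)%E.
  by rewrite lee_fin !mulr_ge0 ?sqdist_ge0 ?gaussp_ge0.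
have mf : measurable_fun setT f.
  apply/measurable_EFinP; apply: measurable_funM; first exact/measurable_EFinP.
  exact: measurableT_comp (measurable_gaussp1 _ _) measurable_fst.
transitivity (\int[leb]_theta \int[leb]_x f (theta, x))%E.
  apply: eq_integral => theta _; rewrite riskE// -ge0_integralZr//.
  - have : measurable_fun setT (pair theta : p.-tuple R -> p.-tuple R * p.-tuple R).
      exact: pair1_measurable.
    exact: measurableT_comp mL.
  - by move=> x _; rewrite lee_fin mulr_ge0 ?sqdist_ge0 ?gaussp_ge0.
  - by rewrite lee_fin gaussp_ge0.
rewrite (@fubini_tonelli _ _ _ _ _ leb leb f mf f0).
by apply: eq_integral => x _; rewrite /bayes_loss -integral_posterior_loss.
Qed.

End gaussp.

(** * Stein's identity in several dimensions *)

Section integration_tools.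
Context d (T : measurableType d) {R : realType}.
Variable mu : {measure set T -> \bar R}.

Lemma Rintegral_lincomb_eq0 (I : Type) (r : seq I) (c : I -> R) (h : I -> T -> R) :
  (forall i, mu.-integrable setT (EFin \o h i)) ->
  (forall i, \int[mu]_x h i x = 0) ->
  mu.-integrable setT (EFin \o (fun x => \sum_(i <- r) c i * h i x)) /\
  \int[mu]_x (\sum_(i <- r) c i * h i x) = 0.
Proof.
move=> ih h0; elim: r => [|i r [ihr Ihr]].
  have -> : (fun x => \sum_(i <- [::]) c i * h i x) = cst 0.
    by apply/funext => x; rewrite big_nil.
  by split; [exact: integrable0|rewrite Rintegral_cst// mul0r].
have ici : mu.-integrable setT (EFin \o (fun x => c i * h i x)).
  exact: integrableZl (ih i).
have -> : (fun x => \sum_(j <- i :: r) c j * h j x) =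
    (fun x => c i * h i x + \sum_(j <- r) c j * h j x).
  by apply/funext => x; rewrite big_cons.
split; first exact: integrableD ici ihr.
by rewrite RintegralD// Ihr addr0 RintegralZl// h0 mulr0.
Qed.

Lemma integral_EFin_Rintegral (f : T -> R) : mu.-integrable setT (EFin \o f) ->
  (\int[mu]_x (f x)%:E = (\int[mu]_x f x)%:E)%E.
Proof. by move=> fi; rewrite fineK//; exact: integrable_fin_num. Qed.

End integration_tools.

Section stein_tuple.
Context {R : realType} {p : nat}.
Local Notation mu := (@lebesgue_measure R).
Local Notation leb := (lebesgue_tuple R p).
Implicit Types (m v s : 'I_p -> R) (x theta : p.-tuple R).

Lemma integrable_le_gaussp m v (C : R) (h : p.-tuple R -> R) :
  (forall i, 0 < v i) -> measurable_fun setT h ->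
  (forall x, `|h x| <= C * (1 + sqdist m (tnth x))) ->
  leb.-integrable setT (EFin \o (fun x => h x * gaussp m v x)).
Proof.
move=> v0 mh hC.
have ig : leb.-integrable setT (EFin \o gaussp m v).
  apply/integrableP; split; first by apply/measurable_EFinP; exact: measurable_gaussp1.
  under eq_integral do rewrite /= ger0_norm ?gaussp_ge0//.
  by rewrite integral_gaussp// ltry.
have is_ : leb.-integrable setT (EFin \o (fun x => sqdist m (tnth x) * gaussp m v x)).
  apply/integrableP; split.
    apply/measurable_EFinP/measurable_funM; last exact: measurable_gaussp1.
    apply: (measurable_sqdist (a := fun i _ => m i) (b := fun i t => tnth t i)) => // i.
    exact: measurable_tnth.
  under eq_integral do rewrite /= ger0_norm ?mulr_ge0 ?gaussp_ge0 ?sqdist_ge0//.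
  by rewrite integral_gaussp_sqdist// ltry.
apply: (@le_integrable _ _ _ leb setT measurableT _
    (EFin \o (fun x => C * (gaussp m v x + sqdist m (tnth x) * gaussp m v x)))).
- by apply/measurable_EFinP/measurable_funM => //; exact: measurable_gaussp1.
- move=> x _ /=; rewrite lee_fin normrM (ger0_norm (gaussp_ge0 _ _ _)).
  apply: le_trans (ler_norm _).
  by rewrite -{2}[gaussp m v x]mul1r -mulrDl mulrA ler_wpM2r ?gaussp_ge0.
- exact: integrableZl (integrableD measurableT ig is_).
Qed.

Lemma gaussp_set_coord m v x j a : gaussp m v (set_coord x j a) =
  gauss (m j) (v j) a * \prod_(i | i != j) gauss (m i) (v i) (tnth x i).
Proof.
rewrite /gaussp (bigD1 j)//= tnth_mktuple eqxx; congr (_ * _).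
by apply: eq_bigr => i ij; rewrite tnth_mktuple (negbTE ij).
Qed.

Lemma coord_sqdist m x j : (tnth x j - m j) ^+ 2 <= sqdist m (tnth x).
Proof.
rewrite /sqdist (bigD1 j)//= -sqrrN opprB lerDl.
by apply: sumr_ge0 => i _; exact: sqr_ge0.
Qed.

(** Stein's identity on each line parallel to the [j]-th axis. *)
Lemma stein_tuple m v j (h h' : p.-tuple R -> R) (C : R) :
  (forall i, 0 < v i) -> measurable_fun setT h -> measurable_fun setT h' ->
  (forall x (a : R), is_derive a 1 (fun b : R => h (set_coord x j b)) (h' (set_coord x j a))) ->
  (forall x, continuous (fun a : R => h' (set_coord x j a))) ->
  (forall x, `|h x| <= C * (1 + `|tnth x j - m j|)) -> (forall x, `|h' x| <= C) ->
  leb.-integrable setT (EFin \o (fun x =>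
    ((tnth x j - m j) * h x - v j * h' x) * gaussp m v x)) /\
  \int[leb]_x (((tnth x j - m j) * h x - v j * h' x) * gaussp m v x) = 0.
Proof.
move=> v0 mh mh' dh ch' hC h'C.
have mj : measurable_fun setT (fun x : p.-tuple R => tnth x j - m j).
  by apply: measurable_funB => //; exact: measurable_tnth.
have int : leb.-integrable setT (EFin \o (fun x =>
    ((tnth x j - m j) * h x - v j * h' x) * gaussp m v x)).
  apply: (@integrable_le_gaussp m v (C * (2 + v j))) => //.
    by apply: measurable_funB; exact: measurable_funM.
  move=> x; rewrite (le_trans (ler_normB _ _))// !normrM (ger0_norm (ltW (v0 j))).
  have h1 := hC x; have h2 := h'C x.
  have C0 : 0 <= C by exact: le_trans h2.
  have h3 : `|tnth x j - m j| ^+ 2 <= sqdist m (tnth x).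
    by rewrite real_normK ?num_real// coord_sqdist.
  have h4 := normr_ge0 (tnth x j - m j); have vj := v0 j.
  have sq0 := sqdist_ge0 m (tnth x).
  move: (`|tnth x j - m j|) (`|h x|) (`|h' x|) (sqdist m (tnth x)) h1 h2 h3 h4 sq0 => a b c q h1 h2 h3 h4 sq0.
  have : a * b <= a * (C * (1 + a)) by rewrite ler_wpM2l.
  have : v j * c <= v j * C by rewrite ler_wpM2l// ltW.
  have : 0 <= C * (1 - a) ^+ 2 by rewrite mulr_ge0 ?sqr_ge0.
  have : C * a ^+ 2 <= C * q by rewrite ler_wpM2l.
  have : 0 <= C * v j * q by rewrite !mulr_ge0// ltW.
  nra.
split => //; apply: (Rintegral_lines_eq0 (j := j)) => // x.
have hx a : `|h (set_coord x j a)| <= C * (1 + `|a - m j|).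
  by have := hC (set_coord x j a); rewrite tnth_mktuple eqxx.
have [i1 I1] := @stein R (fun a => h (set_coord x j a)) (fun a => h' (set_coord x j a))
  (m j) (v j) C (v0 j) (dh x) (ch' x) hx (fun a => h'C (set_coord x j a)).
pose c := \prod_(i | i != j) gauss (m i) (v i) (tnth x i).
have E a : ((tnth (set_coord x j a) j - m j) * h (set_coord x j a) -
      v j * h' (set_coord x j a)) * gaussp m v (set_coord x j a) =
    c * (((a - m j) * h (set_coord x j a) - v j * h' (set_coord x j a)) * gauss (m j) (v j) a).
  by rewrite gaussp_set_coord tnth_mktuple eqxx -/c; ring.
split.
  rewrite (_ : _ \o _ = EFin \o (fun a => c * (((a - m j) * h (set_coord x j a) - v j * h' (set_coord x j a)) * gauss (m j) (v j) a))).
    exact: integrableZl i1.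
  by apply/funext => a; rewrite /= E.
by under eq_Rintegral do rewrite E; rewrite RintegralZl// I1 mulr0.
Qed.

End stein_tuple.

(** * The ordinary risk *)

Definition zstat {R : realType} {p : nat} (s1 : R) (x : p.-tuple R) : R :=
  (\sum_i tnth x i ^+ 2) / s1.

Section shrinkage_calculus.
Context {R : realType} {p : nat}.
Local Notation leb := (lebesgue_tuple R p).
Implicit Types (x theta : p.-tuple R).
Variables (s1 b : R).
Hypotheses (s10 : 0 < s1) (b1 : -1 < b).
Local Notation z := (zstat s1).
Local Notation w x := (shrink b (z x)).
Local Notation w' x := (dshrink b (z x)).

Lemma zstat_ge0 x : 0 <= z x.
Proof. by apply: divr_ge0; [apply: sumr_ge0 => i _; exact: sqr_ge0|exact: ltW]. Qed.

Lemma sqr_coord_zstat x i : tnth x i ^+ 2 <= s1 * z x.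
Proof.
rewrite mulrC divfK ?gt_eqF// (bigD1 i)//= lerDl.
by apply: sumr_ge0 => j _; exact: sqr_ge0.
Qed.

Lemma zstat_set_coord x j a : z (set_coord x j a) =
  (a ^+ 2 + \sum_(i | i != j) tnth x i ^+ 2) / s1.
Proof.
rewrite /zstat (bigD1 j)//= tnth_mktuple eqxx; congr ((_ + _) / _).
by apply: eq_bigr => i ij; rewrite tnth_mktuple (negbTE ij).
Qed.

Lemma is_derive_zstat x j (a : R) :
  is_derive a 1 (fun t : R => z (set_coord x j t)) (2 * a / s1).
Proof.
under eq_fun do rewrite zstat_set_coord.
apply: is_derive_eq; rewrite !scaler0 /GRing.scale /=; ring.
Qed.

Lemma is_derive_shrink_line x j (a : R) :
  is_derive a 1 (fun t : R => w (set_coord x j t))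
    (2 * a / s1 * w' (set_coord x j a)).
Proof.
have dz := is_derive_zstat x j a.
have dw := is_derive_shrink b1 (z (set_coord x j a)).
have := @is_derive1_comp R (shrink b) (fun t => z (set_coord x j t)) a _ _ dw dz.
by rewrite mulrC.
Qed.

Lemma is_derive_coord x j i (a : R) :
  is_derive a 1 (fun t : R => tnth (set_coord x j t) i) (i == j)%:R.
Proof.
by under eq_fun do rewrite tnth_mktuple; case: (i == j); exact: is_derive_eq.
Qed.

Lemma continuous_of_derive (f f' : R -> R) :
  (forall a : R, is_derive a 1 f (f' a)) -> continuous f.
Proof.
move=> df a; apply: differentiable_continuous; apply/derivable1_diffP.
by have [] := df a.
Qed.

Lemma continuous_dshrink_line x j :
  continuous (fun t : R => w' (set_coord x j t)).
Proof.
move=> a; have cz := @continuous_of_derive _ _ (is_derive_zstat x j).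
exact: (cvg_comp _ _ (cz a) (@continuous_dshrink R b b1 (z (set_coord x j a)))).
Qed.

Lemma measurable_zstat : measurable_fun setT (@zstat R p s1).
Proof.
apply: measurable_funM => //; apply: measurable_sum => i.
by apply: measurable_funX; exact: measurable_tnth.
Qed.

Lemma measurable_shrink : measurable_fun setT (fun x : p.-tuple R => w x).
Proof.
apply: (@measurableT_comp _ _ _ _ _ _ (shrink b)); last exact: measurable_zstat.
by apply: continuous_measurable_fun; exact: continuous_shrink.
Qed.

Lemma measurable_dshrink : measurable_fun setT (fun x : p.-tuple R => w' x).
Proof.
apply: (@measurableT_comp _ _ _ _ _ _ (dshrink b)); last exact: measurable_zstat.
by apply: continuous_measurable_fun; exact: continuous_dshrink.
Qed.

Lemma sqr_coord_dshrink_le x i : tnth x i ^+ 2 * (- w' x) <= s1 * w x.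
Proof.
have h1 := sqr_coord_zstat x i; have h2 := mul_dshrink_ge b1 (z x).
have h3 := dshrink_le0 b1 (z x).
apply: (@le_trans _ _ (s1 * z x * (- w' x))); first by rewrite ler_wpM2r// oppr_ge0.
by rewrite -(mulrA s1) ler_wpM2l ?(ltW s10)// mulrN lerNl.
Qed.

Lemma sqr_coord_shrink_le x i : tnth x i ^+ 2 * w x <= s1 * (2 * (b + 1)).
Proof.
have h1 := sqr_coord_zstat x i; have h2 := mul_shrink_le b1 (z x).
have h3 := shrink_gt0 b1 (z x).
apply: (@le_trans _ _ (s1 * z x * w x)); first by rewrite ler_wpM2r// ltW.
by rewrite -(mulrA s1) ler_wpM2l// ltW.
Qed.

Lemma stein_coord_shrink (theta : p.-tuple R) (s : 'I_p -> R) (i : 'I_p) :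
  (forall i, 0 < s i) ->
  let h x := ((tnth x i - tnth theta i) * (tnth x i * w x) -
     s i * (w x + 2 * tnth x i ^+ 2 * w' x / s1)) * gaussp (tnth theta) s x in
  leb.-integrable setT (EFin \o h) /\ \int[leb]_x h x = 0.
Proof.
move=> s0.
apply: (@stein_tuple _ _ (tnth theta) s i (fun x => tnth x i * w x)
  (fun x => w x + 2 * tnth x i ^+ 2 * w' x / s1) (3 + `|tnth theta i|)) => //.
- apply: measurable_funM; last exact: measurable_shrink.
  exact: measurable_tnth.
- apply: measurable_funD; first exact: measurable_shrink.
  apply: measurable_funM => //; apply: measurable_funM; last exact: measurable_dshrink.
  by apply: measurable_funM => //; apply: measurable_funX; exact: measurable_tnth.
- move=> x a; have d1 := is_derive_coord x i i a; have d2 := is_derive_shrink_line x i a.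
  apply: is_derive_eq; rewrite eqxx tnth_mktuple eqxx /GRing.scale /=; ring.
- move=> x a.
  have c1 := @continuous_of_derive _ _ (is_derive_coord x i i) a.
  have c2 := @continuous_of_derive _ _ (is_derive_shrink_line x i) a.
  have c3 := @continuous_dshrink_line x i a.
  apply: (@cvgD _ R^o); first exact: c2.
  apply: cvgM; last exact: cvg_cst.
  apply: cvgM; last exact: c3.
  by apply: cvgM; [exact: cvg_cst|apply: cvgM; exact: c1].
- move=> x; rewrite normrM (gtr0_norm (shrink_gt0 b1 _)).
  apply: (@le_trans _ _ `|tnth x i|); first by rewrite ler_piMr// shrink_le1.
  have := ler_normD (tnth x i - tnth theta i) (tnth theta i); rewrite subrK.
  have := normr_ge0 (tnth x i - tnth theta i); have := normr_ge0 (tnth theta i); nra.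
- move=> x; have h1 := sqr_coord_dshrink_le x i; have h2 := dshrink_le0 b1 (z x).
  have h3 := shrink_gt0 b1 (z x); have h4 := shrink_le1 b1 (z x).
  apply: (@le_trans _ _ 3); last by rewrite lerDl.
  have : tnth x i ^+ 2 * (- w' x) / s1 <= w x by rewrite ler_pdivrMr// (mulrC (w x)).
  have : 0 <= tnth x i ^+ 2 * (- w' x) / s1.
    by rewrite divr_ge0 ?(ltW s10)// mulr_ge0 ?sqr_ge0// oppr_ge0.
  rewrite (_ : 2 * tnth x i ^+ 2 * w' x / s1 = - 2 * (tnth x i ^+ 2 * (- w' x) / s1)); last by ring.
  by move=> h5 h6; rewrite ler_norml; apply/andP; split; lra.
Qed.

(** Stein's identity in direction [j] for the [j]-th component of the radial field
    [f x * x]. *)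
Lemma stein_radial (a : 'I_p -> R) (i j : 'I_p) :
  (forall i, 0 < a i) ->
  let f x := tnth x i ^+ 2 * w x ^+ 2 in
  let h x := (tnth x j ^+ 2 * f x - a j * ((1 + 2 * (i == j)%:R) * f x +
     4 * tnth x i ^+ 2 * w x * w' x * tnth x j ^+ 2 / s1)) * gaussp (fun=> 0) a x in
  leb.-integrable setT (EFin \o h) /\ \int[leb]_x h x = 0.
Proof.
move=> a0 f h.
pose F x := tnth x j * f x.
pose F' x := (1 + 2 * (i == j)%:R) * f x + 4 * tnth x i ^+ 2 * w x * w' x * tnth x j ^+ 2 / s1.
pose C := 7 * (s1 * (2 * (b + 1))).
have f0 x : 0 <= f x by rewrite mulr_ge0 ?sqr_ge0.
have fC x : f x <= s1 * (2 * (b + 1)).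
  have := sqr_coord_shrink_le x i; have := shrink_le1 b1 (z x); have := shrink_gt0 b1 (z x).
  move=> w0 w1; apply: le_trans; rewrite /f expr2 mulrA ler_piMr// mulr_ge0 ?sqr_ge0//.
  exact: ltW.
have mi k : measurable_fun setT (fun x : p.-tuple R => tnth x k ^+ 2).
  by apply: measurable_funX; exact: measurable_tnth.
have mf : measurable_fun setT f.
  by apply: measurable_funM => //; apply: measurable_funX; exact: measurable_shrink.
have := @stein_tuple _ _ (fun=> 0) a j F F' C a0 _ _ _ _ _ _.
have -> : (fun x => ((tnth x j - 0) * F x - a j * F' x) * gaussp (fun=> 0) a x) = h.
  by apply/funext => x; rewrite /h /F /F' subr0; congr (_ * _); ring.
apply.
- by apply: measurable_funM => //; exact: measurable_tnth.
- apply: measurable_funD; first exact: measurable_funM.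
  apply: measurable_funM => //; apply: measurable_funM => //.
  apply: measurable_funM; last exact: measurable_dshrink.
  by apply: measurable_funM; [exact: measurable_funM|exact: measurable_shrink].
- move=> x t; have d1 := is_derive_coord x j i t; have d2 := is_derive_shrink_line x j t.
  have d3 := is_derive_coord x j j t.
  rewrite /F /F' /f; apply: is_derive_eq.
  have tj : tnth (set_coord x j t) j = t by rewrite tnth_mktuple eqxx.
  by case: (i =P j) d1 => [->|_] _; rewrite !tj eqxx /GRing.scale /=; ring.
- move=> x t.
  have c1 := @continuous_of_derive _ _ (is_derive_coord x j i) t.
  have c2 := @continuous_of_derive _ _ (is_derive_shrink_line x j) t.
  have c3 := @continuous_dshrink_line x j t.
  have c4 := @continuous_of_derive _ _ (is_derive_coord x j j) t.
  apply: (@cvgD _ R^o).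
    apply: cvgM; first exact: cvg_cst.
    by apply: cvgM; [apply: cvgM; exact: c1|apply: cvgM; exact: c2].
  apply: cvgM; last exact: cvg_cst.
  apply: cvgM; last by apply: cvgM; exact: c4.
  apply: cvgM; last exact: c3.
  apply: cvgM; last exact: c2.
  by apply: cvgM; [exact: cvg_cst|apply: cvgM; exact: c1].
- move=> x; rewrite /F normrM (ger0_norm (f0 x)) subr0.
  have := fC x; have := f0 x; have := normr_ge0 (tnth x j); rewrite /C; nra.
- move=> x; have h1 := sqr_coord_dshrink_le x j; have h2 := dshrink_le0 b1 (z x).
  have h3 := shrink_gt0 b1 (z x).
  have h5 : tnth x j ^+ 2 * (- w' x) / s1 <= w x by rewrite ler_pdivrMr// (mulrC (w x)).
  have h6 : 0 <= tnth x j ^+ 2 * (- w' x) / s1.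
    by rewrite divr_ge0 ?(ltW s10)// mulr_ge0 ?sqr_ge0// oppr_ge0.
  have E : F' x = (1 + 2 * (i == j)%:R) * f x -
      4 * (tnth x i ^+ 2 * w x * (tnth x j ^+ 2 * (- w' x) / s1)).
    by rewrite /F'; ring.
  have h7 : tnth x i ^+ 2 * w x * (tnth x j ^+ 2 * (- w' x) / s1) <= f x.
    by rewrite /f expr2 [leRHS]mulrA ler_wpM2l// mulr_ge0 ?sqr_ge0// ltW.
  have h8 : 0 <= tnth x i ^+ 2 * w x * (tnth x j ^+ 2 * (- w' x) / s1).
    by rewrite mulr_ge0// mulr_ge0 ?sqr_ge0// ltW.
  rewrite E ler_norml /C; have := fC x; have := f0 x.
  move: (tnth x i ^+ 2 * w x * _) h7 h8 => q h7 h8 h9 h10.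
  by case: (i == j); apply/andP; split; rewrite /=; lra.
Qed.

End shrinkage_calculus.

Section risk_bounds.
Context {R : realType} {p : nat}.
Local Notation leb := (lebesgue_tuple R p).
Implicit Types (x theta : p.-tuple R).
Variables (s1 b : R) (s : 'I_p -> R).
Hypotheses (s10 : 0 < s1) (b1 : -1 < b) (bp : 2 * (b + 1) = p%:R - 2).
Hypotheses (s0 : forall i, 0 < s i) (ss1 : forall i, s i <= s1).
Variable delta : p.-tuple R -> p.-tuple R.
Hypothesis mdelta : measurable_fun setT delta.
Local Notation z := (zstat s1).
Local Notation w x := (shrink b (z x)).
Local Notation w' x := (dshrink b (z x)).
Hypothesis deltaE : forall x i, tnth (delta x) i = tnth x i - s i / s1 * w x * tnth x i.
Local Notation Sigma := (diag_mx (\row_i s i)).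

(** With [g i = s i / s1] and [u i] the share of the [i]-th coordinate in [|x|^2],
    the sum is at most [s1 * w] times the sum of the
    [(p + 2) * g i ^ 2 * u i - 2 * g i ^ 2].  As [g i <= 1] and the [u i] add up to
    at most 1, the first part is at most [p + 2], and the hypothesis says that the
    second is at least as large. *)
Lemma shrinkage_excess_le0 x : p%:R - 2 <= 2 * (\sum_i s i ^+ 2 / s1 ^+ 2 - 2) ->
  \sum_i ((s i / s1 * w x * tnth x i) ^+ 2 -
    2 * (s i / s1) * (s i * (w x + 2 * tnth x i ^+ 2 * w' x / s1))) <= 0.
Proof.
move=> cond.
have w0 := shrink_gt0 b1 (z x); have zw := mul_shrink_le b1 (z x).
have zw' := mul_dshrink_ge b1 (z x).
have n1 : s1 != 0 by rewrite gt_eqF.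
(* the proportion of |x|^2 carried by the i-th coordinate, or 0 when x = 0 *)
pose u i := tnth x i ^+ 2 / (s1 * z x).
have s1z : s1 * z x = \sum_i tnth x i ^+ 2 by rewrite /zstat mulrC divfK.
have u0 i : 0 <= u i by rewrite divr_ge0 ?sqr_ge0// mulr_ge0 ?(ltW s10)// zstat_ge0.
have u1 i : u i <= 1.
  rewrite /u; have [->|n0] := eqVneq (s1 * z x) 0; first by rewrite invr0 mulr0.
  rewrite ler_pdivrMr ?mul1r ?sqr_coord_zstat//.
  by rewrite lt_neqAle eq_sym n0 mulr_ge0 ?(ltW s10)// zstat_ge0.
have su : \sum_i u i <= 1.
  rewrite -mulr_suml -s1z; have [->|n0] := eqVneq (s1 * z x) 0.
    by rewrite invr0 mulr0.
  by rewrite divff.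
have xu i : tnth x i ^+ 2 = u i * (s1 * z x).
  rewrite /u; have [z0|n0] := eqVneq (s1 * z x) 0; last by rewrite divfK.
  rewrite z0 mulr0; apply/eqP; rewrite eq_le sqr_ge0 andbT -z0.
  exact: sqr_coord_zstat.
move: (w x) (w' x) w0 zw zw' => W W' w0 zw zw'.
apply: (@le_trans _ _ (s1 * W * \sum_i ((p%:R + 2) * ((s i / s1) ^+ 2 * u i)
    - 2 * (s i ^+ 2 / s1 ^+ 2)))).
  rewrite mulr_sumr; apply: ler_sum => i _.
  rewrite (exprMn _ _ (tnth x i)) xu; set zx := zstat s1 x in zw zw' *.
  rewrite [leLHS](_ : _ = s1 * (s i / s1) ^+ 2 * (u i * W * (zx * W) - 2 * W
     - 4 * u i * (zx * W'))); last by field.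
  rewrite [leRHS](_ : _ = s1 * (s i / s1) ^+ 2 * (W * ((p%:R + 2) * u i - 2))); last by field.
  have q0 : 0 <= s1 * (s i / s1) ^+ 2 by apply: mulr_ge0; [exact: ltW|exact: sqr_ge0].
  rewrite (ler_wpM2l q0)//.
  have h1 : u i * W * (zx * W) <= u i * W * (p%:R - 2).
    by rewrite -bp ler_wpM2l// mulr_ge0// ltW.
  have h2 : u i * - W <= u i * (zx * W') by rewrite ler_wpM2l.
  nra.
rewrite pmulr_rle0 ?mulr_gt0// sumrB -!mulr_sumr.
have : \sum_i (s i / s1) ^+ 2 * u i <= 1.
  apply: le_trans su; apply: ler_sum => i _; rewrite ler_piMl//.
  rewrite expr_le1// ?divr_ge0 ?(ltW s10) ?(ltW (s0 i))//.
  by rewrite ler_pdivrMr// mul1r.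
set A := \sum_i _; have p0 : 0 <= p%:R :> R by [].
move=> A1; have : (p%:R + 2) * A <= p%:R + 2 by rewrite ler_piMr// addr_ge0.
move: cond; set B := \sum_i _; lra.
Qed.

(** The loss is expanded around [x]; Stein's identity turns the cross term, which
    involves [theta], into the function bounded in [shrinkage_excess_le0]. *)
Lemma risk_shrinkage_le theta :
  p%:R - 2 <= 2 * (\sum_i s i ^+ 2 / s1 ^+ 2 - 2) ->
  (risk Sigma delta theta <= (\sum_i s i)%:E)%E.
Proof.
move=> cond.
pose S i x := ((tnth x i - tnth theta i) * (tnth x i * w x) -
     s i * (w x + 2 * tnth x i ^+ 2 * w' x / s1)) * gaussp (tnth theta) s x.
have HS i := stein_coord_shrink s10 b1 theta i s0.
have [iS IS] := Rintegral_lincomb_eq0 (index_enum 'I_p) (fun i => - 2 * (s i / s1))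
  (fun i => (HS i).1) (fun i => (HS i).2).
have v0 : leb.-integrable setT
    (EFin \o (fun x => sqdist (tnth theta) (tnth x) * gaussp (tnth theta) s x)).
  apply: (@integrable_le_gaussp _ _ _ _ 1) => //.
    apply: (measurable_sqdist (a := fun i _ => tnth theta i) (b := fun i t => tnth t i)) => // i.
    exact: measurable_tnth.
  by move=> x; rewrite ger0_norm ?sqdist_ge0// mul1r lerDr.
rewrite riskE//.
apply: (@le_trans _ _ (\int[leb]_x (sqdist (tnth theta) (tnth x) * gaussp (tnth theta) s x +
   \sum_i - 2 * (s i / s1) * S i x)%:E)%E).
  apply: ge0_le_integral => //.
  - by move=> x _; rewrite lee_fin mulr_ge0 ?sqdist_ge0 ?gaussp_ge0.
  - apply/measurable_EFinP; apply: measurable_funM; last exact: measurable_gaussp1.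
    apply: (measurable_sqdist (a := fun i t => tnth (delta t) i) (b := fun i t => tnth theta i)) => // i.
    exact: (measurableT_comp (measurable_tnth i) mdelta).
  - exact: measurable_int (integrableD measurableT v0 iS).
  - move=> x _; rewrite lee_fin.
    have -> : \sum_i - 2 * (s i / s1) * S i x = (\sum_i - 2 * (s i / s1) *
       ((tnth x i - tnth theta i) * (tnth x i * w x) -
       s i * (w x + 2 * tnth x i ^+ 2 * w' x / s1))) * gaussp (tnth theta) s x.
      by rewrite mulr_suml; apply: eq_bigr => i _; exact: mulrA.
    rewrite -mulrDl ler_wpM2r ?gaussp_ge0// -big_split /= -subr_le0 -sumrB.
    apply: le_trans (shrinkage_excess_le0 x cond); rewrite le_eqVlt; apply/orP; left.
    by apply/eqP; apply: eq_bigr => i _; rewrite deltaE; ring.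
under eq_integral do rewrite EFinD.
rewrite integralD// integral_gaussp_sqdist// integral_EFin_Rintegral// IS adde0.
by rewrite lee_fin /sqdist big1 ?add0r// => i _; rewrite subrr expr0n.
Qed.

(** Let [g = x i ^ 2 * w] and [f = g * w].  Summing [stein_radial] over [j] with
    weights [1 / a j] gives, in expectation,
    [(\sum_j x j ^ 2 / a j) * f = (p + 2) * f + 4 * g * (z * w')].  The left-hand
    side is at most [s1 / tau * z * f], which is at most [(p - 2) * (s1 / tau) * g]
    because [z * w <= p - 2]; the right-hand side is at least [(p - 2) * f] because
    [z * w' >= - w]. *)
Lemma radial_bound (a : 'I_p -> R) (tau : R) (i : 'I_p) : 2 < p%:R :> R ->
  0 < tau -> (forall i, tau <= a i) ->
  (\int[leb]_x (tnth x i ^+ 2 * w x ^+ 2 * gaussp (fun=> 0) a x)%:E <=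
  \int[leb]_x (s1 / tau * (tnth x i ^+ 2 * w x) * gaussp (fun=> 0) a x)%:E)%E.
Proof.
move=> p2 tau0 taua.
have a0 j : 0 < a j by exact: lt_le_trans (taua j).
pose f x := tnth x i ^+ 2 * w x ^+ 2.
pose g x := tnth x i ^+ 2 * w x.
pose H j x := (tnth x j ^+ 2 * f x - a j * ((1 + 2 * (i == j)%:R) * f x +
     4 * tnth x i ^+ 2 * w x * w' x * tnth x j ^+ 2 / s1)) * gaussp (fun=> 0) a x.
have HS j := stein_radial s10 b1 i j a0.
have [iS IS] := Rintegral_lincomb_eq0 (index_enum 'I_p) (fun j => (a j)^-1)
  (fun j => (HS j).1) (fun j => (HS j).2).
have g0 x : 0 <= g x by rewrite mulr_ge0 ?sqr_ge0// ltW// shrink_gt0.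
have f0 x : 0 <= f x by rewrite mulr_ge0 ?sqr_ge0.
have fg x : f x <= g x.
  rewrite /f /g ler_wpM2l ?sqr_ge0// expr2 ler_piMr ?shrink_le1// ltW//.
  exact: shrink_gt0.
have gC x : g x <= s1 * (2 * (b + 1)) by exact: sqr_coord_shrink_le.
have mg : measurable_fun setT g.
  by apply: measurable_funM; [apply: measurable_funX; exact: measurable_tnth|exact: measurable_shrink].
have mf : measurable_fun setT f.
  by apply: measurable_funM; apply: measurable_funX; [exact: measurable_tnth|exact: measurable_shrink].
have iB (h : p.-tuple R -> R) : measurable_fun setT h -> (forall x, 0 <= h x <= g x) ->
    leb.-integrable setT (EFin \o (fun x => h x * gaussp (fun=> 0) a x)).
  move=> mh hg; apply: (@integrable_le_gaussp _ _ _ _ (s1 * (2 * (b + 1)))) => // x.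
  have /andP[h0 hgx] := hg x; rewrite ger0_norm//.
  apply: le_trans hgx _; apply: le_trans (gC x) _.
  by rewrite ler_peMr ?lerDl ?sqdist_ge0// (le_trans (g0 x)).
have fi : leb.-integrable setT (EFin \o (fun x => f x * gaussp (fun=> 0) a x)).
  by apply: iB => // x; rewrite f0 fg.
have gi : leb.-integrable setT (EFin \o (fun x => g x * gaussp (fun=> 0) a x)).
  by apply: iB => // x; rewrite g0 lexx.
have pos : 0 < p%:R - 2 :> R by rewrite subr_gt0.
have key x : (p%:R - 2) * (f x * gaussp (fun=> 0) a x) +
     \sum_j (a j)^-1 * H j x <=
     (p%:R - 2) * (s1 / tau * g x * gaussp (fun=> 0) a x).
  (* the sum over j of [1 + 2 * (i == j)%:R] is [p + 2] *)
  have E : \sum_j (a j)^-1 * H j x = ((\sum_j tnth x j ^+ 2 / a j) * f x - (p%:R + 2) * f x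
      - 4 * g x * (z x * w' x)) * gaussp (fun=> 0) a x.
    rewrite /H; under eq_bigr => j _.
      rewrite (_ : (a j)^-1 * _ = (tnth x j ^+ 2 / a j * f x - (1 + 2 * (i == j)%:R) * f x
       - 4 * g x * w' x / s1 * tnth x j ^+ 2) * gaussp (fun=> 0) a x); last first.
        by rewrite /g; field; rewrite !gt_eqF.
      over.
    rewrite -mulr_suml !sumrB -!mulr_suml -mulr_sumr big_split /= sumr_const card_ord.
    have -> : \sum_(k < p) 2 * (i == k)%:R = 2 :> R.
      rewrite -mulr_sumr (bigD1 i)//= eqxx big1 ?addr0 ?mulr1// => j ij.
      by rewrite eq_sym (negbTE ij).
    congr ((_ - _ - _) * _).
    rewrite /zstat; field; by rewrite gt_eqF.
  rewrite E (mulrA _ (f x)) -mulrDl (mulrA _ (s1 / tau * g x)) ler_wpM2r ?gaussp_ge0//.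
  have h1 : \sum_j tnth x j ^+ 2 / a j <= s1 / tau * z x.
    have -> : s1 / tau * z x = (\sum_j tnth x j ^+ 2) / tau.
      by rewrite /zstat; field; rewrite !gt_eqF.
    rewrite mulr_suml; apply: ler_sum => j _.
    by rewrite ler_wpM2l ?sqr_ge0// lef_pV2// posrE.
  have h2 : - w x <= z x * w' x by exact: mul_dshrink_ge.
  have h3 : z x * w x <= p%:R - 2 by rewrite -bp; exact: mul_shrink_le.
  have h4 : (\sum_j tnth x j ^+ 2 / a j) * f x <= s1 / tau * z x * f x.
    by rewrite ler_wpM2r.
  have h5 : s1 / tau * z x * f x <= s1 / tau * g x * (p%:R - 2).
    rewrite (_ : s1 / tau * z x * f x = s1 / tau * g x * (z x * w x)); last by rewrite /f /g; ring.
    by rewrite ler_wpM2l// mulr_ge0// divr_ge0 ?(ltW s10)// ltW.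
  have h6 : g x * (- w x) <= g x * (z x * w' x) by rewrite ler_wpM2l.
  have h7 : g x * w x = f x by rewrite /f /g; ring.
  have h8 : (p%:R - 2) * (s1 / tau * g x) = s1 / tau * g x * (p%:R - 2) by ring.
  by rewrite h8; move: h4 h5 h6; rewrite mulrN h7; lra.
have c1 : leb.-integrable setT (EFin \o (fun x => (p%:R - 2) * (f x * gaussp (fun=> 0) a x))).
  exact: integrableZl fi.
have gi' : leb.-integrable setT (EFin \o (fun x => s1 / tau * g x * gaussp (fun=> 0) a x)).
  rewrite (_ : _ \o _ = EFin \o (fun x => s1 / tau * (g x * gaussp (fun=> 0) a x))).
    exact: integrableZl gi.
  by apply/funext => x; rewrite /= mulrA.
have c2 : leb.-integrable setT (EFin \o (fun x => (p%:R - 2) * (s1 / tau * g x * gaussp (fun=> 0) a x))).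
  exact: integrableZl gi'.
have := @le_Rintegral _ _ _ leb setT _ _ measurableT (integrableD measurableT c1 iS) c2 (fun x _ => key x).
rewrite RintegralD// IS addr0 !RintegralZl// (ler_pM2l pos).
by rewrite !integral_EFin_Rintegral// lee_fin.
Qed.

End risk_bounds.

(** * Minimax values and the ensemble risk *)

Section ensemble.
Context {R : realType} {p : nat}.
Local Notation leb := (lebesgue_tuple R p).
Implicit Types (x theta : p.-tuple R) (delta : p.-tuple R -> p.-tuple R).
Variables (s : 'I_p -> R).
Hypotheses (s0 : forall i, 0 < s i).
Local Notation Sigma := (diag_mx (\row_i s i)).

Lemma ensemble_weightE (tau : R) theta : 0 < tau ->
  ((2 * pi * tau) `^ (p%:R / 2))^-1 * expR (- (sqnorm (colv theta) / (2 * tau))) =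
  gaussp (fun=> 0) (fun=> tau) theta.
Proof.
move=> tau0; rewrite /gaussp /gauss big_split /=; congr (_ * _).
  rewrite prodr_const card_ord exprVn; congr (_^-1).
  have p0 : 0 <= 2 * pi * tau by rewrite !mulr_ge0 ?pi_ge0// ltW.
  by rewrite [p%:R / 2]mulrC powRrM powR12_sqrt ?powR_mulrn ?sqrtr_ge0.
rewrite -expR_sum; congr expR; rewrite /sqnorm mulr_suml -sumrN.
by apply: eq_bigr => i _; rewrite mxE subr0.
Qed.

Lemma ensemble_riskE delta (tau : R) : measurable_fun setT delta -> 0 < tau ->
  (ensemble_risk Sigma delta tau = \int[leb]_x (bayes_loss (fun=> tau) s delta x *
     gaussp (fun=> 0) (fun i => tau + s i)%R x)%:E)%E.
Proof.
move=> md tau0; rewrite -bayes_risk//; apply: eq_integral => theta _.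
by rewrite ensemble_weightE.
Qed.

Lemma le_sup_ensemble_risk delta (tau : R) : 0 < tau ->
  (ensemble_risk Sigma delta tau <= sup_ensemble_risk Sigma delta)%E.
Proof. by move=> tau0; apply: ereal_sup_ubound; exists tau. Qed.

Lemma integral_gaussp_cst (m v : 'I_p -> R) (c : R) : (forall i, 0 < v i) ->
  0 <= c -> (\int[leb]_x (c * gaussp m v x)%:E = c%:E)%E.
Proof.
move=> v0 c0; under eq_integral do rewrite EFinM.
rewrite ge0_integralZl_EFin ?integral_gaussp ?mule1//.
- by move=> x _; rewrite lee_fin gaussp_ge0.
- by apply/measurable_EFinP; exact: measurable_gaussp1.
Qed.

Lemma measurable_bayes_loss (v : 'I_p -> R) delta : measurable_fun setT delta ->
  measurable_fun setT (bayes_loss v s delta).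
Proof.
move=> md; apply: measurable_funD => //.
apply: (measurable_sqdist (a := fun i t => tnth (delta t) i)
  (b := fun i t => v i / (v i + s i) * tnth t i)) => i.
  exact: (measurableT_comp (measurable_tnth i) md).
by apply: measurable_funM => //; exact: measurable_tnth.
Qed.

Lemma bayes_loss_ge0 (v : 'I_p -> R) delta x : (forall i, 0 < v i) ->
  0 <= bayes_loss v s delta x.
Proof.
move=> v0; rewrite addr_ge0 ?sqdist_ge0// sumr_ge0// => i _.
by rewrite mulr_ge0 ?divr_ge0 ?addr_ge0// ltW.
Qed.

(** The Bayes risk [k] for the prior [N (0, tau I)] differs from the sum of the
    variances by at most [(\sum_i s i ^ 2) / tau]. *)
Lemma sup_ensemble_risk_ge delta : measurable_fun setT delta ->
  ((\sum_i s i)%:E <= sup_ensemble_risk Sigma delta)%E.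
Proof.
move=> md; apply/lee_addgt0Pr => e e0.
pose B := \sum_i s i ^+ 2.
have B0 : 0 <= B by apply: sumr_ge0 => i _; exact: sqr_ge0.
(* [B + 1] instead of [B] keeps [tau] positive when [p = 0] *)
pose tau := (B + 1) / e.
have tau0 : 0 < tau by rewrite divr_gt0// ltr_wpDl.
have Be : B / tau <= e.
  rewrite /tau invf_div mulrCA ler_piMr ?(ltW e0)// ler_pdivrMr ?mul1r ?lerDl//.
  by rewrite ltr_wpDl.
have vs i : 0 < tau + s i by rewrite addr_gt0.
pose k := \sum_i tau / (tau + s i) * s i.
have k0 : 0 <= k.
  by apply: sumr_ge0 => i _; apply: mulr_ge0; [apply: divr_ge0|]; exact: ltW.
apply: (@le_trans _ _ (k + e)%:E).
  rewrite lee_fin -lerBlDl; apply: le_trans Be.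
  rewrite /k /B mulr_suml -sumrB; apply: ler_sum => i _.
  rewrite (_ : s i - _ = s i ^+ 2 / (tau + s i)); last by field; rewrite gt_eqF.
  by rewrite ler_wpM2l ?sqr_ge0// lef_pV2 ?posrE// lerDl ltW.
rewrite EFinD leeD2r//; apply: le_trans (le_sup_ensemble_risk delta tau0).
rewrite ensemble_riskE// -(@integral_gaussp_cst (fun=> 0) (fun i => tau + s i) k)//.
apply: ge0_le_integral => //.
- by move=> x _; rewrite lee_fin mulr_ge0 ?gaussp_ge0.
- by apply/measurable_EFinP; apply: measurable_funM => //; exact: measurable_gaussp1.
- apply/measurable_EFinP; apply: measurable_funM; last exact: measurable_gaussp1.
  exact: measurable_bayes_loss.
- by move=> x _; rewrite lee_fin ler_wpM2r ?gaussp_ge0// lerDr sqdist_ge0.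
Qed.

Lemma ensemble_risk_le_sup delta (tau : R) : measurable_fun setT delta -> 0 < tau ->
  (ensemble_risk Sigma delta tau <= sup_risk Sigma delta)%E.
Proof.
move=> md tau0.
have sup0 : (0 <= sup_risk Sigma delta)%E.
  apply: le_trans (risk_ge0 Sigma delta [tuple 0 | i < p]) _.
  by apply: ereal_sup_ubound; exists [tuple 0 | i < p].
have mw : measurable_fun setT (fun theta => (gaussp (fun=> 0) (fun _ : 'I_p => tau) theta)%:E).
  by apply/measurable_EFinP; exact: measurable_gaussp1.
rewrite -[leRHS]mule1 -(@integral_gaussp R p (fun=> 0) (fun=> tau) (fun=> tau0)).
rewrite -ge0_integralZl//; last by move=> theta _; rewrite lee_fin gaussp_ge0.
have -> : ensemble_risk Sigma delta tau = (\int[leb]_theta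
    (risk Sigma delta theta * (gaussp (fun=> 0) (fun=> tau) theta)%:E))%E.
  by apply: eq_integral => theta _; rewrite ensemble_weightE.
apply: ge0_le_integral => //.
- by move=> theta _; rewrite mule_ge0 ?risk_ge0// lee_fin gaussp_ge0.
- by apply: emeasurable_funM => //; exact: measurable_risk.
- by apply: emeasurable_funM.
- move=> theta _; apply: lee_wpmul2r; first by rewrite lee_fin gaussp_ge0.
  by apply: ereal_sup_ubound; exists theta.
Qed.

Lemma sup_risk_ge delta : measurable_fun setT delta ->
  ((\sum_i s i)%:E <= sup_risk Sigma delta)%E.
Proof.
move=> md; apply: le_trans (sup_ensemble_risk_ge md) _.
by apply: ge_ereal_sup => _ [tau tau0 <-]; exact: ensemble_risk_le_sup.
Qed.

Lemma minimax_of_risk_le delta : measurable_fun setT delta ->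
  (forall theta, (risk Sigma delta theta <= (\sum_i s i)%:E)%E) ->
  minimax Sigma delta.
Proof.
move=> md H; split => //; apply/eqP; rewrite eq_le; apply/andP; split.
  apply: (@le_trans _ _ (\sum_i s i)%:E).
    by apply: ge_ereal_sup => _ [theta _ <-].
  by apply: le_ereal_inf_tmp => _ [d' md' <-]; exact: sup_risk_ge.
by apply: ereal_inf_lbound; exists delta.
Qed.

Lemma ensemble_minimax_of_le delta : measurable_fun setT delta ->
  (forall tau, 0 < tau -> (ensemble_risk Sigma delta tau <= (\sum_i s i)%:E)%E) ->
  ensemble_minimax Sigma delta.
Proof.
move=> md H; split => //; apply/eqP; rewrite eq_le; apply/andP; split.
  apply: (@le_trans _ _ (\sum_i s i)%:E).
    by apply: ge_ereal_sup => _ [tau tau0 <-]; exact: H.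
  by apply: le_ereal_inf_tmp => _ [d' md' <-]; exact: sup_ensemble_risk_ge.
by apply: ereal_inf_lbound; exists delta.
Qed.

Variables (s1 b : R).
Hypotheses (s10 : 0 < s1) (b1 : -1 < b) (bp : 2 * (b + 1) = p%:R - 2).
Hypothesis (p2 : 2 < p%:R :> R).
Hypotheses (ss1 : forall i, s i <= s1).
Variable delta : p.-tuple R -> p.-tuple R.
Hypothesis mdelta : measurable_fun setT delta.
Local Notation z := (zstat s1).
Local Notation w x := (shrink b (z x)).
Hypothesis deltaE : forall x i, tnth (delta x) i = tnth x i - s i / s1 * w x * tnth x i.

(** If [tau <= s1] the inequality holds pointwise, since
    [w <= 1 <= 2 * s1 / (tau + s i)].  If [tau > s1] the factor [s1 / tau] of
    [radial_bound] is smaller than [2 * s1 / (tau + s i)]. *)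
Lemma shrink_gain (tau : R) i : 0 < tau ->
  (\int[leb]_x (tnth x i ^+ 2 * w x ^+ 2 *
     gaussp (fun=> 0) (fun i => tau + s i) x)%:E <=
   \int[leb]_x (2 * s1 / (tau + s i) * (tnth x i ^+ 2 * w x) *
     gaussp (fun=> 0) (fun i => tau + s i) x)%:E)%E.
Proof.
move=> tau0; pose g x := gaussp (fun=> 0) (fun i => tau + s i) x.
have vs j : 0 < tau + s j by rewrite addr_gt0.
have w0 x : 0 < w x by exact: shrink_gt0.
have g0 x : 0 <= g x by exact: gaussp_ge0.
have mg : measurable_fun setT g by exact: measurable_gaussp1.
have mx : measurable_fun setT (fun x : p.-tuple R => tnth x i ^+ 2).
  by apply: measurable_funX; exact: measurable_tnth.
have mw : measurable_fun setT (fun x : p.-tuple R => w x) by exact: measurable_shrink.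
have mF c : measurable_fun setT (fun x => (c * (tnth x i ^+ 2 * w x) * g x)%:E).
  by apply/measurable_EFinP; apply: measurable_funM => //; apply: measurable_funM => //; exact: measurable_funM.
have mQ : measurable_fun setT (fun x => (tnth x i ^+ 2 * w x ^+ 2 * g x)%:E).
  apply/measurable_EFinP; apply: measurable_funM => //; apply: measurable_funM => //.
  exact: measurable_funX.
have [ts|st] := leP tau s1.
  apply: ge0_le_integral => //.
  - by move=> x _; rewrite lee_fin mulr_ge0// mulr_ge0 ?sqr_ge0.
  - move=> x _; rewrite lee_fin ler_wpM2r// (mulrCA (2 * s1 / (tau + s i))) ler_wpM2l ?sqr_ge0//.
    rewrite expr2 ler_wpM2r// ?(ltW (w0 x))//; apply: le_trans (shrink_le1 b1 _) _.
    by rewrite ler_pdivlMr// mul1r; have := ss1 i; lra.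
have := @radial_bound _ _ s1 b s10 b1 bp (fun i => tau + s i) tau i p2 tau0 _.
move=> /(_ (fun i => _)) H.
apply: le_trans (H _) _; first by move=> j; rewrite lerDl ltW.
apply: ge0_le_integral => //.
- move=> x _; rewrite lee_fin; apply: mulr_ge0 => //; apply: mulr_ge0; last by rewrite mulr_ge0 ?sqr_ge0// ltW.
  by apply: divr_ge0; exact: ltW.
- move=> x _; rewrite lee_fin ler_wpM2r//.
  have xw0 : 0 <= tnth x i ^+ 2 * w x by rewrite mulr_ge0 ?sqr_ge0// ltW.
  rewrite (ler_wpM2r xw0)// (ler_pdivrMr _ _ tau0) mulrAC ler_pdivlMr//.
  by rewrite -(mulrA 2) (mulrCA 2) ler_pM2l//; have := ss1 i; lra.
Qed.

(** The posterior loss is that of the identity estimator, whose integral is the sum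
    of the variances, minus a term linear and plus a term quadratic in [w], which
    [shrink_gain] compares. *)
Lemma ensemble_risk_shrinkage_le (tau : R) : 0 < tau ->
  (ensemble_risk Sigma delta tau <= (\sum_i s i)%:E)%E.
Proof.
move=> tau0; rewrite ensemble_riskE//.
pose a i := tau + s i; pose g x := gaussp (fun=> 0) a x.
have a0 j : 0 < a j by rewrite addr_gt0.
have w0 x : 0 < w x by exact: shrink_gt0.
have g0 x : 0 <= g x by exact: gaussp_ge0.
have mg : measurable_fun setT g by exact: measurable_gaussp1.
have mx i : measurable_fun setT (fun x : p.-tuple R => tnth x i ^+ 2).
  by apply: measurable_funX; exact: measurable_tnth.
have mw : measurable_fun setT (fun x : p.-tuple R => w x) by exact: measurable_shrink.
pose c i := (s i / s1) ^+ 2.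
have c0 i : 0 <= c i by exact: sqr_ge0.
pose q i x := tnth x i ^+ 2 * w x ^+ 2 * g x.
pose n i x := 2 * s1 / (tau + s i) * (tnth x i ^+ 2 * w x) * g x.
have q0 i x : 0 <= q i x by rewrite mulr_ge0// mulr_ge0 ?sqr_ge0.
have n0 i x : 0 <= n i x.
  apply: mulr_ge0 => //; apply: mulr_ge0; last by rewrite mulr_ge0 ?sqr_ge0// ltW.
  by apply: divr_ge0; [exact: mulr_ge0 (ltW s10)|exact: ltW (a0 i)].
have mq i : measurable_fun setT (q i).
  by apply: measurable_funM => //; apply: measurable_funM => //; exact: measurable_funX.
have mn i : measurable_fun setT (n i).
  by apply: measurable_funM => //; apply: measurable_funM => //; exact: measurable_funM.
pose P x := ((\sum_i (s i / a i) ^+ 2 * tnth x i ^+ 2) + \sum_i tau / a i * s i) * g x.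
have P0 x : 0 <= P x.
  rewrite mulr_ge0// addr_ge0//; apply: sumr_ge0 => i _; first by rewrite mulr_ge0 ?sqr_ge0.
  by apply: mulr_ge0; [apply: divr_ge0|]; apply: ltW => //; exact: a0.
have mP : measurable_fun setT P.
  apply: measurable_funM => //; apply: measurable_funD => //.
  by apply: measurable_sum => i; exact: measurable_funM.
pose L x := bayes_loss (fun=> tau) s delta x * g x.
have L0 x : 0 <= L x by rewrite mulr_ge0// bayes_loss_ge0.
have mL : measurable_fun setT L.
  by apply: measurable_funM => //; exact: measurable_bayes_loss.
pose N x := \sum_i c i * n i x; pose Q x := \sum_i c i * q i x.
have N0 x : 0 <= N x by apply: sumr_ge0 => i _; rewrite mulr_ge0.
have Q0 x : 0 <= Q x by apply: sumr_ge0 => i _; rewrite mulr_ge0.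
have mN : measurable_fun setT N by apply: measurable_sum => i; exact: measurable_funM.
have mQ : measurable_fun setT Q by apply: measurable_sum => i; exact: measurable_funM.
(* [P] is the loss of the identity estimator, [N] the linear term and [Q] the
   quadratic one; moving [N] to the left keeps every integrand nonnegative *)
have LNPQ x : L x + N x = P x + Q x.
  rewrite /L /N /P /Q /bayes_loss /sqdist.
  under [X in _ + X]eq_bigr do rewrite /n mulrA.
  under [X in _ = _ + X]eq_bigr do rewrite /q mulrA.
  rewrite -!mulr_suml -!mulrDl; congr (_ * _).
  rewrite addrAC [RHS]addrAC; congr (_ + _); rewrite -!big_split /=; apply: eq_bigr => i _.
  rewrite deltaE /c /a; field.
  by rewrite !gt_eqF//; exact: a0.
have EP : (\int[leb]_x (P x)%:E = (\sum_i s i)%:E)%E.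
  transitivity (\int[leb]_x (\sum_i ((s i / a i) ^+ 2)%:E * ((0 - tnth x i) ^+ 2 * g x)%:E
     + ((\sum_i tau / a i * s i) * g x)%:E))%E.
    apply: eq_integral => x _; rewrite /P mulrDl EFinD; congr (_ + _)%E.
    by rewrite mulr_suml -sumEFin; apply: eq_bigr => i _; rewrite -EFinM sub0r sqrrN; congr EFin; exact/esym/mulrA.
  have mi i : measurable_fun setT (fun x => (((0 - tnth x i) ^+ 2 * g x))%:E).
    apply/measurable_EFinP; apply: measurable_funM => //; apply: measurable_funX.
    by apply: measurable_funB => //; exact: measurable_tnth.
  have k0 : 0 <= \sum_i tau / a i * s i.
    by apply: sumr_ge0 => i _; apply: mulr_ge0; [apply: divr_ge0|]; exact: ltW.
  rewrite ge0_integralD//; last 4 first.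
  - by move=> x _; apply: sume_ge0 => i _; rewrite -EFinM lee_fin mulr_ge0 ?sqr_ge0// mulr_ge0 ?sqr_ge0.
  - by apply: emeasurable_sum => i; apply: emeasurable_funM.
  - by move=> x _; rewrite lee_fin mulr_ge0.
  - by apply/measurable_EFinP; exact: measurable_funM.
  rewrite integral_gaussp_cst// ge0_integral_sum//; last 2 first.
  - by move=> i; apply: emeasurable_funM.
  - by move=> i x _; rewrite -EFinM lee_fin mulr_ge0 ?sqr_ge0// mulr_ge0 ?sqr_ge0.
  under eq_bigr => i _.
    rewrite ge0_integralZl_EFin ?sqr_ge0//; last first.
      by move=> x _; rewrite lee_fin mulr_ge0 ?sqr_ge0.
    rewrite integral_gaussp_coord// subrr expr0n add0r -EFinM.
    over.
  rewrite sumEFin -EFinD -big_split /=; congr EFin; apply: eq_bigr => i _.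
  by rewrite /a; field; rewrite gt_eqF//; exact: a0.
have sumE (h : 'I_p -> p.-tuple R -> R) : (forall i, measurable_fun setT (h i)) ->
    (forall i x, 0 <= h i x) ->
    (\int[leb]_x (\sum_i c i * h i x)%:E = \sum_i (c i)%:E * \int[leb]_x (h i x)%:E)%E.
  move=> mh h0; under eq_integral do rewrite -sumEFin.
  rewrite ge0_integral_sum//; last 2 first.
  - by move=> i; apply/measurable_EFinP; exact: measurable_funM.
  - by move=> i x _; rewrite lee_fin mulr_ge0.
  apply: eq_bigr => i _; under eq_integral do rewrite EFinM.
  rewrite ge0_integralZl_EFin//; first by move=> x _; rewrite lee_fin.
  exact/measurable_EFinP.
have QN : (\int[leb]_x (Q x)%:E <= \int[leb]_x (N x)%:E)%E.
  rewrite !sumE//; apply: lee_sum => i _; apply: lee_wpmul2l; first by rewrite lee_fin.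
  exact: shrink_gain.
have Nfin : (\int[leb]_x (N x)%:E)%E \is a fin_num.
  rewrite sumE//; apply/sum_fin_numP => i _ _; rewrite fin_numM//.
  rewrite ge0_fin_numE; last by apply: integral_ge0 => x _; rewrite lee_fin.
  apply: (@le_lt_trans _ _ (\int[leb]_x (2 * s1 / (tau + s i) * (s1 * (2 * (b + 1))) * g x)%:E)%E).
    apply: ge0_le_integral => //.
    - by move=> x _; rewrite lee_fin.
    - exact/measurable_EFinP.
    - by apply/measurable_EFinP; exact: measurable_funM.
    - move=> x _; rewrite lee_fin ler_wpM2r// ler_wpM2l ?sqr_coord_shrink_le//.
      by rewrite divr_ge0 ?mulr_ge0// ltW//; exact: a0.
  rewrite integral_gaussp_cst ?ltry// mulr_ge0//.
    by rewrite divr_ge0 ?mulr_ge0// ltW//; exact: a0.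
  by rewrite bp mulr_ge0 ?subr_ge0 ?(ltW s10)// ltW.
change (\int[leb]_x (L x)%:E <= (\sum_i s i)%:E)%E.
rewrite -(leeD2rE _ _ Nfin) -EP.
rewrite -ge0_integralD//; last 4 first.
- by move=> x _; rewrite lee_fin.
- exact/measurable_EFinP.
- by move=> x _; rewrite lee_fin.
- exact/measurable_EFinP.
under eq_integral do rewrite -EFinD LNPQ EFinD.
rewrite ge0_integralD//; last 4 first.
- by move=> x _; rewrite lee_fin.
- exact/measurable_EFinP.
- by move=> x _; rewrite lee_fin.
- exact/measurable_EFinP.
by rewrite leeD2l.
Qed.

End ensemble.

(** * Logarithmic cutoffs *)

Definition weighted_integral {R : realType} (rho : R -> R) (a z : R) : R :=
  \int[@lebesgue_measure R]_(l in `]0, 1[) (shrink_kernel a z l * rho l).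

Section weighted_integral.
Context {R : realType}.
Local Notation mu := (@lebesgue_measure R).
Implicit Types (a z l : R) (rho : R -> R).

Lemma integrable_weighted rho a z : -1 < a -> measurable_fun setT rho ->
  (forall l, 0 < l < 1 -> 0 <= rho l <= 1) ->
  mu.-integrable `]0, 1[ (EFin \o (fun l => shrink_kernel a z l * rho l)).
Proof.
move=> a1 mrho rho01; apply: (@le_integrable _ _ _ mu _ _ _
  (EFin \o shrink_kernel a z)) => //.
- apply/measurable_EFinP; apply: measurable_funM; first exact: measurable_shrink_kernel.
  exact: measurable_funTS.
- move=> l; rewrite /= in_itv/= => l01; have /andP[r0 r1] := rho01 l l01.
  have k0 := shrink_kernel_ge0 a z l.
  by rewrite lee_fin ger0_norm ?(mulr_ge0 k0 r0)// ger0_norm// ler_piMr.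
- exact: integrable_shrink_kernel.
Qed.

Lemma weighted_integral_ge0 rho a z : (forall l, 0 < l < 1 -> 0 <= rho l <= 1) ->
  0 <= weighted_integral rho a z.
Proof.
move=> rho01; apply: Rintegral_ge0 => l; rewrite /= in_itv/= => /rho01/andP[r0 _].
by rewrite mulr_ge0 ?shrink_kernel_ge0.
Qed.

Lemma weighted_integral_le rho1 rho2 a z : -1 < a ->
  measurable_fun setT rho1 -> measurable_fun setT rho2 ->
  (forall l, 0 < l < 1 -> 0 <= rho1 l <= 1) ->
  (forall l, 0 < l < 1 -> 0 <= rho2 l <= 1) ->
  (forall l, 0 < l < 1 -> rho1 l <= rho2 l) ->
  weighted_integral rho1 a z <= weighted_integral rho2 a z.
Proof.
move=> a1 m1 m2 r1 r2 r12; apply: le_Rintegral => //; [exact: integrable_weighted..|].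
move=> l; rewrite /= in_itv/= => l01.
by rewrite ler_wpM2l ?shrink_kernel_ge0// r12.
Qed.

Lemma weighted_integral1 a z : weighted_integral (fun=> 1) a z = kernel_integral a z.
Proof. by apply: eq_Rintegral => l _; rewrite mulr1. Qed.

Lemma measurable_shrink_kernel2 a : measurable_fun setT (fun zl : R * R => shrink_kernel a zl.1 zl.2).
Proof.
apply: measurable_funM.
  by apply: (measurableT_comp (measurable_powR a)); exact: measurable_snd.
apply: measurableT_comp => //; apply: measurableT_comp => //.
apply: measurable_funM => //; apply: measurable_funM; first exact: measurable_fst.
exact: measurable_snd.
Qed.

End weighted_integral.

Section cutoff.
Context {R : realType}.
Local Notation mu := (@lebesgue_measure R).
Variable N : R.
Hypothesis N0 : 0 < N.
Implicit Types (a z l : R).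

(** A cutoff tending to 1 with little energy: the integral of [l * (cutoff' l) ^ 2]
    is [1 / N]. *)
Definition cutoff l : R := Num.max 0 (1 + ln l / N).

Lemma measurable_cutoff : measurable_fun setT cutoff.
Proof.
apply: measurable_maxr => //; apply: measurable_funD => //.
by apply: measurable_funM => //; exact: measurable_ln.
Qed.

Lemma cutoff_ge0 l : 0 <= cutoff l.
Proof. by rewrite le_max lexx. Qed.

Lemma cutoff_le1 l : l <= 1 -> cutoff l <= 1.
Proof.
by move=> l1; rewrite ge_max ler01 gerDl pmulr_lle0 ?invr_gt0// ln_le0.
Qed.

Lemma cutoff01 l : 0 < l < 1 -> 0 <= cutoff l <= 1.
Proof. by move=> /andP[_ l1]; rewrite cutoff_ge0 cutoff_le1// ltW. Qed.

Lemma cutoff_sq01 l : 0 < l < 1 -> 0 <= cutoff l ^+ 2 <= 1.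
Proof. by move=> /cutoff01/andP[h0 h1]; rewrite sqr_ge0 expr_le1. Qed.

Lemma measurable_cutoff_sq : measurable_fun setT (fun l => cutoff l ^+ 2).
Proof. by apply: measurable_funX; exact: measurable_cutoff. Qed.

Lemma le_cutoff l1 l2 : 0 < l1 -> l1 <= l2 -> cutoff l1 <= cutoff l2.
Proof.
move=> l10 l12; rewrite /cutoff ge_max le_max lexx /= le_max; apply/orP; right.
by rewrite lerD2l ler_wpM2r ?invr_ge0 ?(ltW N0)// ler_ln ?posrE// (lt_le_trans l10).
Qed.

Lemma cutoff_small l : 0 < l -> l <= expR (- N) -> cutoff l = 0.
Proof.
move=> l0 le; apply/max_idPl.
have : ln l / N <= -1.
  by rewrite ler_pdivrMr// mulN1r -(expRK (- N)) ler_ln ?posrE ?expR_gt0.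
by lra.
Qed.

Lemma cutoff_large l : expR (- N) <= l -> cutoff l = 1 + ln l / N.
Proof.
move=> le; apply/max_idPr; rewrite -lerBlDl sub0r ler_pdivlMr// mulN1r.
by rewrite -{1}(expRK (- N)) ler_ln ?posrE ?expR_gt0// (lt_le_trans (expR_gt0 (-N))).
Qed.

Lemma cutoff_gt0 l : expR (- N) < l -> 0 < cutoff l.
Proof.
move=> le; rewrite cutoff_large ?(ltW le)// -ltrBlDl sub0r ltr_pdivlMr// mulN1r.
by rewrite -{1}(expRK (- N)) ltr_ln ?posrE ?expR_gt0// (lt_trans (expR_gt0 (-N))).
Qed.

Definition cutoff_support l : R := \1_(`[expR (- N), 1[) l.

Local Notation B := (weighted_integral (fun l => cutoff l ^+ 2)).
Local Notation D := (weighted_integral cutoff).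
Local Notation C := (weighted_integral cutoff_support).

Lemma cutoff_support01 l : 0 < l < 1 -> 0 <= cutoff_support l <= 1.
Proof. by move=> _; rewrite /cutoff_support indicE; case: (_ \in _); rewrite lexx ler01. Qed.

Lemma measurable_cutoff_support : measurable_fun setT cutoff_support.
Proof. exact: measurable_indic. Qed.

Let eN1 : expR (- N) < 1 :> R.
Proof. by rewrite -expR0 ltr_expR oppr_lt0. Qed.

Lemma Rintegral_cutoff (f : R -> R) : measurable_fun setT f ->
  (forall l, 0 < l -> l < expR (- N) -> f l = 0) ->
  mu.-integrable `]0, 1[ (EFin \o f) ->
  \int[mu]_(l in `]0, 1[) f l = \int[mu]_(l in `[expR (- N), 1]) f l.
Proof.
move=> mf f0 fi; have sub : `[expR (- N), 1[%classic `<=` (`]0, 1[%classic : set R).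
  move=> l; rewrite /= !in_itv/= => /andP[el ->]; rewrite andbT.
  exact: lt_le_trans (expR_gt0 _) el.
rewrite -Rintegral_itv_bndo_bndc; last exact: integrableS fi.
rewrite Rintegral_mkcond [RHS]Rintegral_mkcond; apply: eq_Rintegral => l _.
rewrite !patchE; case: ifPn => lI.
  case: ifPn => // /negP lJ; apply: f0.
    by move: lI; rewrite inE/= in_itv/= => /andP[].
  rewrite ltNge; apply/negP => el; apply: lJ; move: lI.
  by rewrite !inE/= !in_itv/= el => /andP[].
case: ifPn => // lJ; exfalso; move/negP: lI; apply; rewrite inE; apply: sub.
by rewrite inE in lJ.
Qed.

Variables (b z : R).
Hypothesis b1 : -1 < b.
Let b11 : -1 < b + 1. Proof. by move: b1; lra. Qed.

Let iB := integrable_weighted z b1 measurable_cutoff_sq cutoff_sq01.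
Let iA := integrable_weighted z b11 measurable_cutoff_sq cutoff_sq01.
Let iD := integrable_weighted z b1 measurable_cutoff cutoff01.
Let iC := integrable_weighted z b1 measurable_cutoff_support cutoff_support01.

(** Integration by parts as in [kernel_integral_rec]; the derivative [1 / (N * l)] of
    the cutoff produces the extra term. *)
Lemma cutoff_integral_rec :
  z * B (b + 1) z = 2 * (b + 1) * B b z + 4 / N * D b z - 2 * expR (- (z / 2)).
Proof.
pose f l := ((b + 1) * shrink_kernel b z l - z / 2 * shrink_kernel (b + 1) z l) * (1 + ln l / N) ^+ 2
  + 2 / N * (shrink_kernel b z l * (1 + ln l / N)).
pose g l := (b + 1) * (shrink_kernel b z l * cutoff l ^+ 2) -
  z / 2 * (shrink_kernel (b + 1) z l * cutoff l ^+ 2) + 2 / N * (shrink_kernel b z l * cutoff l).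
have jB : mu.-integrable `]0, 1[ (EFin \o (fun l => (b + 1) * (shrink_kernel b z l * cutoff l ^+ 2))).
  exact: integrableZl iB.
have jA : mu.-integrable `]0, 1[ (EFin \o (fun l => z / 2 * (shrink_kernel (b + 1) z l * cutoff l ^+ 2))).
  exact: integrableZl iA.
have jD : mu.-integrable `]0, 1[ (EFin \o (fun l => 2 / N * (shrink_kernel b z l * cutoff l))).
  exact: integrableZl iD.
have jBA : mu.-integrable `]0, 1[ (EFin \o (fun l =>
    (b + 1) * (shrink_kernel b z l * cutoff l ^+ 2) -
    z / 2 * (shrink_kernel (b + 1) z l * cutoff l ^+ 2))).
  by have := integrableB _ jB jA; apply.
have eq1 : \int[mu]_(l in `]0, 1[) g l = (b + 1) * B b z - z / 2 * B (b + 1) z + 2 / N * D b z.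
  by rewrite RintegralD// RintegralB// !RintegralZl.
have mg : measurable_fun setT g.
  apply: measurable_funD; first apply: measurable_funB; apply: measurable_funM => //;
    apply: measurable_funM; try exact: measurable_shrink_kernel; try exact: measurable_cutoff_sq.
  exact: measurable_cutoff.
have eq2 : \int[mu]_(l in `]0, 1[) g l = \int[mu]_(l in `[expR (- N), 1]) f l.
  rewrite Rintegral_cutoff//; last 2 first.
  - by move=> l l0 le; rewrite /g cutoff_small ?(ltW le)// expr0n /= !mulr0 subr0 addr0.
  - by have := integrableD _ jBA jD; apply.
  apply: eq_Rintegral => l; rewrite inE/= in_itv/= => /andP[el _].
  by rewrite /g /f cutoff_large//; ring.
have cln l : 0 < l -> {for l, continuous (fun l : R => 1 + ln l / N)}.
  move=> l0; apply: (@cvgD _ R^o); first exact: cvg_cst.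
  by apply: cvgM; [exact: continuous_ln|exact: cvg_cst].
have dF l : l \in `[expR (- N), 1] ->
    is_derive l 1 (fun l => shrink_kernel (b + 1) z l * (1 + ln l / N) ^+ 2) (f l).
  rewrite in_itv/= => /andP[el _]; have l0 : 0 < l by exact: lt_le_trans (expR_gt0 _) el.
  have d1 := is_derive_shrink_kernel b z l0; have d2 := is_derive1_ln l0.
  apply: is_derive_eq; rewrite /f shrink_kernelS// /GRing.scale /=; field.
  by rewrite !gt_eqF.
have := Rintegral_FTC eN1 dF _; rewrite -eq2 eq1.
rewrite ln1 mul0r addr0 expr1n expRK mulNr divff; last by rewrite gt_eqF.
rewrite subrr expr0n /= mulr0 subr0.
have -> : shrink_kernel (b + 1) z 1 = expR (- (z / 2)).
  by rewrite /shrink_kernel powR1 mul1r mulr1.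
rewrite mulr1 => H.
have {}H := H _; have /H : {within `[expR (- N), 1], continuous f}.
  apply: within_continuous_pos; first exact: expR_gt0.
  move=> l l0; have c0 := @continuous_shrink_kernel _ b z l l0.
  have c1 := @continuous_shrink_kernel _ (b + 1) z l l0.
  apply: (@cvgD _ R^o).
    apply: cvgM; last by apply: cvgM; exact: cln.
    by apply: (@cvgB _ R^o); apply: cvgM => //; exact: cvg_cst.
  by apply: cvgM; [exact: cvg_cst|apply: cvgM => //; exact: cln].
by move: (B (b + 1) z) (B b z) (D b z) (expR (- (z / 2))) => u v w e {}H; lra.
Qed.

Lemma cutoff_integral_gt0 : 0 < B b z.
Proof.
rewrite lt_neqAle (weighted_integral_ge0 _ _ cutoff_sq01) andbT; apply/eqP => B0.
pose f l := shrink_kernel b z l * cutoff l ^+ 2.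
have f0 l : 0 <= f l by rewrite mulr_ge0 ?shrink_kernel_ge0 ?sqr_ge0.
have m01 : measurable (`]0, 1[%classic : set R) by [].
have mf : measurable_fun (`]0, 1[%classic : set R) (EFin \o f).
  by apply: measurable_int iB.
have [+ _] := ae_eq_integral_abs mu m01 mf.
have -> : (\int[mu]_(l in `]0%R, 1%R[) `|(EFin \o f) l| = 0)%E.
  under eq_integral do rewrite /= ger0_norm//.
  rewrite -[LHS]fineK; first by rewrite [fine _](esym B0).
  exact: integrable_fin_num.
move=> /(_ erefl) [A [mA A0 sA]].
have : (mu (`](expR (- N))%R, 1%R[%classic : set R) <= mu A)%E.
  apply: le_measure; rewrite ?inE// => l.
  rewrite /= in_itv/= => /andP[el l1]; apply: sA => /= fl0.
  have l0 : 0 < l by exact: lt_trans (expR_gt0 _) el.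
  have fl : 0 < f l by rewrite mulr_gt0 ?shrink_kernel_gt0// exprn_gt0// cutoff_gt0.
  have : (f l)%:E = 0%:E by apply: fl0; rewrite in_itv/= l0 l1.
  by move=> [fl1]; rewrite fl1 ltxx in fl.
by rewrite A0 lebesgue_measure_itv/= lte_fin eN1 -EFinD lee_fin subr_le0 leNgt eN1.
Qed.

Lemma cutoff_integral_le_kernel : B b z <= kernel_integral b z.
Proof.
rewrite -weighted_integral1; apply: weighted_integral_le => //.
- exact: measurable_cutoff_sq.
- exact: cutoff_sq01.
- by move=> l _; rewrite ler01 lexx.
- by move=> l /cutoff_sq01/andP[].
Qed.

(** Chebyshev's correlation inequality: an increasing weight raises the mean of [l]. *)
Lemma shrink_le_cutoff : shrink b z * B b z <= B (b + 1) z.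
Proof.
set w := shrink b z; have w0 : 0 < w by exact: shrink_gt0.
have w1 : w <= 1 by exact: shrink_le1.
(* [l - w] has zero integral against the kernel, so subtracting the constant [t]
   from the weight does not change the integral and makes the integrand
   nonnegative *)
pose t := cutoff w ^+ 2.
pose g l := (shrink_kernel (b + 1) z l * cutoff l ^+ 2 - w * (shrink_kernel b z l * cutoff l ^+ 2))
  - t * (shrink_kernel (b + 1) z l - w * shrink_kernel b z l).
have j1 : mu.-integrable `]0, 1[ (EFin \o (fun l => w * (shrink_kernel b z l * cutoff l ^+ 2))).
  exact: integrableZl iB.
have k0 := integrable_shrink_kernel z b1.
have k1 := integrable_shrink_kernel z b11.
have j2 : mu.-integrable `]0, 1[ (EFin \o (fun l => w * shrink_kernel b z l)).
  exact: integrableZl k0.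
have j3 : mu.-integrable `]0, 1[ (EFin \o (fun l => shrink_kernel (b + 1) z l - w * shrink_kernel b z l)).
  by have := integrableB _ k1 j2; apply.
have j4 : mu.-integrable `]0, 1[ (EFin \o (fun l => t * (shrink_kernel (b + 1) z l - w * shrink_kernel b z l))).
  exact: integrableZl j3.
have j5 : mu.-integrable `]0, 1[ (EFin \o (fun l => shrink_kernel (b + 1) z l * cutoff l ^+ 2 - w * (shrink_kernel b z l * cutoff l ^+ 2))).
  by have := integrableB _ iA j1; apply.
have : 0 <= \int[mu]_(l in `]0, 1[) g l.
  apply: Rintegral_ge0 => l; rewrite /= in_itv/= => /andP[l0 l1].
  rewrite /g shrink_kernelS// [leRHS](_ : _ = shrink_kernel b z l * ((l - w) * (cutoff l ^+ 2 - t))); last by ring.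
  rewrite mulr_ge0 ?shrink_kernel_ge0//.
  have [lw|wl] := leP l w.
    have := le_cutoff l0 lw; have := cutoff_ge0 l; have := cutoff_ge0 w.
    by rewrite /t => *; rewrite mulr_le0// ?subr_le0// ler_sqr.
  have := le_cutoff w0 (ltW wl); have := cutoff_ge0 l; have := cutoff_ge0 w.
  by rewrite /t => *; rewrite mulr_ge0// subr_ge0 ?ler_sqr// ltW.
rewrite RintegralB// RintegralB// !RintegralZl// RintegralB// RintegralZl//.
rewrite -/(kernel_integral _ _) -/(kernel_integral _ _) -/(weighted_integral _ _ _).
have -> : kernel_integral (b + 1) z = w * kernel_integral b z.
  by rewrite /w /shrink divfK// gt_eqF// kernel_integral_gt0.
by rewrite subrr mulr0 subr0 subr_ge0.
Qed.

(** The Cauchy-Schwarz inequality for [cutoff = cutoff * cutoff_support]. *)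
Lemma cutoff_integral_cauchy : D b z ^+ 2 <= B b z * C b z.
Proof.
have B0 := cutoff_integral_gt0.
have hS l : 0 < l < 1 -> cutoff l * cutoff_support l = cutoff l.
  move=> /andP[l0 l1]; rewrite /cutoff_support indicE.
  have [le|el] := leP l (expR (- N)); first by rewrite cutoff_small// mul0r.
  by rewrite mem_set ?mulr1//= in_itv/= l1 ltW.
have SS l : cutoff_support l ^+ 2 = cutoff_support l.
  by rewrite /cutoff_support indicE; case: (_ \in _); rewrite ?expr1n ?expr0n.
have C0 : 0 < C b z.
  apply: lt_le_trans B0 _; apply: weighted_integral_le => //.
  - exact: measurable_cutoff_sq.
  - exact: measurable_cutoff_support.
  - exact: cutoff_sq01.
  - exact: cutoff_support01.
  - move=> l l01; have /andP[h0 h1] := cutoff_sq01 l01.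
    by rewrite -(hS l l01) exprMn SS ler_piMl.
pose t := D b z / C b z.
have j1 : mu.-integrable `]0, 1[ (EFin \o (fun l => 2 * t * (shrink_kernel b z l * cutoff l))).
  exact: integrableZl iD.
have j2 : mu.-integrable `]0, 1[ (EFin \o (fun l => t ^+ 2 * (shrink_kernel b z l * cutoff_support l))).
  exact: integrableZl iC.
have j3 : mu.-integrable `]0, 1[ (EFin \o (fun l => shrink_kernel b z l * cutoff l ^+ 2 - 2 * t * (shrink_kernel b z l * cutoff l))).
  by have := integrableB _ iB j1; apply.
have : 0 <= \int[mu]_(l in `]0, 1[) (shrink_kernel b z l * cutoff l ^+ 2 -
   2 * t * (shrink_kernel b z l * cutoff l) + t ^+ 2 * (shrink_kernel b z l * cutoff_support l)).
  apply: Rintegral_ge0 => l; rewrite /= in_itv/= => l01.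
  rewrite [leRHS](_ : _ = shrink_kernel b z l * (cutoff l - t * cutoff_support l) ^+ 2).
    by rewrite mulr_ge0 ?shrink_kernel_ge0 ?sqr_ge0.
  have := hS l l01; have := SS l; move: (cutoff l) (cutoff_support l) => u v vv uv.
  rewrite [RHS](_ : _ = shrink_kernel b z l * (u ^+ 2 - 2 * t * (u * v) + t ^+ 2 * v ^+ 2)); last by ring.
  by rewrite vv uv; ring.
rewrite RintegralD// RintegralB// !RintegralZl//.
rewrite -/(weighted_integral _ _ _) -/(weighted_integral _ _ _) -/(weighted_integral _ _ _).
have -> : D b z = t * C b z by rewrite divfK ?gt_eqF.
move: (B b z) (C b z) B0 C0 => u v u0 v0 h; nra.
Qed.

(** In the difference of the recurrences with and without the weight, the
    boundary terms have the favourable sign and leave [4 / N * D / B]; its square is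
    bounded by [cutoff_integral_cauchy]. *)
Lemma cutoff_bound : 0 <= z ->
  B b z * (z * (B (b + 1) z / B b z - shrink b z)) ^+ 2 <= 16 / N ^+ 2 * C b z.
Proof.
move=> z0; have B0 := cutoff_integral_gt0; have n0 : B b z != 0 by rewrite gt_eqF.
have K0 := kernel_integral_gt0 z b1.
have H1 := shrink_le_cutoff; have H2 := cutoff_integral_cauchy.
have d0 : 0 <= z * (B (b + 1) z / B b z - shrink b z).
  by apply: mulr_ge0 => //; rewrite subr_ge0 (ler_pdivlMr _ _ B0).
have d1 : z * (B (b + 1) z / B b z - shrink b z) <= 4 / N * D b z / B b z.
  rewrite mulrBr mul_shrink// mulrA cutoff_integral_rec.
  rewrite -subr_ge0 [leRHS](_ : _ = 2 * expR (- (z / 2)) * ((B b z)^-1 - (kernel_integral b z)^-1)).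
    apply: mulr_ge0; first by rewrite mulr_ge0 ?expR_ge0.
    rewrite subr_ge0 lef_pV2; [exact: cutoff_integral_le_kernel|exact: K0|exact: B0].
  by field; rewrite n0 !gt_eqF.
apply: (@le_trans _ _ (B b z * (4 / N * D b z / B b z) ^+ 2)).
  by rewrite ler_wpM2l ?(ltW B0)// ler_sqr// nnegrE// (le_trans d0).
rewrite [leLHS](_ : _ = 16 / N ^+ 2 * (D b z ^+ 2 / B b z)); last first.
  by field; rewrite n0 gt_eqF.
have k0 : 0 <= 16 / N ^+ 2 by rewrite divr_ge0 ?sqr_ge0.
by apply: (ler_wpM2l k0); rewrite (ler_pdivrMr _ _ B0) mulrC.
Qed.

End cutoff.

Lemma le_cutoff_level {R : realType} (N M l : R) : 0 < N -> N <= M -> l <= 1 ->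
  cutoff N l <= cutoff M l.
Proof.
move=> N0 NM l1; rewrite /cutoff ge_max le_max lexx /= le_max; apply/orP; right.
rewrite lerD2l ler_wnM2l// ?ln_le0// lef_pV2 ?posrE//.
exact: lt_le_trans NM.
Qed.

(** * Integration over the mixing variable *)

Section tonelli_set.
Local Open Scope ereal_scope.
Context d1 d2 (T1 : measurableType d1) (T2 : measurableType d2) (R : realType).
Variables (m1 : {sigma_finite_measure set T1 -> \bar R})
  (m2 : {sigma_finite_measure set T2 -> \bar R}).
Variables (D : set T1) (f : T1 * T2 -> \bar R).
Hypotheses (mD : measurable D) (mf : measurable_fun setT f)
  (f0 : forall x y, D x -> 0 <= f (x, y)).

(* [f] may take negative values outside of [D] *)
Let g (xy : T1 * T2) := f xy * (\1_D xy.1)%:E.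

Let mg : measurable_fun setT g.
Proof.
apply: emeasurable_funM => //; apply/measurable_EFinP.
by apply: (measurableT_comp (@measurable_indic _ _ R _ _ mD)); exact: measurable_fst.
Qed.

Let g0 xy : 0 <= g xy.
Proof.
rewrite /g indicE; case: (boolP (xy.1 \in D)) => [/set_mem Dx|_]; last by rewrite mule0.
by rewrite mule1; case: xy Dx => x y /=; exact: f0.
Qed.

Let gE y : \int[m1]_(x in D) f (x, y) = \int[m1]_x g (x, y).
Proof.
rewrite integral_mkcond; apply: eq_integral => x _; rewrite patchE /g indicE /=.
by case: ifPn => _; rewrite ?mule1 ?mule0.
Qed.

Lemma measurable_integral_set :
  measurable_fun setT (fun y => \int[m1]_(x in D) f (x, y)).
Proof.
under eq_fun do rewrite gE.
exact: (measurable_fun_fubini_tonelli_G g mg g0).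
Qed.

Lemma measurable_on_integral :
  measurable_fun D (fun x => \int[m2]_y f (x, y)).
Proof.
apply: (@eq_measurable_fun _ _ _ _ D (fun x => \int[m2]_y g (x, y))).
  by move=> x xD; apply: eq_integral => y _; rewrite /g indicE /= xD mule1.
apply: measurable_funTS.
exact: (measurable_fun_fubini_tonelli_F g mg g0).
Qed.

Lemma tonelli_set :
  \int[m1]_(x in D) \int[m2]_y f (x, y) = \int[m2]_y \int[m1]_(x in D) f (x, y).
Proof.
under [RHS]eq_integral do rewrite gE.
rewrite -(fubini_tonelli g mg g0) integral_mkcond.
apply: eq_integral => x _; rewrite patchE; case: ifPn => xD.
  by apply: eq_integral => y _; rewrite /g indicE /= xD mule1.
by rewrite integral0_eq// => y _; rewrite /g indicE /= (negbTE xD) mule0.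
Qed.

End tonelli_set.

Section hierarchical.
Context {R : realType} {p : nat}.
Local Notation mu := (@lebesgue_measure R).
Local Notation leb := (lebesgue_tuple R p).
Implicit Types (x theta : p.-tuple R) (delta : p.-tuple R -> p.-tuple R).
Variables (s1 b : R) (s : 'I_p -> R).
Hypotheses (s10 : 0 < s1) (b1 : -1 < b) (bp : 2 * (b + 1) = p%:R - 2).
Hypotheses (s0 : forall i, 0 < s i) (ss1 : forall i, s i <= s1).
Local Notation z := (zstat s1).
Local Notation Sigma := (diag_mx (\row_i s i)).

Let c : R := ((2 * pi * s1) `^ (p%:R / 2))^-1.
Let c0 : 0 < c.
Proof. by rewrite invr_gt0 powR_gt0// !mulr_gt0 ?pi_gt0. Qed.

Lemma gaussp_precisionE (l : R) x : 0 < l ->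
  gaussp (fun=> 0) (fun=> s1 / l) x = c * (l `^ (b + 2) * expR (- (z x * l / 2))).
Proof.
move=> l0; have sl0 : 0 < s1 / l by rewrite divr_gt0.
rewrite -ensemble_weightE// /c.
have -> : p%:R / 2 = b + 2 by move: bp; lra.
rewrite [RHS]mulrA; congr (_ * expR _).
  have -> : 2 * pi * s1 = 2 * pi * (s1 / l) * l by field; rewrite gt_eqF.
  have pl : 0 <= 2 * pi * (s1 / l) by rewrite !mulr_ge0 ?pi_ge0 ?invr_ge0 ?ltW.
  rewrite [in RHS]powRM ?(ltW l0)//; field.
  by rewrite !gt_eqF ?powR_gt0// mulr_gt0// mulr_gt0// pi_gt0.
rewrite /zstat /sqnorm; under eq_bigr do rewrite mxE.
by field; rewrite !gt_eqF.
Qed.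

(** The normalizing constant contributes [l ^ (p / 2) = l ^ (b + 2)], of which the prior
    density removes [l ^ 2]. *)
Lemma gaussp_kernelE (l : R) x : 0 < l ->
  l ^- 2 * gaussp (fun=> 0) (fun=> s1 / l) x = c * shrink_kernel b (z x) l.
Proof.
move=> l0; rewrite gaussp_precisionE// /shrink_kernel powRD; last first.
  by rewrite (gt_eqF l0) implybT.
rewrite powR_mulrn ?(ltW l0)//; field.
by rewrite gt_eqF.
Qed.

Lemma integral_exp_zstat (l : R) : 0 < l ->
  (\int[leb]_x (expR (- (z x * l / 2)))%:E = (c^-1 * l `^ (- (b + 2)))%:E)%E.
Proof.
move=> l0; have pl : 0 < l `^ (b + 2) by exact: powR_gt0.
transitivity (\int[leb]_x ((c^-1 * l `^ (- (b + 2))) * gaussp (fun=> 0) (fun=> s1 / l) x)%:E)%E.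
  apply: eq_integral => x _; rewrite gaussp_precisionE// powRN; congr EFin; field.
  by rewrite !gt_eqF.
rewrite integral_gaussp_cst//; first by move=> _; exact: divr_gt0.
by rewrite mulr_ge0 ?powR_ge0// invr_ge0 ltW.
Qed.

Lemma measurable_exp_line (y : R) (D : set R) :
  measurable_fun D (fun t : R => (expR (- (y * t / 2)))%:E).
Proof.
apply/measurable_EFinP; apply: measurable_funTS.
apply: measurableT_comp => //; apply: measurableT_comp => //.
by apply: measurable_funM => //; exact: measurable_funM.
Qed.

Lemma integral_exp_halfline (y : R) : 0 < y ->
  (\int[mu]_(t in `[0%R, +oo[) (expR (- (y * t / 2)))%:E = (2 / y)%:E)%E.
Proof.
move=> y0; have y20 : 0 < y / 2 by rewrite divr_gt0.
have := integral_exponential_pdf y20; rewrite /exponential_pdf => H.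
have m0 : measurable (`[0, +oo[%classic : set R) by [].
have : (\int[mu]_(t in `[0%R, +oo[) ((y / 2) * expR (- (y * t / 2)))%:E = 1)%E.
  rewrite -H integral_mkcond; apply: eq_integral => t _; rewrite !patchE.
  by case: ifPn => // _; congr (_ * expR _)%:E; ring.
under eq_integral do rewrite EFinM.
rewrite ge0_integralZl_EFin ?(ltW y20)//; last exact: measurable_exp_line.
move=> /(congr1 (fun e => (2 / y)%:E * e)%E).
rewrite muleA -EFinM mule1 (_ : 2 / y * (y / 2) = 1) ?mul1e//.
by field; rewrite gt_eqF.
Qed.

Lemma integral_powR_halfline (a l : R) : 0 < a -> 0 < l ->
  (\int[mu]_(t in `[0%R, +oo[) ((t + l) `^ (- (a + 1)))%:E = (l `^ (- a) / a)%:E)%E.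
Proof.
move=> a0 l0.
pose F t := - ((t + l) `^ (- a) / a).
have dF (t : R) : 0 <= t -> is_derive t 1 F ((t + l) `^ (- (a + 1))).
  move=> t0; have tl0 : 0 < t + l by rewrite ltr_wpDl.
  have d1 := is_derive1_powR (- a) tl0.
  have d2 : is_derive t 1 (fun t : R => t + l) 1 by apply: is_derive_eq; rewrite addr0.
  have d3 := @is_derive1_comp R (fun u : R => u `^ (- a)) (fun t => t + l) t _ _ d1 d2.
  rewrite /F; apply: is_derive_eq; rewrite !scaler0 ?add0r ?addr0 /GRing.scale /= mulr1.
  by rewrite (_ : - a - 1 = - (a + 1)); [field; rewrite gt_eqF|ring].
have cF (t : R) : 0 <= t -> {for t, continuous F}.
  by move=> t0; apply: differentiable_continuous; apply/derivable1_diffP; case: (dF t t0).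
rewrite (@ge0_continuous_FTC2y R _ F 0 0).
- by rewrite -EFinB sub0r /F opprK add0r.
- by move=> t _; exact: powR_ge0.
- apply: derivable_within_continuous => t; rewrite in_itv/= andbT => t0.
  have tl0 : 0 < t + l by rewrite ltr_wpDl.
  have d1 := is_derive1_powR (- (a + 1)) tl0.
  have d2 : is_derive t 1 (fun t : R => t + l) 1 by apply: is_derive_eq; rewrite addr0.
  by have [] := @is_derive1_comp R (fun u : R => u `^ (- (a + 1))) (fun t => t + l) t _ _ d1 d2.
- rewrite -[X in _ --> X]oppr0; apply: (@cvgN _ R^o); rewrite -[X in _ --> X](mul0r a^-1).
  apply: cvgM; last exact: cvg_cst.
  apply/cvgrPdist_le => e e0; near=> t.
  have t0 : 0 <= t by near: t; exact: nbhs_pinfty_ge.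
  have tl0 : 0 < t + l by rewrite ltr_wpDl.
  rewrite sub0r normrN ger0_norm ?powR_ge0// powRN invf_ple ?posrE ?powR_gt0//.
  have M0 : 0 <= (e^-1) `^ (a^-1) by exact: powR_ge0.
  have : (e^-1) `^ (a^-1) <= t + l.
    apply: (@le_trans _ _ t); last by rewrite lerDl ltW.
    by near: t; exact: nbhs_pinfty_ge.
  move=> /(ge0_ler_powR (ltW a0)); rewrite -powRrM mulVf ?gt_eqF// powRr1 ?invr_ge0 ?(ltW e0)//.
  by apply; rewrite nnegrE// ltW.
- by move=> t t0; have [] := dF t (ltW t0).
- by apply: cvg_at_right_filter; exact: cF.
- move=> t; rewrite in_itv/= andbT => t0; rewrite derive1E.
  by have [_ ->] := dF t (ltW t0).
Unshelve. all: by end_near. Qed.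

(** Half the integral of [exp (- z * (t + l) / 2)] over [t >= 0] is
    [z^-1 * exp (- z * l / 2)]; integrating over [x] first leaves a power of [t + l],
    integrable at infinity because [p > 2]. *)
Lemma integral_inv_zstat (l : R) : 0 < l ->
  (\int[leb]_x ((z x)^-1 * expR (- (z x * l / 2)))%:E <=
   (c^-1 / (2 * (b + 1)) * l `^ (- (b + 1)))%:E)%E.
Proof.
move=> l0; have b10 : 0 < b + 1 by move: b1; lra.
pose f (tx : R * p.-tuple R) : \bar R := (expR (- (z tx.2 * tx.1 / 2)) * expR (- (z tx.2 * l / 2)))%:E.
have mz : measurable_fun setT (fun tx : R * p.-tuple R => z tx.2).
  by apply: (measurableT_comp (measurable_zstat s1)); exact: measurable_snd.
have mf : measurable_fun setT f.
  apply/measurable_EFinP; apply: measurable_funM; apply: measurableT_comp => //;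
    apply: measurableT_comp => //; apply: measurable_funM => //; apply: measurable_funM => //.
have f0 t x : (0 <= f (t, x))%E by rewrite lee_fin mulr_ge0 ?expR_ge0.
have m0 : measurable (`[0, +oo[%classic : set R) by [].
apply: (@le_trans _ _ (\int[leb]_x ((2^-1)%:E * \int[mu]_(t in `[0%R, +oo[) f (t, x)))%E).
  apply: ge0_le_integral => //.
  - by move=> x _; rewrite lee_fin mulr_ge0 ?expR_ge0// invr_ge0 zstat_ge0.
  - apply/measurable_EFinP; under eq_fun do rewrite -powR_inv1 ?zstat_ge0//.
    apply: measurable_funM.
      exact: (measurableT_comp (measurable_powR (-1)) (measurable_zstat s1)).
    apply: measurableT_comp => //; apply: measurableT_comp => //.
    apply: measurable_funM => //; apply: measurable_funM => //.
    exact: measurable_zstat.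
  - by apply: emeasurable_funM => //; apply: measurable_integral_set.
  - move=> x _; rewrite /f /=; have [z0|zn] := eqVneq (z x) 0.
      rewrite z0 invr0 mul0r mule_ge0// ?lee_fin//.
      by apply: integral_ge0 => t _; rewrite lee_fin mulr_ge0 ?expR_ge0.
    have z0 : 0 < z x by rewrite lt_neqAle eq_sym zn zstat_ge0.
    under eq_integral do rewrite EFinM.
    rewrite ge0_integralZr//; last exact: measurable_exp_line.
    rewrite integral_exp_halfline// -!EFinM lee_fin mulrA.
    by rewrite [2^-1 * _](_ : _ = (z x)^-1)//; field.
rewrite ge0_integralZl//; last 2 first.
- by apply: measurable_integral_set.
- by move=> x _; apply: integral_ge0 => t _.
rewrite -tonelli_set//.
under eq_integral => t t0.
  under eq_integral => x _.
    rewrite /f /= -expRD (_ : _ + _ = - (z x * (t + l) / 2)); last by field.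
    over.
  rewrite integral_exp_zstat; last first.
    by move: t0; rewrite inE/= in_itv/= andbT => t0; rewrite ltr_wpDl.
  rewrite EFinM (_ : b + 2 = b + 1 + 1); last by ring.
  over.
rewrite ge0_integralZl//; last 3 first.
- apply/measurable_EFinP; apply: measurable_funTS.
  by apply: (measurableT_comp (measurable_powR _)); exact: measurable_funD.
- by move=> t _; rewrite lee_fin powR_ge0.
- by rewrite lee_fin invr_ge0 ltW.
rewrite integral_powR_halfline// -!EFinM lee_fin le_eqVlt; apply/orP; left; apply/eqP.
by field; rewrite !gt_eqF.
Qed.

(** * Posterior losses for a weighted mixing variable *)

(** Posterior expected loss of the action [a] given [x] and [l], multiplied by the
    density of [(x, l)] when [l] has prior density [l^-2 * rho l]. *)
Definition conditional_loss (rho : R -> R) (a : 'I_p -> R) x (l : R) : R :=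
  c * (shrink_kernel b (z x) l * rho l) *
  (sqdist a (fun i => (1 - l * (s i / s1)) * tnth x i) +
   \sum_i (1 - l * (s i / s1)) * s i).

(** The minimizer of the posterior loss for that prior: the posterior mean of [l]
    replaces [l] in [(1 - l * (s i / s1)) * x i]. *)
Definition weighted_bayes (rho : R -> R) x : p.-tuple R :=
  [tuple (1 - s i / s1 * (weighted_integral rho (b + 1) (z x) /
            weighted_integral rho b (z x))) * tnth x i | i < p].

Section posterior.
Variable rho : R -> R.
Hypotheses (mrho : measurable_fun setT rho)
  (rho01 : forall l, 0 < l < 1 -> 0 <= rho l <= 1).
Local Notation W a x := (weighted_integral rho a (z x)).

Lemma ratio01 i : 0 <= s i / s1 <= 1.
Proof.
apply/andP; split; first by apply: divr_ge0; exact: ltW.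
by rewrite ler_pdivrMr// mul1r.
Qed.

Lemma conditional_loss_ge0 a x l : 0 < l < 1 -> 0 <= conditional_loss rho a x l.
Proof.
move=> l01; have /andP[l0 l1] := l01; have /andP[r0 _] := rho01 l01.
rewrite mulr_ge0//; first by rewrite mulr_ge0 ?(ltW c0)// mulr_ge0 ?shrink_kernel_ge0.
rewrite addr_ge0 ?sqdist_ge0//; apply: sumr_ge0 => i _; rewrite mulr_ge0 ?(ltW (s0 i))//.
rewrite subr_ge0; have /andP[g0 g1] := ratio01 i.
by rewrite (le_trans (ler_wpM2l (ltW l0) g1))// mulr1 ltW.
Qed.

(** The loss is a polynomial of degree 2 in [l], so only three integrals occur. *)
Lemma integral_conditional_loss (a : 'I_p -> R) x :
  let A := \sum_i ((a i - tnth x i) ^+ 2 + s i) in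
  let B := \sum_i (2 * (a i - tnth x i) * (s i / s1 * tnth x i) - s i / s1 * s i) in
  let C := \sum_i (s i / s1 * tnth x i) ^+ 2 in
  (\int[mu]_(l in `]0%R, 1%R[) (conditional_loss rho a x l)%:E =
   (c * (A * W b x + B * W (b + 1) x + C * W (b + 1 + 1) x))%:E)%E.
Proof.
move=> A B C; have b11 : -1 < b + 1 by move: b1; lra.
have b12 : -1 < b + 1 + 1 by move: b1; lra.
have i0 := integrable_weighted (z x) b1 mrho rho01.
have i1 := integrable_weighted (z x) b11 mrho rho01.
have i2 := integrable_weighted (z x) b12 mrho rho01.
pose k0 l := A * (shrink_kernel b (z x) l * rho l).
pose k1 l := B * (shrink_kernel (b + 1) (z x) l * rho l).
pose k2 l := C * (shrink_kernel (b + 1 + 1) (z x) l * rho l).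
have j0 : mu.-integrable `]0, 1[ (EFin \o k0) by exact: integrableZl i0.
have j1 : mu.-integrable `]0, 1[ (EFin \o k1) by exact: integrableZl i1.
have j2 : mu.-integrable `]0, 1[ (EFin \o k2) by exact: integrableZl i2.
have j01 : mu.-integrable `]0, 1[ (EFin \o (fun l => k0 l + k1 l)).
  by have := integrableD _ j0 j1; apply.
have j012 : mu.-integrable `]0, 1[ (EFin \o (fun l => k0 l + k1 l + k2 l)).
  by have := integrableD _ j01 j2; apply.
transitivity (\int[mu]_(l in `]0%R, 1%R[) (c * (k0 l + k1 l + k2 l))%:E)%E.
  apply: eq_integral => l; rewrite inE/= in_itv/= => /andP[l0 l1]; congr EFin.
  rewrite /conditional_loss /k0 /k1 /k2 !shrink_kernelS// /sqdist -big_split /=.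
  rewrite -!mulrA; congr (_ * _); rewrite /A /B /C.
  rewrite ![X in _ = X + _ + _]mulr_suml ![X in _ = _ + X + _]mulr_suml ![X in _ = _ + _ + X]mulr_suml.
  rewrite -!big_split /= !mulr_sumr; apply: eq_bigr => i _; ring.
have -> : (\int[mu]_(l in `]0%R, 1%R[) (c * (k0 l + k1 l + k2 l))%:E)%E =
   (\int[mu]_(l in `]0, 1[) (c * (k0 l + k1 l + k2 l)))%:E.
  by rewrite /Rintegral fineK//; apply: integrable_fin_num => //; exact: integrableZl j012.
by rewrite RintegralZl// RintegralD// RintegralD// !RintegralZl.
Qed.

(** Completion of the square in [a]. *)
Lemma integral_conditional_loss_decomp (a : 'I_p -> R) x : 0 < W b x ->
  (\int[mu]_(l in `]0%R, 1%R[) (conditional_loss rho a x l)%:E =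
   \int[mu]_(l in `]0%R, 1%R[) (conditional_loss rho (tnth (weighted_bayes rho x)) x l)%:E +
   (c * W b x * sqdist a (tnth (weighted_bayes rho x)))%:E)%E.
Proof.
move=> W0; rewrite !integral_conditional_loss -EFinD; congr EFin.
rewrite -mulrA -mulrDr; congr (_ * _).
rewrite [RHS]addrAC; congr (_ + _).
rewrite /sqdist !mulr_suml mulr_sumr -!big_split /=; apply: eq_bigr => i _.
rewrite tnth_mktuple.
move: (W b x) (W (b + 1) x) (tnth x i) (s i) W0 => u v y t u0.
by field; rewrite !gt_eqF.
Qed.

End posterior.

Let D01 : set R := `]0%R, 1%R[%classic.
Let mD01 : measurable D01. Proof. exact: measurable_itv. Qed.

Let measurable_inv01 : measurable_fun D01 (fun l : R => l^-1).
Proof.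
apply: (@eq_measurable_fun _ _ _ _ D01 (fun l : R => l `^ (-1))).
  by move=> l; rewrite inE /D01 /= in_itv/= => /andP[l0 _]; rewrite powR_inv1// ltW.
by apply: measurable_funTS; exact: measurable_powR.
Qed.

Lemma integral_inv_above (N : R) : 0 < N ->
  (\int[mu]_(l in D01) (cutoff_support N l * l^-1)%:E <= N%:E)%E.
Proof.
move=> N0; set e := expR (- N).
have e0 : 0 < e by exact: expR_gt0.
have e1 : e < 1 by rewrite -expR0 ltr_expR oppr_lt0.
have minv (A : set R) : measurable A -> A `<=` [set l | 0 < l] ->
    measurable_fun A (fun l : R => (l^-1)%:E).
  move=> mA A0; apply/measurable_EFinP.
  apply: (@eq_measurable_fun _ _ _ _ A (fun l : R => l `^ (-1))).
    by move=> l /set_mem/A0/= l0; rewrite powR_inv1// ltW.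
  by apply: measurable_funTS; exact: measurable_powR.
apply: (@le_trans _ _ (\int[mu]_(l in `[e, 1%R]) (l^-1)%:E)%E).
  rewrite integral_mkcond [leRHS]integral_mkcond; apply: ge0_le_integral => //.
  - move=> l _; rewrite patchE; case: ifPn => // /set_mem; rewrite /D01 /= in_itv/= => /andP[l0 _].
    by rewrite lee_fin mulr_ge0 ?invr_ge0 ?(ltW l0)// /cutoff_support indicE.
  - apply/(measurable_restrictT _ _).1 => //; apply/measurable_EFinP; apply: measurable_funM.
      by apply: measurable_funTS; exact: measurable_cutoff_support.
    exact: measurable_inv01.
  - apply/(measurable_restrictT _ _).1 => //; apply: minv => // l.
    by rewrite /= in_itv/= => /andP[el _]; exact: lt_le_trans el.
  - move=> l _; rewrite !patchE; case: ifPn => [/set_mem|_].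
      rewrite /D01 /= in_itv/= => /andP[l0 l1]; rewrite /cutoff_support indicE.
      case: (boolP (l \in _)) => [/set_mem|_]; last first.
        by rewrite mul0r; case: ifPn => _ //; rewrite lee_fin invr_ge0 ltW.
      rewrite /= in_itv/= => /andP[el _].
      by rewrite mul1r mem_set//= in_itv/= (ltW l1) el.
    case: ifPn => // /set_mem; rewrite /= in_itv/= => /andP[el _].
    by rewrite lee_fin invr_ge0 ltW// (lt_le_trans e0).
have dln (l : R) : e <= l -> is_derive l 1 (@ln R) l^-1.
  by move=> el; apply: is_derive1_ln; exact: lt_le_trans el.
have cln (l : R) : e <= l -> {for l, continuous (@ln R)}.
  by move=> el; apply: continuous_ln; exact: lt_le_trans el.
rewrite (@continuous_FTC2 _ (fun l : R => l^-1) (@ln R) e 1 e1).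
- by rewrite -EFinB ln1 sub0r /e expRK opprK.
- apply: within_continuous_pos => // l el; apply: inv_continuous.
  by rewrite gt_eqF// (lt_le_trans e0).
- split.
  + by move=> l; rewrite in_itv/= => /andP[el _]; have [] := dln l (ltW el).
  + by apply: cvg_at_right_filter; exact: cln.
  + by apply: cvg_at_left_filter; apply: cln; exact: ltW.
- move=> l; rewrite in_itv/= => /andP[el _]; rewrite derive1E.
  by have [_ ->] := dln l (ltW el).
Qed.

(** By Tonelli and [integral_inv_zstat], this is a multiple of the integral of [1 / l]
    above the cutoff.  The growth in [N] is slower than the decay in
    [cutoff_bound]. *)
Lemma integral_cutoff_zstat (N : R) : 0 < N ->
  (\int[leb]_x (weighted_integral (cutoff_support N) b (z x) / z x)%:E <=
   (c^-1 / (2 * (b + 1)) * N)%:E)%E.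
Proof.
move=> N0; set K := c^-1 / _.
have b10 : 0 < b + 1 by move: b1; lra.
have K0 : 0 <= K by apply: divr_ge0; [rewrite invr_ge0; exact: ltW|apply: mulr_ge0 => //; exact: ltW].
have mS := @measurable_cutoff_support R N.
have S01 := @cutoff_support01 R N.
pose f (lx : R * p.-tuple R) : \bar R :=
  (shrink_kernel b (z lx.2) lx.1 * cutoff_support N lx.1 * (z lx.2)^-1)%:E.
have mz : measurable_fun setT (fun tx : R * p.-tuple R => z tx.2).
  by apply: (measurableT_comp (measurable_zstat s1)); exact: measurable_snd.
have mzi : measurable_fun setT (fun x => (z x)^-1).
  under eq_fun do rewrite -powR_inv1 ?zstat_ge0//.
  exact: (measurableT_comp (measurable_powR (-1)) (measurable_zstat s1)).
have mf : measurable_fun setT f.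
  apply/measurable_EFinP; apply: measurable_funM; first apply: measurable_funM.
  - apply: (measurableT_comp (measurable_shrink_kernel2 b)
      (g := fun lx : R * p.-tuple R => (z lx.2, lx.1))).
    by apply/measurable_fun_pair => //; exact: measurable_fst.
  - exact: (measurableT_comp mS measurable_fst).
  - exact: (measurableT_comp mzi measurable_snd).
have f0 l x : D01 l -> (0 <= f (l, x))%E.
  rewrite /D01 /= in_itv/= => /S01/andP[S0 _].
  by rewrite lee_fin mulr_ge0 ?invr_ge0 ?zstat_ge0// mulr_ge0 ?shrink_kernel_ge0.
have -> : (\int[leb]_x (weighted_integral (cutoff_support N) b (z x) / z x)%:E =
    \int[leb]_x \int[mu]_(l in D01) f (l, x))%E.
  apply: eq_integral => x _; rewrite /f /=.
  under eq_integral do rewrite EFinM.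
  rewrite ge0_integralZr//; last 3 first.
  - by have := integrable_weighted (z x) b1 mS S01; exact: measurable_int.
  - move=> l; rewrite /D01 /= in_itv/= => /S01/andP[S0 _].
    by rewrite lee_fin mulr_ge0 ?shrink_kernel_ge0.
  - by rewrite lee_fin invr_ge0 zstat_ge0.
  rewrite EFinM /weighted_integral /Rintegral fineK//.
  by apply: integrable_fin_num => //; exact: integrable_weighted.
rewrite -tonelli_set//.
apply: (@le_trans _ _ (\int[mu]_(l in D01) (K%:E * (cutoff_support N l * l^-1)%:E))%E).
  apply: ge0_le_integral => //.
  - by move=> l Dl; apply: integral_ge0 => x _; exact: f0.
  - exact: measurable_on_integral.
  - apply: emeasurable_funM => //; apply/measurable_EFinP; apply: measurable_funM.
      exact: measurable_funTS.
    exact: measurable_inv01.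
  - move=> l; rewrite /D01 /= in_itv/= => l01; have /andP[l0 _] := l01.
    have /andP[S0 _] := S01 l l01; rewrite /f /=.
    have -> : (\int[leb]_x (shrink_kernel b (z x) l * cutoff_support N l * (z x)^-1)%:E =
        (l `^ b * cutoff_support N l)%:E *
        \int[leb]_x ((z x)^-1 * expR (- (z x * l / 2)))%:E)%E.
      rewrite -ge0_integralZl//.
      + by apply: eq_integral => x _; rewrite -EFinM /shrink_kernel; congr EFin; ring.
      + apply/measurable_EFinP; apply: measurable_funM => //.
        apply: measurableT_comp => //; apply: measurableT_comp => //.
        by apply: measurable_funM => //; apply: measurable_funM => //; exact: measurable_zstat.
      + by move=> x _; rewrite lee_fin mulr_ge0 ?expR_ge0// invr_ge0 zstat_ge0.
      + by rewrite lee_fin mulr_ge0 ?powR_ge0.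
    apply: (le_trans (lee_wpmul2l _ (integral_inv_zstat l0))).
      by rewrite lee_fin mulr_ge0 ?powR_ge0.
    rewrite -!EFinM lee_fin le_eqVlt; apply/orP; left; apply/eqP.
    rewrite -/K.
    transitivity (K * (cutoff_support N l * (l `^ b * l `^ (- (b + 1))))); first by ring.
    rewrite -powRD; last by rewrite (gt_eqF l0) implybT.
    by rewrite (_ : b + - (b + 1) = -1) ?powR_inv1 ?(ltW l0)//; ring.
rewrite ge0_integralZl//.
- by rewrite [leRHS]EFinM lee_wpmul2l// integral_inv_above.
- apply/measurable_EFinP; apply: measurable_funM; first exact: measurable_funTS.
  exact: measurable_inv01.
- move=> l; rewrite /D01 /= in_itv/= => l01; have /andP[l0 _] := l01.
  by have /andP[S0 _] := S01 l l01; rewrite lee_fin mulr_ge0 ?invr_ge0 ?(ltW l0).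
Qed.

Let V (l : R) (i : 'I_p) : R := s1 / l - s i.

Let V_gt0 l i : 0 < l < 1 -> 0 < V l i.
Proof.
move=> /andP[l0 l1]; rewrite subr_gt0 ltr_pdivlMr//.
by apply: (le_lt_trans _ (_ : s1 * l < s1)); [rewrite ler_wpM2r// ltW|rewrite gtr_pMr].
Qed.

Let V_weight l i : 0 < l -> V l i / (V l i + s i) = 1 - l * (s i / s1).
Proof. by move=> l0; rewrite /V subrK; field; rewrite !gt_eqF. Qed.

Let conditional_lossE rho l (delta : p.-tuple R -> p.-tuple R) x : 0 < l ->
  conditional_loss rho (tnth (delta x)) x l =
  l ^- 2 * rho l * (bayes_loss (V l) s delta x * gaussp (fun=> 0) (fun i => V l i + s i) x).
Proof.
move=> l0; rewrite /bayes_loss /conditional_loss mulrA -gaussp_kernelE//.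
have -> : (fun i => V l i + s i) = (fun=> s1 / l) by apply/funext => i; rewrite /V subrK.
have -> : (fun i => V l i / (V l i + s i) * tnth x i) = (fun i => (1 - l * (s i / s1)) * tnth x i).
  by apply/funext => i; rewrite V_weight.
under [in RHS]eq_bigr do rewrite V_weight//.
by ring.
Qed.

Lemma prior_variance_diag l : (s1 / l)%:M - Sigma = diag_mx (\row_i V l i).
Proof.
apply/matrixP => i j; rewrite !mxE /V.
by case: (i == j); rewrite ?mulr1n ?mulr0n ?subr0.
Qed.

Let prior_pdfE l theta : 0 < l < 1 ->
  mvn_pdf 0 ((s1 / l)%:M - Sigma) (colv theta) = gaussp (fun=> 0) (V l) theta.
Proof.
move=> l01; rewrite prior_variance_diag; apply: mvn_pdf_diag => i; last by rewrite mxE.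
exact: V_gt0.
Qed.

Let obs_pdfE theta x : mvn_pdf (colv theta) Sigma (colv x) = gaussp (tnth theta) s x.
Proof. by apply: mvn_pdf_diag => // i; rewrite mxE. Qed.

Local Notation prior_var := (fun l : R => (s1 / l)%:M - Sigma).
Local Notation prior_density := (fun l : R => l ^- 2).

Lemma marginal_kernel_integral x :
  marginal Sigma prior_var prior_density D01 x = (c * kernel_integral b (z x))%:E.
Proof.
transitivity (\int[mu]_(l in D01) (c%:E * (shrink_kernel b (z x) l)%:E))%E.
  apply: eq_integral => l; rewrite inE /D01 /= in_itv/= => l01; have /andP[l0 _] := l01.
  under eq_integral do rewrite obs_pdfE prior_pdfE//.
  rewrite integral_posterior//; last by move=> i; exact: V_gt0.
  rewrite -[RHS]EFinM -gaussp_kernelE// -EFinM.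
  by rewrite (_ : (fun i => V l i + s i) = (fun=> s1 / l))//; apply/funext => i; rewrite /V subrK.
rewrite integralZl//; last exact: integrable_shrink_kernel.
rewrite EFinM; congr (_ * _)%E; rewrite /kernel_integral /Rintegral fineK//.
by apply: integrable_fin_num => //; exact: integrable_shrink_kernel.
Qed.

Lemma posterior_loss_conditional_loss x (a : p.-tuple R) :
  posterior_loss Sigma prior_var prior_density D01 x a =
  (\int[mu]_(l in D01) (conditional_loss (fun=> 1) (tnth a) x l)%:E)%E.
Proof.
apply: eq_integral => l; rewrite inE /D01 /= in_itv/= => l01; have /andP[l0 _] := l01.
under eq_integral do rewrite obs_pdfE prior_pdfE// sqnorm_colvB.
rewrite integral_posterior_loss//; last by move=> i; exact: V_gt0.
by rewrite (conditional_lossE _ (fun=> a) _ l0) mulr1 -EFinM.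
Qed.

Let one01 (l : R) : 0 < l < 1 -> 0 <= (1 : R) <= 1.
Proof. by rewrite ler01 lexx. Qed.

Lemma generalized_bayes_flat_weight (delta : p.-tuple R -> p.-tuple R) :
  measurable_fun setT delta -> (forall x, delta x = weighted_bayes (fun=> 1) x) ->
  generalized_bayes Sigma prior_var prior_density D01 delta.
Proof.
move=> md dE; split=> //; apply: aeW => x.
have K0 := kernel_integral_gt0 (z x) b1.
have decomp a := @integral_conditional_loss_decomp _ (measurable_cst (1 : R)) one01 a x.
rewrite !weighted_integral1 in decomp.
split.
- by rewrite marginal_kernel_integral lte_fin ltry andbT mulr_gt0.
- by rewrite posterior_loss_conditional_loss integral_conditional_loss// ltry.
- move=> a; rewrite !posterior_loss_conditional_loss [leRHS]decomp// dE leeDl// lee_fin.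
  by rewrite mulr_ge0 ?sqdist_ge0// mulr_ge0// ltW.
Qed.

(** * Blyth's method *)

Section blyth.
Variable rho : R -> R.
Hypotheses (mrho : measurable_fun setT rho)
  (rho01 : forall l, 0 < l < 1 -> 0 <= rho l <= 1).
Local Notation W a x := (weighted_integral rho a (z x)).

Let mz2 : measurable_fun setT (fun tx : R * p.-tuple R => z tx.2).
Proof. by apply: (measurableT_comp (measurable_zstat s1)); exact: measurable_snd. Qed.

Let mkernel a : measurable_fun setT
  (fun lx : R * p.-tuple R => shrink_kernel a (z lx.2) lx.1 * rho lx.1).
Proof.
apply: measurable_funM.
  apply: (measurableT_comp (measurable_shrink_kernel2 a)
    (g := fun lx : R * p.-tuple R => (z lx.2, lx.1))).
  by apply/measurable_fun_pair => //; exact: measurable_fst.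
exact: (measurableT_comp mrho measurable_fst).
Qed.

Lemma measurable_weighted_integral a :
  measurable_fun setT (fun x : p.-tuple R => W a x).
Proof.
pose f (lx : R * p.-tuple R) := (shrink_kernel a (z lx.2) lx.1 * rho lx.1)%:E.
have mf : measurable_fun setT f by apply/measurable_EFinP; exact: mkernel.
have f0 l x : D01 l -> (0 <= f (l, x))%E.
  rewrite /D01 /= in_itv/= => /rho01/andP[r0 _].
  by rewrite lee_fin mulr_ge0 ?shrink_kernel_ge0.
apply: (measurableT_comp (@fine_measurable R setT measurableT)).
exact: (measurable_integral_set mu mD01 mf f0).
Qed.

Lemma measurable_weighted_bayes : measurable_fun setT (weighted_bayes rho).
Proof.
apply/measurable_fun_tnthP => i; rewrite (_ : _ \o _ = fun x =>
    (1 - s i / s1 * (W (b + 1) x / W b x)) * tnth x i); last first.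
  by apply/funext => x /=; rewrite tnth_mktuple.
apply: measurable_funM; last exact: measurable_tnth.
apply: measurable_funB => //; apply: measurable_funM => //.
apply: measurable_funM; first exact: measurable_weighted_integral.
rewrite (_ : (fun x => _) = (fun x => W b x `^ (-1))).
  exact: (measurableT_comp (measurable_powR (-1)) (measurable_weighted_integral b)).
by apply/funext => x; rewrite powR_inv1// weighted_integral_ge0.
Qed.

Lemma measurable_conditional_loss delta : measurable_fun setT delta ->
  measurable_fun setT (fun lx : R * p.-tuple R =>
    (conditional_loss rho (tnth (delta lx.2)) lx.2 lx.1)%:E).
Proof.
move=> md; apply/measurable_EFinP; apply: measurable_funM.
  by apply: measurable_funM => //; exact: mkernel.
have ml i : measurable_fun setT (fun lx : R * p.-tuple R => 1 - lx.1 * (s i / s1)).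
  apply: measurable_funB => //; apply: measurable_funM => //; exact: measurable_fst.
apply: measurable_funD.
  apply: (measurable_sqdist (a := fun i (lx : R * p.-tuple R) => tnth (delta lx.2) i)
    (b := fun i (lx : R * p.-tuple R) => (1 - lx.1 * (s i / s1)) * tnth lx.2 i)) => i.
    apply: (measurableT_comp (measurable_tnth i)).
    exact: (measurableT_comp md measurable_snd).
  apply: measurable_funM => //.
  exact: (measurableT_comp (measurable_tnth i) measurable_snd).
by apply: measurable_sum => i; apply: measurable_funM.
Qed.

Definition weighted_bayes_risk delta : \bar R :=
  (\int[mu]_(l in D01) \int[leb]_x (conditional_loss rho (tnth (delta x)) x l)%:E)%E.

Lemma integral_conditional_loss_risk delta l : measurable_fun setT delta -> 0 < l < 1 ->
  (\int[leb]_x (conditional_loss rho (tnth (delta x)) x l)%:E =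
   (l ^- 2 * rho l)%:E * \int[leb]_theta (risk Sigma delta theta *
     (gaussp (fun=> 0) (V l) theta)%:E))%E.
Proof.
move=> md l01; have /andP[l0 _] := l01; have /andP[r0 _] := rho01 l01.
rewrite bayes_risk//; last by move=> i; exact: V_gt0.
under eq_integral do rewrite conditional_lossE// EFinM.
rewrite ge0_integralZl_EFin//.
- move=> x _; rewrite lee_fin mulr_ge0 ?gaussp_ge0// bayes_loss_ge0// => i.
  exact: V_gt0.
- apply/measurable_EFinP; apply: measurable_funM; last exact: measurable_gaussp1.
  exact: measurable_bayes_loss.
- by rewrite mulr_ge0// invr_ge0 sqr_ge0.
Qed.

Lemma weighted_bayes_risk_le delta1 delta2 :
  measurable_fun setT delta1 -> measurable_fun setT delta2 ->
  (forall theta, (risk Sigma delta1 theta <= risk Sigma delta2 theta)%E) ->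
  (weighted_bayes_risk delta1 <= weighted_bayes_risk delta2)%E.
Proof.
move=> m1 m2 le12.
have f0 delta l x : D01 l -> (0 <= (conditional_loss rho (tnth (delta x)) x l)%:E)%E.
  by rewrite /D01 /= in_itv/= => l01; rewrite lee_fin conditional_loss_ge0.
apply: ge0_le_integral => //.
- by move=> l Dl; apply: integral_ge0 => x _; exact: f0.
- exact: (measurable_on_integral leb mD01 (measurable_conditional_loss m1) (f0 delta1)).
- exact: (measurable_on_integral leb mD01 (measurable_conditional_loss m2) (f0 delta2)).
move=> l; rewrite /D01 /= in_itv/= => l01; have /andP[l0 _] := l01.
have /andP[r0 _] := rho01 l01.
rewrite (integral_conditional_loss_risk m1 l01) (integral_conditional_loss_risk m2 l01).
apply: lee_wpmul2l.
  by rewrite lee_fin mulr_ge0// invr_ge0 sqr_ge0.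
have mg : measurable_fun setT (fun theta => (gaussp (fun=> 0) (V l) theta)%:E).
  by apply/measurable_EFinP; exact: measurable_gaussp1.
apply: ge0_le_integral.
- by [].
- by move=> theta _; rewrite mule_ge0 ?risk_ge0// lee_fin gaussp_ge0.
- by apply: emeasurable_funM => //; exact: measurable_risk.
- by apply: emeasurable_funM => //; exact: measurable_risk.
- by move=> theta _; rewrite lee_wpmul2r// lee_fin gaussp_ge0.
Qed.

Definition excess_risk delta : \bar R :=
  (\int[leb]_x (c * W b x * sqdist (tnth (delta x)) (tnth (weighted_bayes rho x)))%:E)%E.

Lemma measurable_weighted_sqdist delta1 delta2 :
  measurable_fun setT delta1 -> measurable_fun setT delta2 ->
  measurable_fun setT (fun x =>
    (c * W b x * sqdist (tnth (delta1 x)) (tnth (delta2 x)))%:E).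
Proof.
move=> m1 m2; apply/measurable_EFinP; apply: measurable_funM.
  by apply: measurable_funM => //; exact: measurable_weighted_integral.
apply: (measurable_sqdist (a := fun i t => tnth (delta1 t) i)
  (b := fun i t => tnth (delta2 t) i)) => i.
  exact: (measurableT_comp (measurable_tnth i) m1).
exact: (measurableT_comp (measurable_tnth i) m2).
Qed.

Lemma weighted_bayes_risk_decomp delta : measurable_fun setT delta ->
  (forall x, 0 < W b x) ->
  (weighted_bayes_risk delta = weighted_bayes_risk (weighted_bayes rho) + excess_risk delta)%E.
Proof.
move=> md W0.
have f0 delta' l x : D01 l -> (0 <= (conditional_loss rho (tnth (delta' x)) x l)%:E)%E.
  by rewrite /D01 /= in_itv/= => l01; rewrite lee_fin conditional_loss_ge0.
have ml := measurable_conditional_loss md; have mh := measurable_conditional_loss measurable_weighted_bayes.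
rewrite /weighted_bayes_risk (tonelli_set mu leb mD01 ml (f0 delta)).
rewrite (tonelli_set mu leb mD01 mh (f0 (weighted_bayes rho))) /excess_risk -ge0_integralD//.
- apply: eq_integral => x _; rewrite /= /D01.
  exact: (integral_conditional_loss_decomp mrho rho01 (tnth (delta x)) (W0 x)).
- by move=> x _; apply: integral_ge0 => l Dl; exact: f0.
- exact: (measurable_integral_set mu mD01 mh (f0 (weighted_bayes rho))).
- by move=> x _; rewrite lee_fin mulr_ge0 ?sqdist_ge0// mulr_ge0// ltW.
- exact: (measurable_weighted_sqdist _ measurable_weighted_bayes).
Qed.

(** The minimal Bayes risk is common to both and finite, so it cancels. *)
Lemma excess_risk_le delta1 delta2 :
  measurable_fun setT delta1 -> measurable_fun setT delta2 ->
  (forall x, 0 < W b x) -> (weighted_bayes_risk delta2 < +oo)%E ->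
  (forall theta, (risk Sigma delta1 theta <= risk Sigma delta2 theta)%E) ->
  (excess_risk delta1 <= excess_risk delta2)%E.
Proof.
move=> m1 m2 W0 foo le12.
have h0 : (0 <= weighted_bayes_risk (weighted_bayes rho))%E.
  apply: integral_ge0 => l; rewrite /D01 /= in_itv/= => l01.
  by apply: integral_ge0 => x _; rewrite lee_fin conditional_loss_ge0.
have e0 : (0 <= excess_risk delta2)%E.
  by apply: integral_ge0 => x _; rewrite lee_fin mulr_ge0 ?sqdist_ge0// mulr_ge0// ltW.
have hfin : weighted_bayes_risk (weighted_bayes rho) \is a fin_num.
  rewrite (ge0_fin_numE h0); apply: (le_lt_trans _ foo).
  by rewrite (weighted_bayes_risk_decomp m2 W0) leeDl.
have := weighted_bayes_risk_le m1 m2 le12.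
by rewrite (weighted_bayes_risk_decomp m1 W0) (weighted_bayes_risk_decomp m2 W0) leeD2lE.
Qed.

End blyth.

Section admissibility.
Variable delta : p.-tuple R -> p.-tuple R.
Hypotheses (mdelta : measurable_fun setT delta)
  (deltaE : forall x i,
     tnth (delta x) i = tnth x i - s i / s1 * shrink b (z x) * tnth x i).

Lemma bayes_loss_shrinkage_le l x : 0 < l < 1 ->
  bayes_loss (V l) s delta x <= sqdist (fun=> 0) (tnth x) + \sum_i s i.
Proof.
move=> l01; have /andP[l0 l1] := l01.
have w0 := shrink_gt0 b1 (z x); have w1 : shrink b (z x) <= 1.
  exact: (shrink_le1 b1 (z x)).
rewrite /bayes_loss lerD//; apply: ler_sum => i _; rewrite V_weight//;
  have /andP[g0 g1] := ratio01 i.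
  rewrite deltaE sub0r sqrrN.
  have -> : tnth x i - s i / s1 * shrink b (z x) * tnth x i -
      (1 - l * (s i / s1)) * tnth x i =
    s i / s1 * (l - shrink b (z x)) * tnth x i by ring.
  move: (s i / s1) g0 g1 => g g0 g1.
  rewrite !exprMn ler_piMl ?sqr_ge0//.
  rewrite mulr_ile1 ?sqr_ge0//; first by rewrite expr_le1.
  by rewrite -ler_sqrt ?ltr01// sqrtr_sqr sqrtr1 ler_norml; apply/andP; split; lra.
rewrite ler_piMl ?(ltW (s0 i))// gerBl mulr_ge0 ?(ltW l0)//.
Qed.

Section level.
Variable N : R.
Hypothesis N0 : 0 < N.
Local Notation rho := (fun l : R => cutoff N l ^+ 2).
Local Notation B a x := (weighted_integral rho a (z x)).

Let mrho := @measurable_cutoff_sq R N.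
Let rho01 := @cutoff_sq01 R N N0.

Lemma integral_conditional_loss_shrinkage_le l : 0 < l < 1 ->
  (\int[leb]_x (conditional_loss rho (tnth (delta x)) x l)%:E <=
   (l ^- 2 * rho l * (\sum_(i < p) (s1 / l) + \sum_i s i))%:E)%E.
Proof.
move=> l01; have /andP[l0 _] := l01; have /andP[r0 _] := rho01 l01.
have k0 : 0 <= l ^- 2 * rho l by rewrite mulr_ge0// invr_ge0 sqr_ge0.
have S0 : 0 <= \sum_i s i by apply: sumr_ge0 => i _; exact: ltW.
have v0 (i : 'I_p) : 0 < s1 / l by rewrite divr_gt0.
pose g x := gaussp (fun=> 0) (fun _ : 'I_p => s1 / l) x.
have mg : measurable_fun setT g by exact: measurable_gaussp1.
have ms : measurable_fun setT (fun x : p.-tuple R => sqdist (fun=> 0) (tnth x)).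
  apply: (measurable_sqdist (a := fun _ _ => 0) (b := fun i t => tnth t i)) => // i.
  exact: measurable_tnth.
have -> : ((l ^- 2 * rho l * (\sum_(i < p) (s1 / l) + \sum_i s i))%:E =
    \int[leb]_x ((l ^- 2 * rho l)%:E * ((sqdist (fun=> 0) (tnth x) * g x)%:E + ((\sum_i s i) * g x)%:E)))%E.
  rewrite ge0_integralZl_EFin//; last 2 first.
  - by move=> x _; rewrite adde_ge0// lee_fin mulr_ge0 ?sqdist_ge0 ?gaussp_ge0.
  - by apply: emeasurable_funD; apply/measurable_EFinP; apply: measurable_funM.
  rewrite ge0_integralD//; last 4 first.
  - by move=> x _; rewrite lee_fin mulr_ge0 ?sqdist_ge0 ?gaussp_ge0.
  - by apply/measurable_EFinP; apply: measurable_funM.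
  - by move=> x _; rewrite lee_fin mulr_ge0 ?gaussp_ge0.
  - by apply/measurable_EFinP; apply: measurable_funM.
  rewrite integral_gaussp_sqdist// integral_gaussp_cst// /sqdist.
  rewrite [X in ((X + _)%:E + _)%E]big1; last by move=> i _; rewrite subr0 expr0n.
  by rewrite add0r -EFinD -EFinM.
apply: ge0_le_integral => //.
- by move=> x _; rewrite lee_fin conditional_loss_ge0.
- apply: (measurableT_comp (measurable_conditional_loss mrho mdelta) (g := pair l)).
  exact: pair1_measurable.
- apply: emeasurable_funM => //.
  by apply: emeasurable_funD; apply/measurable_EFinP; apply: measurable_funM.
- move=> x _; rewrite conditional_lossE// -EFinD -EFinM lee_fin.
  rewrite (_ : (fun i => V l i + s i) = (fun=> s1 / l)); last first.
    by apply/funext => i; rewrite /V subrK.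
  rewrite -/(g x) -mulrDl; apply: ler_wpM2l => //; apply: ler_wpM2r; first exact: gaussp_ge0.
  exact: bayes_loss_shrinkage_le.
Qed.

(** The weight vanishes for [l <= expR (- N)], and above that level the loss averaged
    over [x] is bounded. *)
Lemma weighted_bayes_risk_lty : (weighted_bayes_risk rho delta < +oo)%E.
Proof.
pose M := expR N ^+ 2 * (\sum_(i < p) (s1 * expR N) + \sum_i s i).
have S0 : 0 <= \sum_i s i by apply: sumr_ge0 => i _; exact: ltW.
have M0 : 0 <= M.
  rewrite mulr_ge0 ?sqr_ge0// addr_ge0//; apply: sumr_ge0 => i _.
  by rewrite mulr_ge0 ?expR_ge0// ltW.
have f0 l x : D01 l -> (0 <= (conditional_loss rho (tnth (delta x)) x l)%:E)%E.
  by rewrite /D01 /= in_itv/= => l01; rewrite lee_fin conditional_loss_ge0.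
apply: (@le_lt_trans _ _ (\int[mu]_(l in D01) (cst M%:E) l)%E).
  apply: ge0_le_integral => //.
  - by move=> l Dl; apply: integral_ge0 => x _; exact: f0.
  - exact: (measurable_on_integral leb mD01 (measurable_conditional_loss mrho mdelta) f0).
  move=> l; rewrite /D01 /= in_itv/= => l01; have /andP[l0 l1] := l01.
  apply: (le_trans (integral_conditional_loss_shrinkage_le l01)); rewrite lee_fin.
  have [le|el] := leP l (expR (- N)); first by rewrite cutoff_small// expr0n mulr0 mul0r.
  have /andP[r0 r1] := rho01 l01.
  have li : l^-1 <= expR N by rewrite -[expR N]invrK -expRN lef_pV2 ?posrE ?expR_gt0// ltW.
  have li0 : 0 <= l^-1 by rewrite invr_ge0 ltW.
  have sl0 : 0 <= \sum_(i < p) (s1 / l) by apply: sumr_ge0 => i _; rewrite divr_ge0// ltW.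
  apply: ler_pM; [by rewrite mulr_ge0// invr_ge0 sqr_ge0|by rewrite addr_ge0| |].
    rewrite -[leRHS]mulr1; apply: ler_pM => //; first by rewrite invr_ge0 sqr_ge0.
    by rewrite -exprVn; apply: lerXn2r; rewrite ?nnegrE ?expR_ge0.
  by rewrite lerD2r; apply: ler_sum => i _; rewrite ler_wpM2l// ltW.
have muD : mu D01 = 1%:E by rewrite /D01 lebesgue_measure_itv/= lte_fin ltr01 -EFinB subr0.
by rewrite integral_cst// [X in (_ * X)%E]muD mule1 ltry.
Qed.

(** The squared distance between the two estimators is at most [s1 * z * d ^ 2], with
    [d] the change in the posterior mean of [l]; multiplied by [B b x], this is what
    [cutoff_bound] controls after division by [z]. *)
Lemma excess_risk_shrinkage_le :
  (excess_risk rho delta <= (8 * s1 / ((b + 1) * N))%:E)%E.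
Proof.
have b10 : 0 < b + 1 by move: b1; lra.
pose k := 16 * c * s1 / N ^+ 2.
have k0 : 0 <= k.
  by apply: divr_ge0; rewrite ?sqr_ge0//; apply: mulr_ge0; [apply: mulr_ge0 => //|]; exact: ltW.
have -> : (8 * s1 / ((b + 1) * N))%:E = (k%:E * (c^-1 / (2 * (b + 1)) * N)%:E)%E :> \bar R.
  by rewrite -EFinM; congr EFin; rewrite /k; field; rewrite !gt_eqF.
apply: (le_trans _ (lee_wpmul2l _ (integral_cutoff_zstat N0))); last by rewrite lee_fin.
have mS := @measurable_cutoff_support R N; have S01 := @cutoff_support01 R N.
have C0 x : 0 <= weighted_integral (cutoff_support N) b (z x) by exact: weighted_integral_ge0.
have mCz : measurable_fun setT (fun x =>
    (weighted_integral (cutoff_support N) b (z x) / z x)%:E).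
  apply/measurable_EFinP; apply: measurable_funM.
    exact: measurable_weighted_integral.
  rewrite (_ : (fun x => _) = (fun x => z x `^ (-1))).
    exact: (measurableT_comp (measurable_powR (-1)) (measurable_zstat s1)).
  by apply/funext => x; rewrite powR_inv1// zstat_ge0.
rewrite -ge0_integralZl//; last first.
  by move=> x _; rewrite lee_fin divr_ge0 ?zstat_ge0.
apply: ge0_le_integral => //.
- move=> x _; rewrite lee_fin mulr_ge0 ?sqdist_ge0// mulr_ge0 ?(ltW c0)//.
  exact: weighted_integral_ge0.
- exact: (measurable_weighted_sqdist mrho rho01 mdelta (measurable_weighted_bayes mrho rho01)).
- exact: emeasurable_funM.
move=> x _; rewrite -EFinM lee_fin.
have B0 : 0 < B b x by exact: cutoff_integral_gt0.
set d := B (b + 1) x / B b x - shrink b (z x).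
have dist : sqdist (tnth (delta x)) (tnth (weighted_bayes rho x)) <= d ^+ 2 * (s1 * z x).
  rewrite /zstat [s1 * _]mulrC divfK ?gt_eqF// mulr_sumr; apply: ler_sum => i _.
  rewrite deltaE tnth_mktuple.
  rewrite (_ : _ - _ = s i / s1 * (d * tnth x i)); last by rewrite /d; ring.
  have /andP[g0 g1] := ratio01 i.
  move: (s i / s1) g0 g1 => g g0 g1.
  by rewrite [leLHS]exprMn -[leRHS]exprMn ler_piMl ?sqr_ge0// expr_le1.
have cB0 : 0 <= c * B b x by rewrite mulr_ge0 ?ltW.
apply: (le_trans (ler_wpM2l cB0 dist)).
have [z0|zn] := eqVneq (z x) 0; first by rewrite z0 invr0 !mulr0.
have z0 : 0 < z x by rewrite lt_neqAle eq_sym zn zstat_ge0.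
have := cutoff_bound N0 b1 (ltW z0); rewrite -/d => H.
rewrite [leLHS](_ : _ = c * s1 / z x * (B b x * (z x * d) ^+ 2)); last by field.
rewrite [leRHS](_ : _ = c * s1 / z x * (16 / N ^+ 2 * weighted_integral (cutoff_support N) b (z x))).
  by rewrite ler_wpM2l// divr_ge0 ?zstat_ge0// mulr_ge0 ?ltW.
by rewrite /k; field; rewrite zn gt_eqF.
Qed.

End level.

Lemma sqdist_triangle (a d m : 'I_p -> R) :
  sqdist a d <= 2 * sqdist a m + 2 * sqdist d m.
Proof.
rewrite /sqdist !mulr_sumr -big_split /=; apply: ler_sum => i _.
rewrite -subr_ge0 (_ : _ - _ = (a i + d i - 2 * m i) ^+ 2) ?sqr_ge0//; ring.
Qed.

(** Both estimators are close to the Bayes estimator of level [N] in the weight of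
    that level, which is at least the weight of level 1. *)
Lemma dominating_ae_eq delta' : measurable_fun setT delta' ->
  (forall theta, (risk Sigma delta' theta <= risk Sigma delta theta)%E) ->
  {ae leb, forall x, delta' x = delta x}.
Proof.
move=> md' le.
have b10 : 0 < b + 1 by move: b1; lra.
pose B N x := weighted_integral (fun l => cutoff N l ^+ 2) b (z x).
have B0 N x : 0 < N -> 0 < B N x by move=> N0; exact: cutoff_integral_gt0.
have mr := @measurable_cutoff_sq R; have r01 := @cutoff_sq01 R.
pose f x := (c * B 1 x * sqdist (tnth (delta' x)) (tnth (delta x)))%:E.
have f0 x : (0 <= f x)%E.
  by rewrite lee_fin mulr_ge0 ?sqdist_ge0// mulr_ge0 ?ltW// B0.
have mf : measurable_fun setT f.
  exact: (measurable_weighted_sqdist (mr 1) (r01 1 ltr01) md' mdelta).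
have bound (N : R) : 1 <= N -> (\int[leb]_x f x <= (32 * s1 / ((b + 1) * N))%:E)%E.
  move=> N1; have N0 : 0 < N by exact: lt_le_trans ltr01 N1.
  have mN := mr N; have rN := r01 N N0.
  have mh := measurable_weighted_bayes mN rN.
  have excess := excess_risk_le mN rN md' mdelta (fun x => B0 N x N0)
    (weighted_bayes_risk_lty N0) le.
  have small := excess_risk_shrinkage_le N0.
  pose e d x := (c * B N x * sqdist (tnth (d x)) (tnth (weighted_bayes (fun l => cutoff N l ^+ 2) x)))%:E.
  have e0 d x : (0 <= e d x)%E.
    by rewrite lee_fin mulr_ge0 ?sqdist_ge0// mulr_ge0 ?ltW// B0.
  have me d : measurable_fun setT d -> measurable_fun setT (e d).
    by move=> md; exact: (measurable_weighted_sqdist mN rN md mh).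
  have me1 := me _ md'; have me2 := me _ mdelta.
  apply: (@le_trans _ _ (\int[leb]_x (2%:E * e delta' x + 2%:E * e delta x))%E).
    apply: ge0_le_integral => //.
    - by apply: emeasurable_funD; exact: emeasurable_funM.
    - move=> x _; rewrite -!EFinM -EFinD lee_fin.
      have BB : B 1 x <= B N x.
        apply: weighted_integral_le => //; [exact: r01|].
        move=> l /andP[l0 l1]; apply: lerXn2r; rewrite ?nnegrE ?cutoff_ge0//.
        by apply: le_cutoff_level => //; exact: ltW.
      have H := sqdist_triangle (tnth (delta' x)) (tnth (delta x))
        (tnth (weighted_bayes (fun l => cutoff N l ^+ 2) x)).
      rewrite !(mulrCA 2) -mulrDr.
      apply: ler_pM => //; [|exact: sqdist_ge0|].
        by rewrite mulr_ge0 ?(ltW c0)// ltW// B0.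
      by rewrite ler_wpM2l// ltW.
  rewrite ge0_integralD//; last 4 first.
  - by move=> x _; rewrite mule_ge0.
  - exact: emeasurable_funM.
  - by move=> x _; rewrite mule_ge0.
  - exact: emeasurable_funM.
  rewrite !ge0_integralZl_EFin//.
  apply: (@le_trans _ _ (2%:E * (8 * s1 / ((b + 1) * N))%:E + 2%:E * (8 * s1 / ((b + 1) * N))%:E)%E).
    by apply: leeD; apply: lee_wpmul2l => //; exact: le_trans excess small.
  rewrite -!EFinM -EFinD lee_fin le_eqVlt; apply/orP; left; apply/eqP.
  by field; rewrite !gt_eqF.
have intf0 : (\int[leb]_x f x = 0)%E.
  apply/eqP; rewrite eq_le integral_ge0 ?andbT//.
  apply/lee_addgt0Pr => e e0; rewrite add0e.
  (* the term 1 ensures [1 <= N]; the other makes the bound at most [e] *)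
  pose N := 1 + 32 * s1 / ((b + 1) * e).
  have q0 : 0 <= 32 * s1 / ((b + 1) * e).
    by apply: divr_ge0; apply: mulr_ge0 => //; exact: ltW.
  have N1 : 1 <= N by rewrite lerDl.
  have N0 : 0 < N by exact: lt_le_trans ltr01 N1.
  apply: (le_trans (bound N N1)); rewrite lee_fin.
  have bN : 0 < (b + 1) * N by exact: mulr_gt0.
  rewrite ler_pdivrMr// (_ : e * _ = (b + 1) * e + 32 * s1).
    by rewrite lerDr mulr_ge0// ltW.
  by rewrite /N; field; rewrite !gt_eqF.
have [+ _] := ae_eq_integral_abs leb measurableT mf.
have -> : (\int[leb]_x `|f x| = 0)%E.
  by rewrite -intf0; apply: eq_integral => x _; rewrite gee0_abs.
move=> /(_ erefl); apply: filterS => x /(_ I) /eqP.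
rewrite /f eqe mulf_eq0 gt_eqF ?mulr_gt0 ?B0//= psumr_eq0; last by move=> i _; exact: sqr_ge0.
move=> /allP H; apply: eq_from_tnth => i.
by have := H i (mem_index_enum i); rewrite /= sqrf_eq0 subr_eq0 => /eqP.
Qed.

Lemma ae_eq_risk delta1 delta2 theta :
  measurable_fun setT delta1 -> measurable_fun setT delta2 ->
  {ae leb, forall x, delta1 x = delta2 x} ->
  risk Sigma delta1 theta = risk Sigma delta2 theta.
Proof.
move=> m1 m2 e12; rewrite !riskE//.
have m d : measurable_fun setT d -> measurable_fun setT (fun x =>
    (sqdist (tnth (d x)) (tnth theta) * gaussp (tnth theta) s x)%:E).
  move=> md; apply: (measurableT_comp (measurable_loss_integrand s md) (g := pair theta)).
  exact: pair1_measurable.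
apply: ae_eq_integral => //; [exact: m..|].
by apply: filterS e12 => x -> _.
Qed.

Lemma admissible_shrinkage : admissible Sigma delta.
Proof.
split=> // -[delta' [md' le [theta]]].
by rewrite (ae_eq_risk theta md' mdelta (dominating_ae_eq md' le)) ltxx.
Qed.

End admissibility.

End hierarchical.

(** * The estimator and the theorem *)

Section delta_star.
Context {R : realType} {p : nat}.
Variables (s1 : R) (s : 'I_p -> R).
Hypotheses (s10 : 0 < s1) (s0 : forall i, 0 < s i).
Local Notation Sigma := (diag_mx (\row_i s i)).

Lemma diag_unitmx : Sigma \in unitmx.
Proof.
rewrite unitmxE det_diag unitfE; apply: lt0r_neq0; apply: prodr_gt0 => i _.
by rewrite mxE.
Qed.

Lemma phi_star_shrink (z : R) : z != 0 ->
  phi_star p z / z = shrink (p%:R / 2 - 2) z.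
Proof.
move=> z0; rewrite /phi_star mulrAC mulfV// mul1r /shrink /kernel_integral.
by rewrite (_ : p%:R / 2 - 2 + 1 = p%:R / 2 - 1 :> R)//; ring.
Qed.

Lemma delta_starE (x : p.-tuple R) i :
  tnth (delta_star s1 Sigma x) i =
  tnth x i - s i / s1 * shrink (p%:R / 2 - 2) (zstat s1 x) * tnth x i.
Proof.
rewrite tnth_mktuple /delta_star.
have -> : ((colv x)^T *m (s1^-1 *: Sigma) *m invmx Sigma *m colv x) 0 0 = zstat s1 x.
  rewrite -scalemxAr -!scalemxAl mulmxK ?diag_unitmx// !mxE mulrC; congr (_ * _).
  by apply: eq_bigr => j _; rewrite !mxE.
rewrite mulmxBl mul1mx -!scalemxAl mul_diag_mx !mxE.
(* the quotient [phi_star p z / z] is not [shrink] at 0, where [x = 0] *)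
have [z0|z0] := eqVneq (zstat s1 x) 0; last by rewrite phi_star_shrink//; ring.
have -> : tnth x i = 0; last by rewrite !mulr0.
have := sqr_coord_zstat s10 x i; rewrite z0 mulr0 => xi.
by apply/eqP; rewrite -sqrf_eq0 eq_le xi sqr_ge0.
Qed.

Lemma measurable_delta_star : 3 <= p%:R :> R -> measurable_fun setT (delta_star s1 Sigma).
Proof.
move=> p3; apply/measurable_fun_tnthP => i; rewrite (_ : _ \o _ = fun x =>
    tnth x i - s i / s1 * shrink (p%:R / 2 - 2) (zstat s1 x) * tnth x i); last first.
  by apply/funext => x; exact: delta_starE.
have b1 : -1 < p%:R / 2 - 2 :> R by lra.
apply: measurable_funB; first exact: measurable_tnth.
apply: measurable_funM; last exact: measurable_tnth.
by apply: measurable_funM => //; exact: measurable_shrink.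
Qed.

End delta_star.

Theorem theorem3p3 (R : realType) (p : nat) (hp : (3 <= p)%N)
    (sigma : 'I_p -> R)
    (sigma_decr : forall i j : 'I_p, (i < j)%N -> sigma j ^+ 2 < sigma i ^+ 2)
    (sigma_pos : forall i : 'I_p, 0 < sigma i ^+ 2) :
  let i1 := first_ord hp in
  let s1 := sigma i1 ^+ 2 in
  let Sigma : 'M[R]_p := diag_mx (\row_i sigma i ^+ 2) in
  let delta := delta_star s1 Sigma in
  [/\ generalized_bayes Sigma (fun l : R => (s1 / l)%:M - Sigma)
        (fun l : R => l ^- 2) `]0, 1[ delta,
      ensemble_minimax Sigma delta,
      p%:R - 2 <= 2 * (\sum_i sigma i ^+ 4 / sigma i1 ^+ 4 - 2) ->
        minimax Sigma delta &
      admissible Sigma delta].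
Proof.
move=> i1 s1 Sigma delta.
pose s i := sigma i ^+ 2; pose b : R := p%:R / 2 - 2.
have s0 i : 0 < s i by exact: sigma_pos.
have s10 : 0 < s1 by exact: sigma_pos.
have ss1 i : s i <= s1.
  have [i0|ip] := posnP i; last by apply: ltW; exact: sigma_decr.
  by rewrite (_ : i = i1)//; exact: val_inj.
have p3 : 3 <= p%:R :> R by rewrite ler_nat.
have b1 : -1 < b by rewrite /b; lra.
have bp : 2 * (b + 1) = p%:R - 2 by rewrite /b; lra.
have p2 : 2 < p%:R :> R by lra.
have mdelta : measurable_fun setT delta by exact: measurable_delta_star.
have deltaE : forall x i, tnth (delta x) i =
    tnth x i - s i / s1 * shrink b (zstat s1 x) * tnth x i.
  by move=> x i; exact: delta_starE.
split.
- apply: (generalized_bayes_flat_weight s10 b1 bp s0 ss1 mdelta) => x.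
  apply: eq_from_tnth => i; rewrite deltaE tnth_mktuple !weighted_integral1 /shrink.
  by ring.
- apply: ensemble_minimax_of_le => // tau tau0.
  by apply: ensemble_risk_shrinkage_le deltaE _ tau0.
- move=> cond; apply: minimax_of_risk_le => // theta.
  apply: (risk_shrinkage_le (s1 := s1) (b := b)) => //.
  rewrite (_ : \sum_i _ = \sum_i sigma i ^+ 4 / sigma i1 ^+ 4)//.
  by apply: eq_bigr => i _; rewrite -!exprM.
- exact: (admissible_shrinkage s10 b1 bp s0 ss1 mdelta deltaE).
Qed.
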